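(* The algebra $\mathrm{A}(O_N^+)$, $N\ge2$, is not weakly amenable.
   Context: $O_N^+$ is Wang's free orthogonal quantum group: $\mathrm{Pol}(O_N^+)$ is the universal unital $*$-algebra generated by self-adjoint $x_{jk}$ ($1\le j,k\le N$) such that $[x_{jk}]$ is unitary, with $\Delta(x_{jk})=\sum_l x_{jl}\otimes x_{lk}$. For a compact quantum group $\mathbb{G}$, fix unitary irreducible representatives $U^\alpha=[u^\alpha_{ij}]\in M_{n_\alpha}(\mathrm{Pol}(\mathbb{G}))$, $\alpha\in\mathrm{Irr}(\mathbb{G})$. $\ell^\infty(\widehat{\mathbb{G}})=\ell^\infty\text{-}\bigoplus_\alpha M_{n_\alpha}$ with matrix units $e^\alpha_{ij}$, and the dual coproduct $\widehat\Delta:\ell^\infty(\widehat{\mathbb{G}})\to\ell^\infty(\widehat{\mathbb{G}})\overline\otimes\ell^\infty(\widehat{\mathbb{G}})$ is the normal unital $*$-homomorphism determined by $\sum\widehat\Delta(e^\alpha_{ij})\otimes u^\alpha_{ij}=\sum e^\beta_{kl}\otimes e^\gamma_{pq}\otimes u^\beta_{kl}u^\gamma_{pq}$. The Fourier algebra $\mathrm{A}(\mathbb{G})=\ell^1(\widehat{\mathbb{G}})$ is the predual of $\ell^\infty(\widehat{\mathbb{G}})$ with product $\widehat\Delta_*$. A Banach algebra $\mathcal{B}$ is weakly amenable if every bounded derivation $D:\mathcal{B}\to\mathcal{B}^*$ is inner, i.e. of the form $D(b)=b\cdot Y-Y\cdot b$ for some $Y\in\mathcal{B}^*$. *)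

(* Defs.v *)
From HB Require Import structures.
From mathcomp Require Import all_boot all_order all_algebra finmap.
From mathcomp Require Import mxtens complex.
From mathcomp Require Import all_classical all_reals all_analysis.
From mathcomp.analysis.showcase Require summability.

Set Implicit Arguments.
Unset Strict Implicit.
Unset Printing Implicit Defensive.

Import Order.TTheory GRing.Theory Num.Theory.
Import numFieldNormedType.Exports.

Local Open Scope classical_set_scope.
Local Open Scope ring_scope.

Record banachAlgebra (K : numFieldType) := BanachAlgebra {
  ba_space :> completeNormedModType K;
  ba_mul : ba_space -> ba_space -> ba_space;
  ba_mulA : associative ba_mul;
  ba_mul_bilinear : bilinear_for *:%R *:%R ba_mul;
  ba_mul_norm : forall a b, `|ba_mul a b| <= `|a| * `|b| }.

Section WeakAmenability.
Variables (K : numFieldType) (B : banachAlgebra K).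
Implicit Types (a b x : B) (f Y : B -> K).

Definition dual f := linear (f : B -> K^o) /\ continuous (f : B -> K^o).

Definition dual_lact a f : B -> K := fun x => f (ba_mul x a).
Definition dual_ract f a : B -> K := fun x => f (ba_mul a x).

Definition bounded_derivation (D : B -> B -> K) :=
  [/\ forall a, dual (D a),
      forall (c : K) a b x, D (c *: a + b) x = c * D a x + D b x,
      exists M : K, forall a x, `|D a x| <= M * `|a| * `|x|
    & forall a b x,
        D (ba_mul a b) x = dual_lact a (D b) x + dual_ract (D a) b x].

Definition inner_derivation (D : B -> B -> K) :=
  exists2 Y, dual Y & forall b x, D b x = dual_lact b Y x - dual_ract Y b x.

Definition weakly_amenable :=
  forall D, bounded_derivation D -> inner_derivation D.

End WeakAmenability.

HB.mixin Record Algebra_isStarAlgebra (C : numClosedFieldType) A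
    of GRing.Algebra C A := {
  star : A -> A;
  starK : involutive star;
  starD : {morph star : a b / a + b};
  starZ : forall (c : C) a, star (c *: a) = c^* *: star a;
  starM : forall a b, star (a * b) = star b * star a }.

#[short(type="starAlgType")]
HB.structure Definition StarAlgebra (C : numClosedFieldType) :=
  {A of Algebra_isStarAlgebra C A & GRing.Algebra C A}.

Section StarAlgebras.
Variable C : numClosedFieldType.

Definition star_morphism (A B : starAlgType C) (f : A -> B) :=
  {morph f : a / star a}.

Definition star_mx (A : starAlgType C) m n (U : 'M[A]_(m, n)) : 'M[A]_(n, m) :=
  \matrix_(i, j) star (U j i).

Definition unitary_mx (A : starAlgType C) n (U : 'M[A]_n) :=
  U *m star_mx U = 1%:M /\ star_mx U *m U = 1%:M.

Record is_tensor_product (A B T : starAlgType C) (t : A -> B -> T) : Prop := {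
  tens_bilinear : bilinear_for *:%R *:%R t;
  tens_exists : forall (V : lmodType C) (f : A -> B -> V),
    bilinear_for *:%R *:%R f ->
    exists g : {linear T -> V}, forall a b, g (t a b) = f a b;
  tens_unique : forall (V : lmodType C) (g h : {linear T -> V}),
    (forall a b, g (t a b) = h (t a b)) -> g =1 h;
  tens_one : t 1 1 = 1;
  tens_mul : forall a a' b b', t a b * t a' b' = t (a * a') (b * b');
  tens_star : forall a b, star (t a b) = t (star a) (star b) }.

(* A quantum group is given by its *-algebra of polynomial functions and the
   coproduct. Coassociativity and the spanning property of the matrix
   coefficients are not required here: for O_N^+ they follow from the formula
   defining Delta. *)
Record quantumGroup := QuantumGroup {
  Pol : starAlgType C;
  Pol2 : starAlgType C;
  tens : Pol -> Pol -> Pol2;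
  tensP : is_tensor_product tens;
  Delta : {lrmorphism Pol -> Pol2};
  Delta_star : star_morphism Delta }.

Definition orthogonal_relations (A : starAlgType C) N (x : 'M[A]_N) :=
  (forall j k, star (x j k) = x j k) /\ unitary_mx x.

Record is_free_orthogonal (N : nat) (G : quantumGroup) (x : 'M[Pol G]_N)
    : Prop := {
  fo_relations : orthogonal_relations x;
  fo_exists : forall (B : starAlgType C) (y : 'M[B]_N),
    orthogonal_relations y ->
    exists2 f : {lrmorphism Pol G -> B},
      star_morphism f & forall j k, f (x j k) = y j k;
  fo_unique : forall (B : starAlgType C) (f g : {lrmorphism Pol G -> B}),
    star_morphism f -> star_morphism g ->
    (forall j k, f (x j k) = g (x j k)) -> f =1 g;
  fo_Delta : forall j k,
    Delta G (x j k) = \sum_(l < N) tens (x j l) (x l k) }.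

Variable G : quantumGroup.

Definition is_unitary_rep n (U : 'M[Pol G]_n) :=
  unitary_mx U /\
  forall i j, Delta G (U i j) = \sum_(k < n) tens (U i k) (U k j).

Definition intertwiner m n (U : 'M[Pol G]_n) (V : 'M[Pol G]_m)
    (T : 'M[C]_(m, n)) :=
  map_mx (fun c => c%:A) T *m U = V *m map_mx (fun c => c%:A) T.

Definition irreducible_rep n (U : 'M[Pol G]_n) :=
  (0 < n)%N /\
  forall T : 'M[C]_n, intertwiner U U T -> exists c, T = c%:M.

Definition equivalent_reps m n (U : 'M[Pol G]_n) (V : 'M[Pol G]_m) :=
  exists (T : 'M[C]_(m, n)) (S : 'M[C]_(n, m)),
    [/\ T *m S = 1%:M, S *m T = 1%:M & intertwiner U V T].

(* U is a choice, indexed by I = Irr(G), of one unitary representative in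
   each equivalence class of irreducible representations *)
Record is_Irr (I : choiceType) (n : I -> nat)
    (U : forall alpha, 'M[Pol G]_(n alpha)) : Prop := {
  Irr_unitary : forall alpha, is_unitary_rep (U alpha);
  Irr_irreducible : forall alpha, irreducible_rep (U alpha);
  Irr_distinct : forall alpha beta,
    equivalent_reps (U alpha) (U beta) -> alpha = beta;
  Irr_exhaustive : forall m (V : 'M[Pol G]_m),
    is_unitary_rep V -> irreducible_rep V ->
    exists alpha, equivalent_reps (U alpha) V }.

End StarAlgebras.

Section MatrixSums.
Variable R : realType.
Local Notation C := R[i].

Definition l2norm n (v : 'cV[C]_n) : R :=
  Num.sqrt (\sum_i Normc.normc (v i 0) ^+ 2).

Definition opnorm n (y : 'M[C]_n) : R :=
  sup [set l2norm (y *m v) | v in [set v | l2norm v <= 1]].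

Definition mxpair n (a y : 'M[C]_n) : C := \sum_i \sum_j a i j * y i j.

(* norm of the predual of M_n, identified with M_n through mxpair; this is the
   trace norm *)
Definition predual_norm n (a : 'M[C]_n) : R :=
  sup [set Normc.normc (mxpair a y) | y in [set y | opnorm y <= 1]].

Section Families.
Variables (I : choiceType) (n : I -> nat).

Definition mxfamily := forall alpha : I, 'M[C]_(n alpha).

Definition linfty : set mxfamily :=
  [set y | exists M : R, forall alpha, opnorm (y alpha) <= M].

Definition l1norm (a : mxfamily) : \bar R :=
  (\esum_(alpha in [set: I]) (predual_norm (a alpha))%:E)%R.

Definition l1 : set mxfamily := [set a | (l1norm a < +oo)%E].

(* the sum is the limit of the net of finite partial sums *)
Definition pairing (a y : mxfamily) : C :=
  summability.sum (fun alpha => mxpair (a alpha) (y alpha) : C^o).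

Definition mxunit alpha (i j : 'I_(n alpha)) : mxfamily :=
  @dfwith I (fun beta => 'M[C]_(n beta)) (fun=> 0) alpha (delta_mx i j).

Definition fam_one : mxfamily := fun=> 1%:M.
Definition fam_lin (c : C) (y z : mxfamily) : mxfamily :=
  fun alpha => c *: y alpha + z alpha.
Definition fam_mul (y z : mxfamily) : mxfamily :=
  fun alpha => y alpha *m z alpha.
Definition fam_adj (y : mxfamily) : mxfamily :=
  fun alpha => map_mx Num.conj (y alpha)^T.

End Families.

(* index of the blocks of l^oo(n) (x) l^oo(n) = l^oo-(+) M_(n b) (x) M_(n c);
   M_p (x) M_q is identified with M_(p * q) through mxtens_index *)
Definition dim2 (I : choiceType) (n : I -> nat) (p : I * I) : nat :=
  (n p.1 * n p.2)%N.

Definition fam_tens (I : choiceType) (n : I -> nat) (a b : mxfamily n) :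
  mxfamily (dim2 n) := fun p => a p.1 *t b p.2.

End MatrixSums.

Section Fourier.
Variables (R : realType) (G : quantumGroup R[i]).
Variables (I : choiceType) (n : I -> nat).
Variable U : forall alpha, 'M[Pol G]_(n alpha).

(* D need only be specified on l^oo.
   dc_normal: a weak*-continuous functional on l^oo is one given by an element
   of l^1, so D is weak*-continuous iff it pulls l^1 back into l^1.
   dc_finite, dc_coef: the identity
     sum D(e^alpha_ij) (x) u^alpha_ij
       = sum e^beta_kl (x) e^gamma_pq (x) u^beta_kl u^gamma_pq,
   read at each matrix entry, where the left-hand sum is finite. *)
Record is_dual_coproduct (D : mxfamily R n -> mxfamily R (dim2 n)) : Prop := {
  dc_linfty : forall y, linfty y -> linfty (D y);
  dc_linear : forall c y z, linfty y -> linfty z ->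
    D (fam_lin c y z) = fam_lin c (D y) (D z);
  dc_one : D (fam_one R n) = fam_one R (dim2 n);
  dc_mul : forall y z, linfty y -> linfty z ->
    D (fam_mul y z) = fam_mul (D y) (D z);
  dc_adj : forall y, linfty y -> D (fam_adj y) = fam_adj (D y);
  dc_normal : forall w, l1 w -> exists2 c, l1 c &
    forall y, linfty y -> pairing w (D y) = pairing c y;
  dc_finite : forall p : I * I,
    finite_set [set alpha | exists i j : 'I_(n alpha),
                              D (mxunit R i j) p <> 0];
  dc_coef : forall (beta gamma : I)
      (k l : 'I_(n beta)) (p q : 'I_(n gamma)),
    \sum_(alpha \in [set: I]) \sum_(i < n alpha) \sum_(j < n alpha)
      D (mxunit R i j) (beta, gamma) (mxtens_index (k, p)) (mxtens_index (l, q))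
        *: U alpha i j
    = U beta k l * U gamma p q }.

(* Phi identifies A isometrically with l^1, its product being the preadjoint
   of the dual coproduct *)
Record is_Fourier_algebra (D : mxfamily R n -> mxfamily R (dim2 n))
    (A : banachAlgebra R[i]) (Phi : A -> mxfamily R n) : Prop := {
  fa_linear : forall c a b, Phi (c *: a + b) = fam_lin c (Phi a) (Phi b);
  fa_range : range Phi = @l1 R I n;
  fa_norm : forall a, `|a| = real_complex R (fine (l1norm (Phi a)));
  fa_mul : forall a b y, linfty y ->
    pairing (Phi (ba_mul a b)) y = pairing (fam_tens (Phi a) (Phi b)) (D y) }.

End Fourier.

(* Main.v *)
(* Let h be the Haar state of O_N^+, which is a trace, H an antisymmetric matrix
   and eta the derivation at the counit with eta (x j k) = H j k. Then
   delta = (id (x) eta) Delta is a derivation of Pol(O_N^+), and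
   D(a)(b) = h(delta(a) b) satisfies the derivation identity.

   D is bounded: by the orthogonality relations it is bounded on the block of
   U alpha by the norm of eta(U alpha) divided by n alpha. Symmetric matrices
   also act on every representation, through functionals which are derivations
   twisted by the parity character (-1)^degree; with H they span a copy of sl_2,
   so the eigenvalues of eta(U alpha) are weights of a representation of
   dimension n alpha.

   D is not inner: sum_j x j k * x j q is a scalar symmetric in k and q, so
   sum_j D(x j k)(x j q) would vanish, whereas it equals H q k.

   Linear independence of the coefficients of the U alpha is not used. Instead h
   is the coefficient of the trivial representation in the Fourier algebra: the
   dual coproduct decomposes U beta (x) U gamma, and maps the trivial block to
   the projection onto the invariant vectors. *)
From HB Require Import structures.
From mathcomp Require Import all_boot all_order all_algebra finmap.
From mathcomp Require Import mxtens complex ring lra.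
From mathcomp Require Import all_classical all_reals all_analysis.
From mathcomp.analysis.showcase Require summability.
Require Import Defs.

Set Implicit Arguments.
Unset Strict Implicit.
Unset Printing Implicit Defensive.

Import Order.TTheory GRing.Theory Num.Theory.
Import numFieldNormedType.Exports.

Local Open Scope classical_set_scope.
Local Open Scope ring_scope.

(** * Star-algebras and generation of Pol(O_N^+) *)

(** A bound of eta(U alpha) by n alpha could also be reached by comparing n alpha with the degree of
    U alpha in the generators, but that requires the fusion rules of O_N^+. The sl_2 argument
    extracts it from the dimension alone, for any unitary representation. It asks for a hermitian
    antisymmetric H completed by two symmetric matrices to an sl_2-triple; two isotropic vectors
    conjugate to each other supply it as soon as N >= 2.

    The division by n alpha comes from Schur's lemma. The invariant vectors of U beta (x) U gamma
    form a space of dimension at most one, spanned, when nonzero, by a multiple of a unitary matrix;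
    this uses that O_N^+ is of Kac type. The same description shows that h is a trace.

    Counit, antipode and eta are not part of the data: each is obtained from the universal property,
    as a morphism into a suitable *-algebra, and identified by uniqueness on generators. In the
    Fourier algebra delta is unbounded, so identities are checked on matrix units and extended by
    continuity of the form h(delta(a) b). Its boundedness therefore comes before the derivation
    identity. *)

Lemma starL (C : numClosedFieldType) (A : starAlgType C) (c : C) (a b : A) :
  star (c *: a + b) = c^* *: star a + star b.
Proof. by rewrite starD starZ. Qed.

Lemma star0 (C : numClosedFieldType) (A : starAlgType C) : star (0 : A) = 0.
Proof. by apply: (addIr (star (0 : A))); rewrite -starD !add0r. Qed.

Lemma star1 (C : numClosedFieldType) (A : starAlgType C) : star (1 : A) = 1.
Proof. by rewrite -[LHS]mul1r -{1}[1]starK -starM mul1r starK. Qed.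

Lemma star_sum (C : numClosedFieldType) (A : starAlgType C) (J : Type)
    (r : seq J) (Q : pred J) (F : J -> A) :
  star (\sum_(i <- r | Q i) F i) = \sum_(i <- r | Q i) star (F i).
Proof. exact: (big_morph star (@starD C A) (star0 A)). Qed.

Section SubStarAlgebra.
Variables (C : numClosedFieldType) (A : starAlgType C) (S : subalgClosed A).

(** A *-closed subalgebra as a *-algebra of its own, to serve as a target for the universal
    property. [hS] is a parameter of the type so that the involution can be attached to it as an
    instance. *)
Record sub_star (hS : {in S, forall a : A, star a \in S}) :=
  SubStar { sub_star_val : A; _ : sub_star_val \in S }.

Variable hS : {in S, forall a : A, star a \in S}.
Local Notation T := (sub_star hS).

HB.instance Definition _ := [isSub for @sub_star_val hS].
HB.instance Definition _ := [Choice of T by <:].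
HB.instance Definition _ := [SubChoice_isSubAlgebra of T by <:].

Definition sub_star_op (u : T) : T := SubStar hS (hS (valP u)).

Fact sub_star_opK : involutive sub_star_op.
Proof. by move=> u; apply/val_inj; rewrite /= starK. Qed.
Fact sub_star_opD : {morph sub_star_op : a b / a + b}.
Proof. by move=> a b; apply/val_inj; rewrite /= starD. Qed.
Fact sub_star_opZ (c : C) a : sub_star_op (c *: a) = c^* *: sub_star_op a.
Proof. by apply/val_inj; rewrite /= starZ. Qed.
Fact sub_star_opM a b : sub_star_op (a * b) = sub_star_op b * sub_star_op a.
Proof. by apply/val_inj; rewrite /= starM. Qed.

HB.instance Definition _ := Algebra_isStarAlgebra.Build C T
  sub_star_opK sub_star_opD sub_star_opZ sub_star_opM.

Definition sub_star_incl (u : T) : A := \val u.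
HB.instance Definition _ := GRing.RMorphism.copy sub_star_incl
  (\val : {rmorphism T -> A}).
HB.instance Definition _ := GRing.isScalable.Build C T A *:%R sub_star_incl
  (@GRing.valZ _ _ _ T).

End SubStarAlgebra.

Section ConjugateAlgebra.
Variables (C : numClosedFieldType) (A : starAlgType C).

(** Scalars act through their conjugates, so that a conjugate-linear multiplicative map into [A]
    becomes a morphism into [conj_alg]. *)
Definition conj_alg : Type := A.
HB.instance Definition _ := GRing.NzRing.copy conj_alg A.

Definition conj_scale (c : C) (a : conj_alg) : conj_alg := (c^* *: (a : A)).

Fact conj_scaleA a b v :
  conj_scale a (conj_scale b v) = conj_scale (a * b) v.
Proof. by rewrite /conj_scale scalerA rmorphM. Qed.
Fact conj_scale1 : left_id 1 conj_scale.
Proof. by move=> v; rewrite /conj_scale rmorph1 scale1r. Qed.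
Fact conj_scaleDr : right_distributive conj_scale +%R.
Proof. by move=> a u v; exact: scalerDr. Qed.
Fact conj_scaleDl v : {morph conj_scale^~ v : a b / a + b}.
Proof. by move=> a b; rewrite /conj_scale rmorphD scalerDl. Qed.
HB.instance Definition _ := GRing.Zmodule_isLmodule.Build C conj_alg
  conj_scaleA conj_scale1 conj_scaleDr conj_scaleDl.

Fact conj_scaleAl (a : C) (u v : conj_alg) : a *: (u * v) = (a *: u) * v.
Proof. exact: (@scalerAl C A). Qed.
HB.instance Definition _ := GRing.Lmodule_isLalgebra.Build C conj_alg
  conj_scaleAl.
Fact conj_scaleAr (a : C) (u v : conj_alg) : a *: (u * v) = u * (a *: v).
Proof. exact: (@scalerAr C A). Qed.
HB.instance Definition _ := GRing.Lalgebra_isAlgebra.Build C conj_alg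
  conj_scaleAr.

Definition conj_star (a : conj_alg) : conj_alg := star (a : A).
Fact conj_starK : involutive conj_star. Proof. exact: (@starK C A). Qed.
Fact conj_starD : {morph conj_star : a b / a + b}.
Proof. exact: (@starD C A). Qed.
Fact conj_starZ (c : C) a : conj_star (c *: a) = c^* *: conj_star a.
Proof. exact: (@starZ C A). Qed.
Fact conj_starM a b : conj_star (a * b) = conj_star b * conj_star a.
Proof. exact: (@starM C A). Qed.
HB.instance Definition _ := Algebra_isStarAlgebra.Build C conj_alg
  conj_starK conj_starD conj_starZ conj_starM.

End ConjugateAlgebra.

Section Adjoint.
Variable C : numClosedFieldType.

Definition adjm m n (a : 'M[C]_(m, n)) : 'M[C]_(n, m) := map_mx Num.conj a^T.

Lemma adjmK m n (a : 'M[C]_(m, n)) : adjm (adjm a) = a.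
Proof. by apply/matrixP => i j; rewrite !mxE conjCK. Qed.

Lemma adjmM m n p (a : 'M[C]_(m, n)) (b : 'M[C]_(n, p)) :
  adjm (a *m b) = adjm b *m adjm a.
Proof. by rewrite /adjm trmx_mul map_mxM. Qed.

Lemma adjmE m n (a : 'M[C]_(m, n)) i j : adjm a i j = (a j i)^*.
Proof. by rewrite !mxE. Qed.

End Adjoint.

(* [M_2 x M_2] with the involution exchanging the factors: an orthogonal
   matrix over it is the same as a matrix [m] over [M_2] with
   [m *m m^T = m^T *m m = 1], so it need not be unitary over [C]. *)
Section DoubleAlgebra.
Variable C : numClosedFieldType.

Definition dbl_alg : Type := ('M[C]_2 * 'M[C]_2)%type.
HB.instance Definition _ := GRing.Algebra.copy dbl_alg ('M[C]_2 * 'M[C]_2)%type.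

Definition dbl_star (a : dbl_alg) : dbl_alg := (adjm a.2, adjm a.1).

Fact dbl_starK : involutive dbl_star.
Proof. by case=> a b; rewrite /dbl_star /= !adjmK. Qed.
Fact dbl_starD : {morph dbl_star : a b / a + b}.
Proof.
by move=> a b; apply: injective_projections; apply/matrixP => i j;
  rewrite !mxE rmorphD.
Qed.
Fact dbl_starZ (c : C) a : dbl_star (c *: a) = c^* *: dbl_star a.
Proof.
by apply: injective_projections; apply/matrixP => i j; rewrite !mxE rmorphM.
Qed.
Fact dbl_starM a b : dbl_star (a * b) = dbl_star b * dbl_star a.
Proof.
by apply: injective_projections; rewrite /= /adjm trmx_mul map_mxM.
Qed.
HB.instance Definition _ := Algebra_isStarAlgebra.Build C dbl_alg
  dbl_starK dbl_starD dbl_starZ dbl_starM.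

End DoubleAlgebra.

Section FreeOrthogonal.
Variables (C : numClosedFieldType) (N : nat) (G : quantumGroup C).
Variables (x : 'M[Pol G]_N) (hG : is_free_orthogonal x).

Lemma fo_star j k : star (x j k) = x j k.
Proof. by case: (fo_relations hG) => h _; apply: h. Qed.

Lemma fo_row j k : \sum_l x j l * x k l = (j == k)%:R.
Proof.
have [_ [/matrixP/(_ j k)]] := fo_relations hG; rewrite !mxE => + _ => <-.
by apply: eq_bigr => l _; rewrite mxE fo_star.
Qed.

Lemma fo_col j k : \sum_l x l j * x l k = (j == k)%:R.
Proof.
have [_ [_ /matrixP/(_ j k)]] := fo_relations hG; rewrite !mxE => <-.
by apply: eq_bigr => l _; rewrite mxE fo_star.
Qed.

(** The span of the words in the generators. Letters are added on the left only, which turns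
    recursions on [x j k * a] into an induction principle. *)
Inductive generated : Pol G -> Prop :=
| generated1 : generated 1
| generatedL c a b : generated a -> generated b -> generated (c *: a + b)
| generatedM j k a : generated a -> generated (x j k * a).

Lemma generatedMM a b : generated a -> generated b -> generated (a * b).
Proof.
move=> ga gb; elim: ga => [|c u v _ hu _ hv|j k u _ hu].
- by rewrite mul1r.
- by rewrite mulrDl -scalerAl; apply: generatedL.
- by rewrite -mulrA; apply: generatedM.
Qed.

Lemma generated_star a : generated a -> generated (star a).
Proof.
elim=> [|c u v _ hu _ hv|j k u _ hu].
- by rewrite star1; apply: generated1.
- by rewrite starL; apply: generatedL.
- rewrite starM fo_star; apply: generatedMM => //.
  by rewrite -[x j k]mulr1; apply/generatedM/generated1.
Qed.

(** The span of the words is a *-subalgebra containing the generators. The universal property maps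
    Pol(O_N^+) into it; followed by the inclusion, this map fixes the generators, hence is the
    identity. *)
Lemma generated_all a : generated a.
Proof.
pose S : {pred Pol G} := fun a => `[< generated a >].
have SP u : reflect (generated u) (u \in S) by exact: asboolP.
have g0 : generated 0.
  by rewrite -[0](subrr 1) addrC -scaleN1r;
    apply: generatedL; exact: generated1.
have S_alg : GRing.subsemialg_closed S.
  split.
  - apply/SP; exact: generated1.
  - split=> [|u v /SP hu /SP hv]; apply/SP => //.
    by rewrite -[u]scale1r; apply: generatedL.
  - by move=> c u /SP hu; apply/SP; rewrite -[_ *: _]addr0; apply: generatedL.
  - by move=> u v /SP hu /SP hv; apply/SP/generatedMM.
pose SA : subalgClosed (Pol G) := HB.pack_for (subalgClosed (Pol G)) S
  (GRing.isSubalgClosed.Build C (Pol G) S S_alg).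
have hS : {in SA, forall a : Pol G, star a \in SA}.
  by move=> u /SP hu; apply/SP/generated_star.
have xS j k : x j k \in SA.
  by apply/SP; rewrite -[x j k]mulr1; apply/generatedM/generated1.
pose B : starAlgType C := sub_star hS.
pose y : 'M[B]_N := \matrix_(j, k) SubStar hS (xS j k).
have hy : orthogonal_relations y.
  split=> [j k|]; first by apply/val_inj; rewrite mxE /= fo_star.
  split; apply/matrixP => j k; apply/val_inj; rewrite !mxE raddf_sum /=.
  - under eq_bigr do rewrite !mxE /= fo_star.
    by rewrite fo_row; case: (j == k).
  - under eq_bigr do rewrite !mxE /= fo_star.
    by rewrite fo_col; case: (j == k).
have [f fstar fx] := fo_exists hG hy.
pose g : {lrmorphism Pol G -> Pol G} :=
  @sub_star_incl C (Pol G) SA hS \o f.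
have gx j k : g (x j k) = x j k by rewrite /g /= fx mxE.
have gstar : star_morphism g by move=> u; rewrite /g /= fstar.
have ga : g a = a.
  by apply: (fo_unique hG (g := idfun) gstar).
by apply/SP; rewrite -ga; exact: (valP (f a)).
Qed.

End FreeOrthogonal.

(** * Counit and skew derivations at the counit *)

Definition linear_of (K : pzRingType) (V W : lmodType K) (f : V -> W)
    (hf : linear f) : {linear V -> W} :=
  HB.pack_for {linear V -> W} f (GRing.isLinear.Build K V W *:%R f hf).

Lemma sum_deltal (K : pzSemiRingType) n (j : 'I_n) (F : 'I_n -> K) :
  \sum_l (j == l)%:R * F l = F j.
Proof.
rewrite (bigD1 j) //= eqxx mul1r big1 ?addr0 // => l.
by rewrite eq_sym => /negPf->; rewrite mul0r.
Qed.

Lemma sum_deltar (K : pzSemiRingType) n (j : 'I_n) (F : 'I_n -> K) :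
  \sum_l F l * (l == j)%:R = F j.
Proof.
rewrite (bigD1 j) //= eqxx mulr1 big1 ?addr0 // => l.
by move=> /negPf->; rewrite mulr0.
Qed.

Lemma sum_deltars (K : pzSemiRingType) n (j : 'I_n) (F : 'I_n -> K) :
  \sum_l F l * (j == l)%:R = F j.
Proof. by under eq_bigr do rewrite eq_sym; rewrite sum_deltar. Qed.

Section FreeOrthogonalFunctionals.
Variables (C : numClosedFieldType) (N : nat) (G : quantumGroup C).
Variables (x : 'M[Pol G]_N) (hG : is_free_orthogonal x).

Lemma fo_ext (V : lmodType C) (f g : Pol G -> V) : linear f -> linear g ->
  f 1 = g 1 -> (forall j k b, f b = g b -> f (x j k * b) = g (x j k * b)) ->
  f =1 g.
Proof.
move=> lf lg fg1 fgx a; elim: (generated_all hG a) => // [c u v _ hu _ hv|].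
  by rewrite lf lg hu hv.
by move=> j k b _; apply: fgx.
Qed.

Lemma tens_ext (V : lmodType C) (f g : Pol2 G -> V) : linear f -> linear g ->
  (forall a b, f (tens a b) = g (tens a b)) -> f =1 g.
Proof.
move=> lf lg; exact: (tens_unique (tensP G)
  (g := linear_of lf) (h := linear_of lg)).
Qed.

Lemma tens_linear (V : lmodType C) (f : Pol G -> Pol G -> V) :
  (forall b, linear (f^~ b)) -> (forall a, linear (f a)) ->
  exists2 g : Pol2 G -> V, linear g & forall a b, g (tens a b) = f a b.
Proof.
move=> f1 f2; have [|g hg] := tens_exists (tensP G) (f := f).
  by split.
by exists g => //; exact: linearP.
Qed.

Lemma Delta_gen j k b :
  Delta G (x j k * b) = \sum_l tens (x j l) (x l k) * Delta G b.
Proof. by rewrite rmorphM /= (fo_Delta hG) mulr_suml. Qed.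

Definition is_counit (eps : Pol G -> C^o) := [/\ linear eps, eps 1 = 1 &
  forall j k b, eps (x j k * b) = (j == k)%:R * eps b].

(** The one-letter case of phi(ab) = phi(a) eps(b) + s^deg(a) eps(a) phi(b): a derivation at the
    counit for s = 1, twisted by parity for s = -1. Compatibility with the orthogonality relations
    is the equation M + s M^T = 0, so M is antisymmetric or symmetric accordingly. *)
Definition is_skew (eps : Pol G -> C^o) (s : C) (M : 'M[C]_N)
    (phi : Pol G -> C^o) := [/\ linear phi, phi 1 = 0 &
  forall j k b, phi (x j k * b) = M j k * eps b + s * (j == k)%:R * phi b].

(* [phi] is read off the corner of a morphism to upper triangular 2x2 matrices
   with diagonal characters [s^degree] and [eps]. *)
Lemma skew_exists0 (s : C) (M : 'M[C]_N) : s * s = 1 -> M + s *: M^T = 0 ->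
  exists eps phi, is_counit eps /\ is_skew eps s M phi.
Proof.
move=> ss hM.
pose m j k : 'M[C]_2 := \matrix_(a, b)
  if a == 0 then if b == 0 then s * (j == k)%:R else M j k
  else if b == 0 then 0 else (j == k)%:R.
have M0 j k : M j k + s * M k j = 0.
  by have /matrixP/(_ j k) := hM; rewrite !mxE.
have natE (c : bool) a b : (c%:R : 'M[C]_2) a b = c%:R * (a == b)%:R.
  by case: c; rewrite !mxE ?mul1r ?mul0r.
have m_row j k : \sum_l m j l * m k l = (j == k)%:R.
  apply/matrixP => a b; rewrite summxE natE.
  under eq_bigr do rewrite mxE big_ord_recl big_ord1 !mxE.
  case: a => [[|[|]]] //= ha; case: b => [[|[|]]] //= hb;
    rewrite ?mulr0 ?mulr1 big_split /=.
  - rewrite [X in _ + X]big1 => [|l _]; last by rewrite mulr0.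
    under eq_bigr do rewrite mulrACA ss mul1r.
    by rewrite sum_deltars addr0 eq_sym.
  - under eq_bigr do rewrite mulrAC.
    by rewrite !sum_deltars addrC.
  - by rewrite !big1 ?addr0 // => l _; rewrite ?mul0r ?mulr0.
  - rewrite big1 => [|l _]; last by rewrite mul0r.
    by rewrite sum_deltars add0r eq_sym.
have m_col j k : \sum_l m l j * m l k = (j == k)%:R.
  apply/matrixP => a b; rewrite summxE natE.
  under eq_bigr do rewrite mxE big_ord_recl big_ord1 !mxE.
  case: a => [[|[|]]] //= ha; case: b => [[|[|]]] //= hb;
    rewrite ?mulr0 ?mulr1 big_split /=.
  - rewrite [X in _ + X]big1 => [|l _]; last by rewrite mulr0.
    under eq_bigr do rewrite mulrACA ss mul1r.
    by rewrite sum_deltar eq_sym addr0 eq_sym.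
  - under eq_bigr do rewrite mulrAC.
    by rewrite !sum_deltar addrC M0.
  - by rewrite !big1 ?addr0 // => l _; rewrite ?mul0r ?mulr0.
  - rewrite big1 => [|l _]; last by rewrite mul0r.
    by rewrite sum_deltar add0r eq_sym.
have adjm_sum (F : 'I_N -> 'M[C]_2) : adjm (\sum_l F l) = \sum_l adjm (F l).
  by apply/matrixP => a b; rewrite !(mxE, summxE) rmorph_sum;
    apply: eq_bigr => l _; rewrite !mxE.
have adjm_nat (c : bool) : adjm (c%:R : 'M[C]_2) = c%:R.
  by apply/matrixP => a b; rewrite !(mxE, natE) rmorphM !rmorph_nat eq_sym.
have adjmMr (a b : 'M[C]_2) : adjm (a * b) = adjm b * adjm a.
  exact: adjmM.
have fst_sum (F : 'I_N -> dbl_alg C) : (\sum_l F l).1 = \sum_l (F l).1.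
  by elim/big_rec2: _ => // l u v _ <-.
have snd_sum (F : 'I_N -> dbl_alg C) : (\sum_l F l).2 = \sum_l (F l).2.
  by elim/big_rec2: _ => // l u v _ <-.
pose y : 'M[dbl_alg C]_N := \matrix_(j, k) (m j k, adjm (m j k)).
have hy : orthogonal_relations y.
  split=> [j k|]; first by rewrite mxE; congr pair; exact: adjmK.
  split; apply/matrixP => j k; rewrite !mxE; under eq_bigr do rewrite !mxE.
    apply: injective_projections; rewrite ?fst_sum ?snd_sum /=.
  - by under eq_bigr do rewrite adjmK; rewrite m_row; case: (j == k).
  - under eq_bigr do rewrite -adjmMr.
    by rewrite -adjm_sum m_row adjm_nat eq_sym; case: (j == k).
  apply: injective_projections; rewrite ?fst_sum ?snd_sum /=.
  - by under eq_bigr do rewrite adjmK; rewrite m_col; case: (j == k).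
  - under eq_bigr do rewrite -adjmMr.
    by rewrite -adjm_sum m_col adjm_nat eq_sym; case: (j == k).
have [f _ fy] := fo_exists hG hy.
pose i1 : 'I_2 := lift ord0 ord0.
exists (fun a => (f a).1 i1 i1), (fun a => (f a).1 ord0 i1); split; split.
- by move=> c a b; rewrite linearP /= !mxE.
- by rewrite rmorph1 mxE.
- move=> j k b; rewrite rmorphM /= fy !mxE /= big_ord_recl big_ord1 !mxE /=.
  by rewrite mul0r add0r.
- by move=> c a b; rewrite linearP /= !mxE.
- by rewrite rmorph1 mxE.
- move=> j k b; rewrite rmorphM /= fy !mxE /= big_ord_recl big_ord1 !mxE /=.
  by rewrite addrC.
Qed.

Lemma counit_unique e1 e2 : is_counit e1 -> is_counit e2 -> e1 =1 e2.
Proof.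
move=> [l1 h1 r1] [l2 h2 r2]; apply: fo_ext => //; first by rewrite h1.
by move=> j k b; rewrite r1 r2 => ->.
Qed.

Variables (eps : Pol G -> C^o) (heps : is_counit eps).

Lemma skew_unique s M f g : is_skew eps s M f -> is_skew eps s M g -> f =1 g.
Proof.
move=> [l1 h1 r1] [l2 h2 r2]; apply: fo_ext => //; first by rewrite h1.
by move=> j k b; rewrite r1 r2 => ->.
Qed.

Lemma skew_exists s M : s * s = 1 -> M + s *: M^T = 0 ->
  exists phi, is_skew eps s M phi.
Proof.
move=> ss /(skew_exists0 ss)[e' [phi [he' [l1 h1 r1]]]]; exists phi; split=> //.
by move=> j k b; rewrite r1 (counit_unique he' heps).
Qed.

Lemma skew_gen s M phi j k : is_skew eps s M phi -> phi (x j k) = M j k.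
Proof.
case: heps => _ e1 _ [_ h1 r]; rewrite -[x j k]mulr1 r h1 e1.
by rewrite mulr0 addr0 mulr1.
Qed.

Lemma linear_comp (U V W : lmodType C) (f : U -> V) (g : V -> W) :
  linear f -> linear g -> linear (g \o f).
Proof. by move=> lf lg c u v; rewrite /= lf lg. Qed.

Lemma linear_mull (A : algType C) (V : lmodType C) (f : A -> V) (a : A) :
  linear f -> linear (fun b => f (a * b)).
Proof. by move=> lf c u v; rewrite mulrDr -scalerAr lf. Qed.

Lemma linear_suml (U V : lmodType C) n (F : 'I_n -> U -> V) :
  (forall l, linear (F l)) -> linear (fun u => \sum_l F l u).
Proof.
move=> lF c u v; rewrite scaler_sumr -big_split.
by apply: eq_bigr => l _; rewrite lF.
Qed.

Lemma linear_Z (U V : lmodType C) (f : U -> V) (d : C) :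
  linear f -> linear (fun u => d *: f u).
Proof. by move=> lf c u v; rewrite lf scalerDr !scalerA mulrC. Qed.

Lemma linear_add (U V : lmodType C) (f g : U -> V) :
  linear f -> linear g -> linear (fun u => f u + g u).
Proof. by move=> lf lg c u v; rewrite lf lg scalerDr addrACA. Qed.

Lemma lin_sum (U V : lmodType C) (J : Type) (r : seq J) (Q : pred J)
    (F : J -> U) (f : U -> V) : linear f ->
  f (\sum_(l <- r | Q l) F l) = \sum_(l <- r | Q l) f (F l).
Proof. by move=> lf; exact: (raddf_sum (linear_of lf)). Qed.

Lemma lin_0 (U V : lmodType C) (f : U -> V) : linear f -> f 0 = 0.
Proof. by move=> lf; exact: (raddf0 (linear_of lf)). Qed.

Lemma lin_Z (U V : lmodType C) c u (f : U -> V) :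
  linear f -> f (c *: u) = c *: f u.
Proof.
by move=> lf; rewrite -[X in f X]addr0 lf (lin_0 lf) addr0.
Qed.

Lemma Delta_linear : linear (Delta G).
Proof. exact: linearP. Qed.

Lemma sum_deltaZ (V : lmodType C) n (j : 'I_n) (F : 'I_n -> V) :
  \sum_l (j == l)%:R *: F l = F j.
Proof.
rewrite (bigD1 j) //= eqxx scale1r big1 ?addr0 // => l.
by rewrite eq_sym => /negPf->; rewrite scale0r.
Qed.

Lemma Delta1 : Delta G 1 = tens 1 1.
Proof. by rewrite rmorph1 (tens_one (tensP G)). Qed.

(** The counit axiom. The tensor product is known only through its universal property, so here and
    below a map such as eps (x) id is any linear map with the right values on elementary tensors. *)
Lemma counit_Delta_id (g : Pol2 G -> Pol G) : linear g ->
  (forall a b, g (tens a b) = eps a *: b) -> forall a, g (Delta G a) = a.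
Proof.
move=> lg gt; have [le e1 er] := heps.
apply: fo_ext => [|//||j k b IH]; first exact: linear_comp Delta_linear lg.
  by rewrite Delta1 gt e1 scale1r.
rewrite Delta_gen lin_sum //.
(* Stated for every [z] and not only for [Delta G b], so that [tens_ext] reduces it to elementary
   tensors. *)
have E z : \sum_l g (tens (x j l) (x l k) * z) = x j k * g z.
  move: z; apply: tens_ext.
  - by apply: linear_suml => l; apply: linear_mull.
  - by move=> c u v; rewrite lg mulrDr scalerAr.
  - move=> a d; rewrite gt.
    under eq_bigr do rewrite (tens_mul (tensP G)) gt er -scalerA.
    by rewrite sum_deltaZ scalerAr.
by rewrite E IH.
Qed.

Lemma counitl (f : Pol G -> C^o) (g : Pol2 G -> C^o) : linear f -> linear g ->
  (forall a b, g (tens a b) = eps a *: f b) ->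
  forall a, g (Delta G a) = f a.
Proof.
move=> lf lg gt a; have [le _ _] := heps.
have [||h lh ht] := @tens_linear (Pol G) (fun a b => eps a *: b).
- by move=> b c u v; rewrite le scalerDl scalerA.
- by move=> b c u v; rewrite scalerDr !scalerA mulrC.
rewrite -[in RHS](counit_Delta_id lh ht a); move: (Delta G a).
apply: tens_ext => [//||u v]; first exact: linear_comp lh lf.
by rewrite gt /= ht (lin_Z _ _ lf).
Qed.

Lemma counitr (f : Pol G -> C^o) (g : Pol2 G -> C^o) : linear f -> linear g ->
  (forall a b, g (tens a b) = f a * eps b) ->
  forall a, g (Delta G a) = f a.
Proof.
move=> lf lg gt a; have [le e1 er] := heps.
have [||h lh ht] := @tens_linear (Pol G) (fun a b => eps b *: a).
- by move=> b c u v; rewrite scalerDr !scalerA mulrC.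
- by move=> b c u v; rewrite le scalerDl scalerA.
have hD b : h (Delta G b) = b.
  move: b; apply: fo_ext => [|//||j k b IH].
    exact: linear_comp Delta_linear lh.
    by rewrite Delta1 ht e1 scale1r.
  rewrite Delta_gen lin_sum //.
  have E z : \sum_l h (tens (x j l) (x l k) * z) = x j k * h z.
    move: z; apply: tens_ext.
    - by apply: linear_suml => l; apply: linear_mull.
    - by move=> c u v; rewrite lh mulrDr scalerAr.
    - move=> u d; rewrite ht.
      under eq_bigr do rewrite (tens_mul (tensP G)) ht er eq_sym -scalerA.
      by rewrite sum_deltaZ scalerAr.
  by rewrite E IH.
rewrite -[in RHS](hD a); move: (Delta G a).
apply: tens_ext => [//||u v]; first exact: linear_comp lh lf.
by rewrite gt /= ht (lin_Z _ _ lf) mulrC.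
Qed.

Lemma functional_tens (f g : Pol G -> C^o) : linear f -> linear g ->
  exists2 h : Pol2 G -> C^o, linear h & forall a b, h (tens a b) = f a * g b.
Proof.
move=> lf lg; apply: tens_linear.
- by move=> b c u v; rewrite lf mulrDl scalerAl.
- by move=> b c u v; rewrite lg mulrDr scalerAr.
Qed.

(** The recursion for the convolution of f and g. The two middle terms are symmetric under the
    exchange of (s1, M1, f) and (s2, M2, g), so they cancel in the ordinary commutator, whatever the
    signs. *)
Lemma convol_gen s1 s2 M1 M2 (f g : Pol G -> C^o) (h : Pol2 G -> C^o) :
  is_skew eps s1 M1 f -> is_skew eps s2 M2 g -> linear h ->
  (forall a b, h (tens a b) = f a * g b) -> forall j k a,
  h (Delta G (x j k * a)) = (M1 *m M2) j k * eps a + s2 * M1 j k * g a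
    + s1 * M2 j k * f a + s1 * s2 * (j == k)%:R * h (Delta G a).
Proof.
move=> [lf f1 fr] [lg g1 gr] lh ht j k a; have [le e1 er] := heps.
have [hee lee hete] := functional_tens le le.
have [heg leg hetg] := functional_tens le lg.
have [hfe lfe hfte] := functional_tens lf le.
rewrite Delta_gen lin_sum //.
rewrite -(counitl le lee hete a) -(counitl lg leg hetg) -(counitr lf lfe hfte).
move: (Delta G a); apply: tens_ext.
- by apply: linear_suml => l; apply: linear_mull.
- by repeat apply: linear_add; apply: linear_Z.
move=> u v; rewrite hete hetg hfte ht.
under eq_bigr do rewrite (tens_mul (tensP G)) ht fr gr mulrDl !mulrDr.
rewrite !big_split /=.
rewrite [X in X + _ + _](eq_bigr (fun l => M1 j l * M2 l k * (eps u * eps v)));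
  last by move=> l _; rewrite mulrACA.
rewrite [X in _ + X + _](eq_bigr
  (fun l => s2 * M1 j l * (eps u * g v) * (l == k)%:R)); last first.
  by move=> l _; ring.
rewrite [X in _ + (X + _)](eq_bigr
  (fun l => s1 * M2 l k * (f u * eps v) * (j == l)%:R)); last first.
  by move=> l _; ring.
rewrite [X in _ + (_ + X)](eq_bigr
  (fun l => s1 * s2 * (j == l)%:R * (f u * g v) * (l == k)%:R)); last first.
  by move=> l _; ring.
by rewrite !sum_deltar sum_deltars -mulr_suml mxE !addrA.
Qed.

(** Signs multiply: two symmetric matrices bracket to an antisymmetric one. Symmetric and
    antisymmetric matrices together thus carry the bracket of gl_N over to the convolution
    commutator. *)
Lemma skew_comm s1 s2 M1 M2 (f g : Pol G -> C^o)
    (hfg hgf : Pol2 G -> C^o) :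
  is_skew eps s1 M1 f -> is_skew eps s2 M2 g -> linear hfg -> linear hgf ->
  (forall a b, hfg (tens a b) = f a * g b) ->
  (forall a b, hgf (tens a b) = g a * f b) ->
  is_skew eps (s1 * s2) (M1 *m M2 - M2 *m M1)
    (fun a => hfg (Delta G a) - hgf (Delta G a)).
Proof.
move=> hf hg lfg lgf fgt gft.
have [_ f1 _] := hf; have [_ g1 _] := hg.
split.
- by move=> c u v; rewrite linearP /= lfg lgf scalerBr opprD addrACA.
- by rewrite Delta1 fgt gft f1 g1 mulr0 subrr.
- move=> j k b; rewrite (convol_gen hf hg lfg fgt) (convol_gen hg hf lgf gft).
  by rewrite !mxE; ring.
Qed.

Section Representation.
Variables (n : nat) (V : 'M[Pol G]_n) (hV : is_unitary_rep V).

(** The counit axiom gives V = eps(V) V, and V is invertible. *)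
Lemma rep_counit : map_mx eps V = 1%:M.
Proof.
have [le _ _] := heps.
have [h lh ht] : exists2 g : Pol2 G -> Pol G, linear g &
    forall a b, g (tens a b) = eps a *: b.
  apply: tens_linear => b c u v; first by rewrite le scalerDl scalerA.
  by rewrite scalerDr !scalerA mulrC.
have E : map_mx (fun c : C => c%:A) (map_mx eps V) *m V = V.
  apply/matrixP => i j; rewrite mxE -[RHS](counit_Delta_id lh ht).
  rewrite hV.2 lin_sum //; apply: eq_bigr => k _.
  by rewrite ht !mxE mulr_algl.
have {}E : map_mx (fun c : C => c%:A) (map_mx eps V) = 1%:M :> 'M[Pol G]_n.
  by rewrite -[LHS]mulmx1 -hV.1.1 mulmxA E hV.1.1.
apply/matrixP => i j; have /matrixP/(_ i j) := E; rewrite !mxE.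
(* The embedding of scalars is injective because [eps] sends [c%:A] back to [c]. *)
move=> /(congr1 eps); rewrite (lin_Z _ _ le).
have [_ e1 _] := heps.
rewrite e1 [LHS]mulr1 => ->.
by case: (i == j); rewrite ?mulr1n // (lin_0 le).
Qed.

Lemma rep_functional_mul (f g : Pol G -> C^o) (h : Pol2 G -> C^o) :
  linear h -> (forall a b, h (tens a b) = f a * g b) ->
  map_mx (h \o Delta G) V = map_mx f V *m map_mx g V.
Proof.
move=> lh ht; apply/matrixP => i j; rewrite !mxE /= hV.2 lin_sum //.
by apply: eq_bigr => k _; rewrite ht !mxE.
Qed.

Lemma rep_skew_comm s1 s2 M1 M2 (f g h : Pol G -> C^o) :
  is_skew eps s1 M1 f -> is_skew eps s2 M2 g ->
  is_skew eps (s1 * s2) (M1 *m M2 - M2 *m M1) h ->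
  map_mx h V = map_mx f V *m map_mx g V - map_mx g V *m map_mx f V.
Proof.
move=> hf hg hh; have [lf _ _] := hf; have [lg _ _] := hg.
have [hfg lfg fgt] := functional_tens lf lg.
have [hgf lgf gft] := functional_tens lg lf.
have H := skew_unique hh (skew_comm hf hg lfg lgf fgt gft).
rewrite -(rep_functional_mul lfg fgt) -(rep_functional_mul lgf gft).
by apply/matrixP => i j; rewrite !mxE H.
Qed.

End Representation.

End FreeOrthogonalFunctionals.

(** * Antipode and Kac property *)

Section FreeOrthogonalReps.
Variables (C : numClosedFieldType) (N : nat) (G : quantumGroup C).
Variables (x : 'M[Pol G]_N) (hG : is_free_orthogonal x).

(* [a |-> S(a)^*] with [S] the antipode; being multiplicative and
   conjugate-linear it is a morphism to the conjugate algebra. *)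
Definition is_kappa (kap : Pol G -> Pol G) :=
  [/\ forall c a b, kap (c *: a + b) = c^* *: kap a + kap b, kap 1 = 1,
      {morph kap : a b / a * b}, {morph kap : a / star a}
    & forall j k, kap (x j k) = x k j].

Lemma kappa_exists : exists kap, is_kappa kap.
Proof.
pose B := conj_alg (Pol G).
have hy : orthogonal_relations (x^T : 'M[B]_N).
  split=> [j k|]; first by rewrite mxE; exact: fo_star.
  split; apply/matrixP => j k; rewrite !mxE.
    transitivity (\sum_l x l j * x l k : B); last first.
      by rewrite (fo_col hG).
    by apply: eq_bigr => l _; rewrite !mxE; congr (_ * _); exact: fo_star.
  transitivity (\sum_l x j l * x k l : B); last by rewrite (fo_row hG).
  by apply: eq_bigr => l _; rewrite !mxE; congr (_ * _); exact: fo_star.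
have [f fstar fy] := fo_exists hG hy.
exists f; split=> //.
- by move=> c a b; rewrite linearP.
- exact: rmorph1.
- exact: rmorphM.
- by move=> j k; rewrite fy mxE.
Qed.

Variables (kap : Pol G -> Pol G) (hkap : is_kappa kap).
Variables (eps : Pol G -> C^o) (heps : is_counit x eps).

Lemma kappa_sum n (F : 'I_n -> Pol G) :
  kap (\sum_l F l) = \sum_l kap (F l).
Proof.
have [kL k1 kM ks kx] := hkap.
have k0 : kap 0 = 0.
  by have := kL (-1) 1 1; rewrite rmorphN1 !scaleN1r !addNr.
by apply: (big_morph kap _ k0) => a b; have := kL 1 a b;
  rewrite rmorph1 !scale1r.
Qed.

(** The antipode axiom, [star \o kap] being the antipode. *)
Lemma antipode_left (g : Pol2 G -> Pol G) : linear g ->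
  (forall a b, g (tens a b) = star (kap a) * b) ->
  forall a, g (Delta G a) = (eps a)%:A.
Proof.
have [kL k1 kM ks kx] := hkap; have [le e1 er] := heps.
move=> lg gt; apply: (fo_ext hG).
- by move=> c u v; rewrite linearP /= lg.
- by move=> c u v; rewrite le scalerDl scalerA.
- by rewrite (Delta1 G) gt k1 star1 mul1r e1 scale1r.
move=> j k b IH; rewrite (Delta_gen hG) lin_sum //.
have E z : \sum_l g (tens (x j l) (x l k) * z) = (j == k)%:R *: g z.
  move: z; apply: tens_ext.
  - by apply: linear_suml => l; apply: linear_mull.
  - exact: linear_Z.
  - move=> u d; rewrite gt.
    under eq_bigr do rewrite (tens_mul (tensP G)) gt kM kx starM (fo_star hG)
       -mulrA (mulrA (x _ _)).
    rewrite -mulr_sumr -mulr_suml (fo_col hG).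
    by case: (j == k); rewrite ?mul1r ?scale1r // mul0r mulr0 scale0r.
by rewrite E IH er scalerA.
Qed.

Section Representation.
Variables (n : nat) (V : 'M[Pol G]_n) (hV : is_unitary_rep V).

Lemma rep_row i j : \sum_k V i k * star (V j k) = (i == j)%:R.
Proof.
have /matrixP/(_ i j) := hV.1.1; rewrite !mxE => <-.
by apply: eq_bigr => k _; rewrite !mxE.
Qed.

Lemma rep_col i j : \sum_k star (V k i) * V k j = (i == j)%:R.
Proof.
have /matrixP/(_ i j) := hV.1.2; rewrite !mxE => <-.
by apply: eq_bigr => k _; rewrite !mxE.
Qed.

(** By the antipode axiom the antipode applied to V is a left inverse of V, hence equals
    [star_mx V]. *)
Lemma rep_kappa i j : kap (V i j) = V j i.
Proof.
have [kL k1 kM ks kx] := hkap.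
have [g lg gt] : exists2 g : Pol2 G -> Pol G, linear g &
    forall a b, g (tens a b) = star (kap a) * b.
  apply: tens_linear => b c u v.
    by rewrite kL starL conjCK mulrDl scalerAl.
  by rewrite mulrDr scalerAr.
have E : (\matrix_(i, j) star (kap (V i j))) *m V = 1%:M.
  apply/matrixP => k l; rewrite !mxE.
  have <- : g (Delta G (V k l)) = (k == l)%:R.
    rewrite (antipode_left lg gt).
    have /matrixP/(_ k l) := rep_counit hG heps hV; rewrite !mxE => ->.
    by case: (k == l); rewrite ?scale1r ?scale0r.
  rewrite hV.2 lin_sum //.
  by apply: eq_bigr => m _; rewrite gt !mxE.
have {}E : \matrix_(i, j) star (kap (V i j)) = star_mx V.
  by rewrite -[LHS]mulmx1 -hV.1.1 mulmxA E mul1mx.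
have /matrixP/(_ i j) := E; rewrite !mxE.
by move=> /(congr1 star); rewrite !starK.
Qed.

(* The Kac property: the entrywise adjoint of [V] is unitary. *)
Lemma rep_kac_col i j : \sum_k V k i * star (V k j) = (i == j)%:R.
Proof.
have [kL k1 kM ks kx] := hkap.
have := congr1 kap (rep_row i j); rewrite kappa_sum.
have -> : kap (i == j)%:R = (i == j)%:R.
  case: (i == j) => //; have := kappa_sum (fun i : 'I_0 => 0).
  by rewrite !big_ord0.
by move=> <-; apply: eq_bigr => k _; rewrite kM ks !rep_kappa.
Qed.

Lemma rep_kac_row i j : \sum_k star (V i k) * V j k = (i == j)%:R.
Proof.
have [kL k1 kM ks kx] := hkap.
have := congr1 kap (rep_col i j); rewrite kappa_sum.
have -> : kap (i == j)%:R = (i == j)%:R.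
  case: (i == j) => //; have := kappa_sum (fun i : 'I_0 => 0).
  by rewrite !big_ord0.
by move=> <-; apply: eq_bigr => k _; rewrite kM ks !rep_kappa.
Qed.

(** Since [kap] transposes x and M is hermitian, a -> conj(phi(kap a)) satisfies the recursion that
    determines phi; on V, [kap] is the transposition. *)
Lemma rep_skew_herm s M phi : is_skew x eps s M phi -> s^* = s ->
  (forall j k, (M k j)^* = M j k) ->
  forall i j, (phi (V j i))^* = phi (V i j).
Proof.
have [kL k1 kM ks kx] := hkap; have [le e1 er] := heps.
move=> [lp p1 pr] hs hM i j.
have ekap a : (eps (kap a))^* = eps a.
  move: a; apply: (counit_unique hG _ heps); split.
  - by move=> c u v; rewrite kL le rmorphD rmorphM /= conjCK.
  - by rewrite k1 e1 rmorph1.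
  - by move=> a b c; rewrite kM kx er rmorphM rmorph_nat eq_sym.
rewrite -(rep_kappa i j).
suff /(skew_unique hG)/(_ (And3 lp p1 pr)) :
    is_skew x eps s M (fun a => (phi (kap a))^*) by exact.
split=> {i j}.
- by move=> c u v; rewrite kL lp rmorphD rmorphM /= conjCK.
- by rewrite k1 p1 rmorph0.
- move=> j k b; rewrite kM kx pr rmorphD !rmorphM /= rmorph_nat hM hs ekap.
  by rewrite eq_sym.
Qed.

End Representation.

Lemma scalar_commP n (T : 'M[C]_n) :
  (forall a b, T *m delta_mx a b = delta_mx a b *m T) -> exists c, T = c%:M.
Proof.
case: n T => [|n] T hT; first by exists 0; apply/matrixP => -[].
have E a b i : T i a = (i == a)%:R * T b b.
  have /matrixP/(_ i b) := hT a b; rewrite !mxE.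
  under eq_bigr do rewrite mxE eqxx andbT.
  rewrite sum_deltar => ->.
  rewrite -(sum_deltar b (fun l => (i == a)%:R * T l b)).
  by apply: eq_bigr => l _; rewrite mxE -mulnb natrM mulrAC.
exists (T ord0 ord0); apply/matrixP => i a; rewrite (E _ ord0) mxE.
by rewrite mulr_natl.
Qed.

Lemma fo_rep : is_unitary_rep x.
Proof. by split; [case: (fo_relations hG) | exact: fo_Delta]. Qed.

(** Skew functionals applied to T x = x T show that T commutes with every symmetric and every
    antisymmetric matrix, and these span all matrices. *)
Lemma fo_irreducible : (0 < N)%N -> irreducible_rep x.
Proof.
move=> N_gt0; split=> // T hT.
have comm s (M : 'M[C]_N) : s * s = 1 -> M + s *: M^T = 0 -> T *m M = M *m T.
  move=> ss /(skew_exists hG heps ss)[phi hphi].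
  have [lp _ _] := hphi.
  apply/matrixP => j k; have /matrixP/(_ j k)/(congr1 phi) := hT.
  rewrite !mxE !lin_sum //.
  under eq_bigr do
    rewrite mxE mulr_algl (lin_Z _ _ lp) (skew_gen heps _ _ hphi).
  under [X in _ = X -> _]eq_bigr do
    rewrite mxE mulr_algr (lin_Z _ _ lp) (skew_gen heps _ _ hphi).
  by move=> ->; apply: eq_bigr => l _; rewrite mulrC.
apply: scalar_commP => a b.
have c1 := comm (-1) (delta_mx a b + delta_mx b a).
have c2 := comm 1 (delta_mx a b - delta_mx b a).
have {}c1 : T *m (delta_mx a b + delta_mx b a)
    = (delta_mx a b + delta_mx b a) *m T.
  apply: c1; first by rewrite mulrNN mulr1.
  by rewrite raddfD /= !trmx_delta scaleN1r (addrC (delta_mx b a)) subrr.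
have {}c2 : T *m (delta_mx a b - delta_mx b a)
    = (delta_mx a b - delta_mx b a) *m T.
  apply: c2; first by rewrite mulr1.
  by rewrite raddfB /= !trmx_delta scale1r subrKA subrr.
move: (congr2 +%R c1 c2); rewrite -mulmxDl -mulmxDr addrACA subrr addr0.
rewrite -mulr2n -scaler_nat -scalemxAr -scalemxAl => /scalerI; apply.
by rewrite pnatr_eq0.
Qed.

End FreeOrthogonalReps.

(** * Weights of sl_2-representations *)

Section Sl2.
Variable C : numClosedFieldType.

(** Otherwise the n + 1 distinct numbers mu + c j would all be roots of the characteristic
    polynomial, which has degree n. *)
Lemma eigenvalue_string n (H : 'M[C]_n) (mu c : C) (v : nat -> 'rV[C]_n) :
  c != 0 -> (forall j, (j <= n)%N -> v j *m H = (mu + c * j%:R) *: v j) ->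
  exists2 j, (j <= n)%N & v j = 0.
Proof.
move=> c_neq0 hv; apply: contrapT => v_neq0.
pose rs := [seq mu + c * j%:R | j <- iota 0 n.+1].
have urs : uniq rs.
  rewrite map_inj_uniq ?iota_uniq // => i j /addrI/(mulfI c_neq0)/eqP.
  by rewrite eqr_nat => /eqP.
have rrs : all (root (char_poly H)) rs.
  apply/allP => _ /mapP[j + ->]; rewrite mem_iota add0n ltnS => /= hj.
  rewrite -eigenvalue_root_char; apply/eigenvalueP; exists (v j).
    exact: hv.
  by apply/eqP => vj0; apply: v_neq0; exists j.
have := max_poly_roots (monic_neq0 (char_poly_monic H)) rrs urs.
by rewrite size_char_poly size_map size_iota ltnn.
Qed.

(** Raising v as far as possible gives a highest weight vector w of weight mu >= n. Raising its
    j+1-st descendant returns (j+1)(mu - j) times the j-th one, a nonzero multiple for j < n, so w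
    has n + 1 nonzero descendants of distinct weights, too many in dimension n. *)
Lemma sl2_eigenvalue_lt n (H E F : 'M[C]_n) a :
  H *m E - E *m H = 2 *: E -> H *m F - F *m H = - 2 *: F ->
  E *m F - F *m E = H -> eigenvalue H a -> n%:R <= a -> False.
Proof.
move=> hE hF hEF /eigenvalueP[v vH v_neq0] na.
(* Matrices act on row vectors from the right, so F raises weights by 2 and E lowers them. *)
pose up j := iter j (fun w : 'rV_n => w *m F) v.
have upH j : up j *m H = (a + 2 * j%:R) *: up j.
  elim: j => [|j IH]; first by rewrite mulr0 addr0.
  rewrite [up _]/= -mulmxA -[F *m H](addrNK (H *m F)).
  rewrite -opprB hF scaleNr opprK mulmxDr mulmxA IH -scalemxAr -scalemxAl.
  by rewrite -scalerDl -(natr1 j); congr (_ *: _); ring.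
have [k hk] : exists2 k, up k != 0 & up k.+1 = 0.
  have two_neq0 : 2 != 0 :> C by rewrite pnatr_eq0.
  have [j _ upj0] := eigenvalue_string two_neq0 (fun j _ => upH j).
  have /ex_minnP[m /eqP m0 mmin] : exists j, up j == 0 by exists j; apply/eqP.
  case: m m0 mmin => [|k] k0 kmin.
    by rewrite -[v]/(up 0) k0 eqxx in v_neq0.
  by exists k => //; apply/negP => /kmin; rewrite ltnn.
set w := up k in hk * => /= wF.
pose mu := a + 2 * k%:R.
have mu_ge : n%:R <= mu by rewrite (le_trans na) // lerDl mulr_ge0 ?ler0n.
pose down j := iter j (fun w : 'rV_n => w *m E) w.
have downH j : down j *m H = (mu + (- 2) * j%:R) *: down j.
  elim: j => [|j IH]; first by rewrite mulr0 addr0 upH.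
  rewrite [down _]/= -mulmxA -[E *m H](addrNK (H *m E)).
  rewrite -opprB hE mulmxDr mulmxA IH mulmxN -scalemxAr -scalemxAl.
  by rewrite -scaleNr -scalerDl -(natr1 j); congr (_ *: _); ring.
have downF j : down j.+1 *m F = (j.+1%:R * (mu - j%:R)) *: down j.
  elim: j => [|j IH].
    rewrite /= -mulmxA -[E *m F](addrNK (F *m E)) hEF mulmxDr mulmxA wF mul0mx.
    by rewrite addr0 (downH 0) mulr0 addr0 mul1r subr0.
  rewrite [down j.+2]/= -mulmxA -[E *m F](addrNK (F *m E)) hEF mulmxDr mulmxA.
  rewrite -[down j *m E]/(down j.+1) IH -scalemxAl downH -scalerDl.
  by congr (_ *: _); rewrite -(natr1 j.+1) -(natr1 j); ring.
have two_neq0 : - 2 != 0 :> C by rewrite oppr_eq0 pnatr_eq0.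
have [j jn downj] := eigenvalue_string two_neq0 (fun j _ => downH j).
(* Vanishing climbs back up the string to w. *)
elim: j jn downj => [_ /= w0|j IH jn dj0]; first by rewrite w0 eqxx in hk.
apply: IH; first exact: ltnW.
have /eqP := downF j; rewrite dj0 mul0mx eq_sym scaler_eq0 => /orP[|/eqP //].
rewrite mulf_eq0 pnatr_eq0 /= subr_eq0 => /eqP muj.
by move: mu_ge; rewrite muj ler_nat leqNgt jn.
Qed.

Lemma sl2_eigenvalue_bound n (H E F : 'M[C]_n) a :
  H *m E - E *m H = 2 *: E -> H *m F - F *m H = - 2 *: F ->
  E *m F - F *m E = H -> a \is Num.real -> eigenvalue H a -> `|a| <= n%:R.
Proof.
move=> hE hF hEF ra ea.
have hna : n%:R \is @Num.real C by rewrite realn.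
rewrite real_ler_norml //; apply/andP; split; last first.
  rewrite real_leNgt //; apply/negP => /ltW.
  exact: (sl2_eigenvalue_lt hE hF hEF ea).
rewrite real_leNgt ?rpredN //; apply/negP; rewrite ltrNr => /ltW.
(* The lower bound follows from the upper one for the triple (-H, F, E). *)
apply: (@sl2_eigenvalue_lt n (- H) F E).
- by rewrite mulNmx mulmxN opprK addrC -[RHS]opprK -scaleNr -hF opprB.
- by rewrite mulNmx mulmxN opprK addrC scaleNr -hE opprB.
- by rewrite -opprB hEF.
have /eigenvalueP[v vH v0] := ea; apply/eigenvalueP; exists v => //.
by rewrite mulmxN vH scaleNr.
Qed.

Definition sqn n (v : 'cV[C]_n) : C := \sum_i `|v i 0| ^+ 2.

Lemma sqnE n (v : 'cV[C]_n) : sqn v = (adjm v *m v) 0 0.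
Proof.
rewrite mxE; apply: eq_bigr => i _.
by rewrite adjmE mulrC -normCK.
Qed.

Lemma sqn_scaled_isometry m n (A : 'M[C]_(m, n)) (t : C) (v : 'cV[C]_n) :
  adjm A *m A = t%:M -> sqn (A *m v) = t * sqn v.
Proof.
move=> hA; rewrite !sqnE adjmM -mulmxA (mulmxA (adjm A)) hA mul_scalar_mx.
by rewrite -scalemxAr mxE.
Qed.

Lemma sqn_hermitian_bound n (H : 'M[C]_n) (c : C) (v : 'cV[C]_n) :
  adjm H = H -> (forall a, a \is Num.real -> eigenvalue H a -> `|a| <= c) ->
  sqn (H *m v) <= c ^+ 2 * sqn v.
Proof.
move=> hH hc.
have Hherm : H \is hermsymmx.
  by apply/is_hermitianmxP; rewrite expr0 scale1r.
have hn := hermitian_normalmx Hherm.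
have := orthomx_spectralP hn; set P := spectralmx H; set d := spectral_diag H.
have Pu : P \is unitarymx := spectral_unitarymx H.
have Pun := unitarymx_unit Pu.
have PadjP : adjm P *m P = 1%:M.
  by have := mulVmx Pun; rewrite invmx_unitary.
have PPadj : P *m adjm P = 1%:M by exact/unitarymxP.
rewrite invmx_unitary // => HE.
have PH : P *m H = diag_mx d *m P by rewrite {1}HE !mulmxA PPadj mul1mx.
have isoP w : sqn (P *m w) = sqn w.
  by rewrite (sqn_scaled_isometry (t := 1) w PadjP) mul1r.
rewrite -isoP mulmxA PH -mulmxA -[sqn v]isoP /sqn mulr_sumr.
apply: ler_sum => i _; rewrite mul_diag_mx mxE normrM exprMn.
rewrite ler_wpM2r ?exprn_ge0 //.
have di : `|d 0 i| <= c.
  apply: hc.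
    have /mxOverP := hermitian_spectral_diag_real Hherm; exact.
  apply/eigenvalueP; exists (row i P).
    by rewrite -row_mul PH row_mul row_diag_mx -scalemxAl -rowE.
  apply/eqP => rowP0; have /matrixP/(_ i i) := PPadj.
  rewrite !mxE eqxx => /esym/eqP; rewrite big1 ?oner_eq0 // => k _.
  by have /rowP/(_ k) := rowP0; rewrite !mxE => ->; rewrite mul0r.
by rewrite lerXn2r ?nnegrE ?normr_ge0 // (le_trans _ di).
Qed.

End Sl2.

(** * Schur's lemma *)

Section MatricesOverPol.
Variables (C : numClosedFieldType) (A : starAlgType C).

Definition cmx m n (T : 'M[C]_(m, n)) : 'M[A]_(m, n) :=
  map_mx (fun c => c%:A) T.

Definition bar_mx m n (V : 'M[A]_(m, n)) : 'M[A]_(m, n) := map_mx star V.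

Lemma cmxM m n p (S : 'M[C]_(m, n)) (T : 'M[C]_(n, p)) :
  cmx (S *m T) = cmx S *m cmx T.
Proof.
apply/matrixP => i j; rewrite !mxE scaler_suml; apply: eq_bigr => k _.
by rewrite !mxE mulr_algl scalerA.
Qed.

Lemma cmx_scalar n c : cmx (c%:M : 'M[C]_n) = c%:A%:M.
Proof.
by apply/matrixP => i j; rewrite !mxE; case: (i == j); rewrite ?scale0r.
Qed.

Lemma star_mxM m n p (S : 'M[A]_(m, n)) (T : 'M[A]_(n, p)) :
  star_mx (S *m T) = star_mx T *m star_mx S.
Proof.
apply/matrixP => i j; rewrite !mxE star_sum; apply: eq_bigr => k _.
by rewrite !mxE starM.
Qed.

Lemma star_alg (c : C) : star (c%:A : A) = (c^*)%:A.
Proof. by rewrite starZ star1. Qed.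

Lemma star_cmx m n (T : 'M[C]_(m, n)) : star_mx (cmx T) = cmx (adjm T).
Proof. by apply/matrixP => i j; rewrite !mxE star_alg. Qed.

Lemma bar_cmx m n (T : 'M[C]_(m, n)) : bar_mx (cmx T) = cmx (map_mx Num.conj T).
Proof. by apply/matrixP => i j; rewrite !mxE star_alg. Qed.

Lemma bar_cmxM m n p (T : 'M[C]_(m, n)) (V : 'M[A]_(n, p)) :
  bar_mx (cmx T *m V) = bar_mx (cmx T) *m bar_mx V.
Proof.
apply/matrixP => i j; rewrite !mxE star_sum; apply: eq_bigr => k _.
by rewrite !mxE !mulr_algl star_alg mulr_algl starZ.
Qed.

Lemma bar_mxMc m n p (V : 'M[A]_(m, n)) (T : 'M[C]_(n, p)) :
  bar_mx (V *m cmx T) = bar_mx V *m bar_mx (cmx T).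
Proof.
apply/matrixP => i j; rewrite !mxE star_sum; apply: eq_bigr => k _.
by rewrite !mxE !mulr_algr star_alg mulr_algr starZ.
Qed.

Lemma bar_mxK m n (V : 'M[A]_(m, n)) : bar_mx (bar_mx V) = V.
Proof. by apply/matrixP => i j; rewrite !mxE starK. Qed.

Lemma star_mxK m n (V : 'M[A]_(m, n)) : star_mx (star_mx V) = V.
Proof. by apply/matrixP => i j; rewrite !mxE starK. Qed.

Definition intw m n (V : 'M[A]_m) (T : 'M[C]_(m, n)) (W : 'M[A]_n) :=
  V *m cmx T = cmx T *m W.

Lemma intw_adj m n (V : 'M[A]_m) (T : 'M[C]_(m, n)) (W : 'M[A]_n) :
  unitary_mx V -> unitary_mx W -> intw V T W -> intw W (adjm T) V.
Proof.
move=> [VV' V'V] [WW' W'W] /(congr1 (@star_mx C A _ _)).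
rewrite !star_mxM star_cmx => E.
by rewrite /intw -[LHS]mulmx1 -V'V mulmxA -(mulmxA W) E !mulmxA WW' mul1mx.
Qed.

Lemma intw_comp m n p (V : 'M[A]_m) (T : 'M[C]_(m, n)) (W : 'M[A]_n)
    (T' : 'M[C]_(n, p)) (X : 'M[A]_p) :
  intw V T W -> intw W T' X -> intw V (T *m T') X.
Proof. by move=> E E'; rewrite /intw cmxM mulmxA E -mulmxA E' mulmxA. Qed.

Lemma intw_bar m n (V : 'M[A]_m) (T : 'M[C]_(m, n)) (W : 'M[A]_n) :
  intw V T W -> intw (bar_mx V) (map_mx Num.conj T) (bar_mx W).
Proof. by move=> E; rewrite /intw -bar_cmx -bar_mxMc E bar_cmxM. Qed.

End MatricesOverPol.

Section Schur.
Variables (C : numClosedFieldType) (G : quantumGroup C).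

Lemma irr_intw n (V : 'M[Pol G]_n) (T : 'M[C]_n) :
  irreducible_rep V -> intw V T V -> exists c, T = c%:M.
Proof. by move=> [_ h] E; apply: h; exact/esym/E. Qed.

(** T1 [adjm] T2 intertwines V with itself, and [adjm] T2 T1 does so for [bar_mx W]; conjugating
    entries brings the latter to W, whose irreducibility is assumed. Taking T1 = T2 gives multiples
    of unitaries, taking them distinct gives proportionality. *)
Lemma schur_adj m n (V : 'M[Pol G]_m) (W : 'M[Pol G]_n)
    (T1 T2 : 'M[C]_(m, n)) : unitary_mx V -> unitary_mx (bar_mx W) ->
  irreducible_rep V -> irreducible_rep W ->
  intw V T1 (bar_mx W) -> intw V T2 (bar_mx W) ->
  (exists c, T1 *m adjm T2 = c%:M) /\ (exists c, adjm T2 *m T1 = c%:M).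
Proof.
move=> uV uW iV iW h1 h2.
have h2' := intw_adj uV uW h2.
split; first exact: irr_intw iV (intw_comp h1 h2').
have /intw_bar := intw_comp h2' h1; rewrite bar_mxK.
move=> /(irr_intw iW)[c /matrixP E]; exists c^*.
apply/matrixP => i j; have := E i j; rewrite mxE => /(congr1 Num.conj).
by rewrite conjCK => ->; rewrite !mxE rmorphMn.
Qed.

Definition inv_vec m (V : 'M[Pol G]_m) (v : 'cV[C]_m) :=
  forall i, \sum_j v j 0 *: V i j = (v i 0)%:A.

Lemma inv_vecP m (V : 'M[Pol G]_m) (v : 'cV[C]_m) :
  inv_vec V v <-> V *m cmx (Pol G) v = cmx (Pol G) v.
Proof.
split=> [h|/matrixP h i]; [apply/matrixP => i j; rewrite !ord1 {j}|].
  by rewrite !mxE -h; apply: eq_bigr => j _; rewrite !mxE mulr_algr.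
by have := h i 0; rewrite !mxE => <-; apply: eq_bigr => j _;
  rewrite !mxE mulr_algr.
Qed.

Lemma inv_vec_adj m (V : 'M[Pol G]_m) (v : 'cV[C]_m) : unitary_mx V ->
  inv_vec V v -> cmx (Pol G) (adjm v) *m V = cmx (Pol G) (adjm v).
Proof.
move=> [VV' V'V] /inv_vecP E.
have : star_mx V *m cmx _ v = cmx _ v by rewrite -{1}E mulmxA V'V mul1mx.
by move=> /(congr1 (@star_mx C _ _ _)); rewrite star_mxM star_mxK star_cmx.
Qed.

Lemma inv_row_adj m (V : 'M[Pol G]_m) (v : 'cV[C]_m) : unitary_mx V ->
  cmx (Pol G) (adjm v) *m V = cmx (Pol G) (adjm v) -> inv_vec V v.
Proof.
move=> [VV' V'V] E; apply/inv_vecP.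
have : cmx _ (adjm v) *m star_mx V = cmx _ (adjm v).
  by rewrite -{1}E -mulmxA VV' mulmx1.
move=> /(congr1 (@star_mx C _ _ _)).
by rewrite star_mxM star_mxK star_cmx adjmK.
Qed.

Lemma triv_rep : is_unitary_rep (1%:M : 'M[Pol G]_1).
Proof.
have s1 : star_mx (1%:M : 'M[Pol G]_1) = 1%:M.
  by apply/matrixP => i j; rewrite !ord1 !mxE eqxx star1.
split; first by split; rewrite s1 mulmx1.
move=> i j; rewrite !ord1 big_ord1 !mxE eqxx rmorph1.
by rewrite (tens_one (tensP G)).
Qed.

Lemma triv_irreducible : irreducible_rep (1%:M : 'M[Pol G]_1).
Proof. by split=> // T _; exists (T 0 0); exact: mx11_scalar. Qed.

(** v [adjm v] intertwines V with itself, hence is a scalar, and a nonzero one. So v is invertible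
    as an m by 1 matrix and is itself the equivalence. *)
Lemma inv_vec_triv m (V : 'M[Pol G]_m) (v : 'cV[C]_m) : unitary_mx V ->
  irreducible_rep V -> inv_vec V v -> v != 0 ->
  equivalent_reps V (1%:M : 'M[Pol G]_1).
Proof.
move=> uV iV hv v0; have hv' := inv_vec_adj uV hv.
have [c hc] : exists c, v *m adjm v = c%:M.
  apply: (irr_intw iV); rewrite /intw cmxM mulmxA.
  by move/inv_vecP: (hv) => ->; rewrite -mulmxA hv'.
have [r hr] : exists r, adjm v *m v = r%:M.
  by exists ((adjm v *m v) 0 0); exact: mx11_scalar.
have rc : r = c.
  have : v *m (adjm v *m v) = c *: v by rewrite mulmxA hc mul_scalar_mx.
  rewrite hr mul_mx_scalar => /eqP; rewrite -subr_eq0 -scalerBl scaler_eq0.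
  by rewrite (negPf v0) orbF subr_eq0 => /eqP.
have c0 : c != 0.
  apply/eqP => c0; have := sqnE v; rewrite hr rc c0 mxE mul0rn.
  move=> /psumr_eq0P s0; case/negP: v0; apply/eqP/matrixP => i j.
  rewrite ord1 mxE; apply/eqP; rewrite -normr_eq0 -sqrf_eq0.
  by apply/eqP/s0 => // k _; rewrite exprn_ge0.
exists (c^-1 *: adjm v), v; split.
- by rewrite -scalemxAl hr rc scale_scalar_mx mulVf.
- by rewrite -scalemxAr hc scale_scalar_mx mulVf.
- rewrite /intertwiner mul1mx.
  have -> : map_mx (fun c0 : C => c0%:A) (c^-1 *: adjm v)
      = c^-1%:A *: cmx (Pol G) (adjm v).
    by apply/matrixP => i j; rewrite !mxE mulr_algl scalerA.
  by rewrite -scalemxAl hv'.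
Qed.

Lemma equivalent_sym_trans m n p (V : 'M[Pol G]_m) (W : 'M[Pol G]_n)
    (X : 'M[Pol G]_p) :
  equivalent_reps V X -> equivalent_reps W X -> equivalent_reps V W.
Proof.
move=> [T [S [TS ST E]]] [T' [S' [TS' ST' E']]]; exists (S' *m T), (S *m T').
split.
- by rewrite mulmxA -(mulmxA S') TS mulmx1.
- by rewrite mulmxA -(mulmxA S) TS' mulmx1.
have EX : cmx _ S' *m X = W *m cmx _ S'.
  have c1 k : cmx (Pol G) (1%:M : 'M[C]_k) = 1%:M by rewrite cmx_scalar scale1r.
  have E2 : X *m cmx _ T' = cmx _ T' *m W by exact: esym E'.
  rewrite -[X]mulmx1 -c1 -TS' cmxM (mulmxA X) E2.
  by rewrite !mulmxA -cmxM ST' c1 mul1mx.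
change (cmx (Pol G) (S' *m T) *m V = W *m cmx (Pol G) (S' *m T)).
by rewrite cmxM -mulmxA [cmx _ T *m V]E mulmxA EX mulmxA.
Qed.

Variables (I : choiceType) (n : I -> nat).
Variables (U : forall alpha, 'M[Pol G]_(n alpha)) (hU : is_Irr U).

(** The index of the trivial representation. As [n a0] equals 1 only propositionally, the unique
    index of this block is carried along as [e0] below. *)
Lemma triv_index : exists a0, [/\ n a0 = 1%N, forall i j, U a0 i j = 1 &
  forall alpha v, alpha != a0 -> inv_vec (U alpha) v -> v = 0].
Proof.
have [a0 ha0] := Irr_exhaustive hU triv_rep triv_irreducible.
exists a0; have [T [S [TS ST E]]] := ha0.
have c1 k : cmx (Pol G) (1%:M : 'M[C]_k) = 1%:M by rewrite cmx_scalar scale1r.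
have n1 : n a0 = 1%N.
  (* The traces of ST and TS agree, and they are the two dimensions. *)
  have := congr1 mxtrace ST; rewrite mxtrace_mulC TS !mxtrace1 => /eqP.
  by rewrite eqr_nat => /eqP.
have U1 : U a0 = 1%:M.
  rewrite -[LHS]mul1mx -c1 -ST cmxM -mulmxA [cmx _ T *m _]E mul1mx.
  by rewrite -cmxM ST c1.
split=> // [i j|alpha v].
  rewrite U1 mxE; have -> : i = j; last by rewrite eqxx.
  by case: i j; rewrite n1 => -[] // p [[] // q]; apply/val_inj.
move=> /eqP ne hv; apply/eqP/negPn/negP => v0; apply: ne.
apply: (Irr_distinct hU); apply: equivalent_sym_trans ha0.
exact: inv_vec_triv (Irr_unitary hU alpha).1 (Irr_irreducible hU alpha) hv v0.
Qed.

End Schur.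

(** * Decomposition of tensor products *)

Section Decomposition.
Variables (C : numClosedFieldType) (G : quantumGroup C).
Variables (I : choiceType) (n : I -> nat).
Variables (U : forall alpha, 'M[Pol G]_(n alpha)).

(* [W] is equivalent to a direct sum of multiples of the [U alpha], in a
   coordinate-free form: [rho] is a *-representation of the matrix algebras
   [M_(n alpha)], nonzero on finitely many of them, and
   [W = (rho (x) id)(sum_alpha U alpha)]. *)
Record decomposition m (W : 'M[Pol G]_m) (S : seq I)
    (rho : forall alpha, 'I_(n alpha) -> 'I_(n alpha) -> 'M[C]_m) := {
  dec_out : forall a i j, a \notin S -> rho a i j = 0;
  dec_uniq : uniq S;
  dec_sum : W = \sum_(a <- S) \sum_i \sum_j
                  U a i j *: cmx (Pol G) (rho a i j);
  dec_mul : forall a i j k l,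
    rho a i j *m rho a k l = (j == k)%:R *: rho a i l;
  dec_mul0 : forall a b i j k l, a != b -> rho a i j *m rho b k l = 0;
  dec_adj : forall a i j, adjm (rho a i j) = rho a j i }.

Lemma cmx0 m p : cmx (Pol G) (0 : 'M[C]_(m, p)) = 0.
Proof. by apply/matrixP => i j; rewrite !mxE scale0r. Qed.

Lemma cmx_mulZ m p q (X : 'M[C]_(m, p)) (u : Pol G) (Y : 'M[C]_(p, q)) :
  cmx (Pol G) X *m (u *: cmx (Pol G) Y) = u *: cmx (Pol G) (X *m Y).
Proof.
rewrite cmxM; apply/matrixP => i j; rewrite !mxE mulr_sumr.
by apply: eq_bigr => k _; rewrite !mxE !mulr_algl scalerAr.
Qed.

Variables (m : nat) (W : 'M[Pol G]_m) (S : seq I).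
Variable rho : forall alpha, 'I_(n alpha) -> 'I_(n alpha) -> 'M[C]_m.
Hypothesis dec : decomposition W S (@rho).

(** For c = f(U) the sum on the left is f(W), by [dec_functional]: multiplying f(W) by a matrix unit
    extracts a row of the block f(U a). *)
Lemma dec_mul_sum (c : forall b, 'I_(n b) -> 'I_(n b) -> C) a
    (i k : 'I_(n a)) :
  rho i k *m (\sum_(b <- S) \sum_p \sum_q c b p q *: rho p q)
    = \sum_q c a k q *: rho i q.
Proof.
have E b : b != a -> rho i k *m (\sum_p \sum_q c b p q *: rho p q) = 0.
  rewrite eq_sym => ab; rewrite mulmx_sumr big1 // => p _.
  rewrite mulmx_sumr big1 // => q _.
  by rewrite -scalemxAr (dec_mul0 dec) // scaler0.
rewrite mulmx_sumr; have [aS|aS] := boolP (a \in S); last first.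
  rewrite !big1 // => [q _|b _]; first by rewrite (dec_out dec) // scaler0.
  by rewrite (dec_out dec) // mul0mx.
rewrite (bigD1_seq a) ?(dec_uniq dec) //= [X in _ + X]big1 // addr0.
rewrite mulmx_sumr.
rewrite -(sum_deltaZ k (fun p => \sum_q c a p q *: rho i q)).
apply: eq_bigr => p _; rewrite mulmx_sumr scaler_sumr.
apply: eq_bigr => q _.
by rewrite -scalemxAr (dec_mul dec) !scalerA mulrC.
Qed.

Lemma dec_mulW a (i k : 'I_(n a)) :
  cmx (Pol G) (rho i k) *m W = \sum_q U a k q *: cmx (Pol G) (rho i q).
Proof.
rewrite (dec_sum dec).
have E b : b != a -> cmx (Pol G) (rho i k) *m
    (\sum_p \sum_q U b p q *: cmx (Pol G) (rho p q)) = 0.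
  rewrite eq_sym => ab; rewrite mulmx_sumr big1 // => p _.
  rewrite mulmx_sumr big1 // => q _.
  by rewrite cmx_mulZ (dec_mul0 dec) // cmx0 scaler0.
rewrite mulmx_sumr; have [aS|aS] := boolP (a \in S); last first.
  rewrite !big1 // => [q _|b _].
    by rewrite (dec_out dec) // cmx0 scaler0.
  by rewrite (dec_out dec) // cmx0 mul0mx.
rewrite (bigD1_seq a) ?(dec_uniq dec) //= [X in _ + X]big1 // addr0.
rewrite mulmx_sumr (bigD1 k) //= [X in _ + X]big1 => [|p].
  rewrite addr0 mulmx_sumr; apply: eq_bigr => q _.
  by rewrite cmx_mulZ (dec_mul dec) eqxx scale1r.
rewrite eq_sym => /negPf kp; rewrite mulmx_sumr big1 // => q _.
by rewrite cmx_mulZ (dec_mul dec) kp scale0r cmx0 scaler0.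
Qed.

Lemma dec_functional (f : Pol G -> C^o) : linear f ->
  map_mx f W = \sum_(a <- S) \sum_i \sum_j f (U a i j) *: rho i j.
Proof.
move=> lf; rewrite (dec_sum dec); apply/matrixP => p q; rewrite !mxE !summxE.
rewrite (lin_sum _ _ _ lf); apply: eq_bigr => a _.
rewrite !summxE (lin_sum _ _ _ lf); apply: eq_bigr => i _.
rewrite !summxE (lin_sum _ _ _ lf); apply: eq_bigr => j _.
by rewrite !mxE mulr_algr /= (lin_Z _ _ lf) mulrC.
Qed.

(** With f the counit this is the unitality of rho, read off from eps(W) = 1. *)
Lemma dec_one (f : Pol G -> C^o) : linear f -> map_mx f W = 1%:M ->
  (forall a, map_mx f (U a) = 1%:M) ->
  \sum_(a <- S) \sum_(i < n a) rho i i = 1%:M :> 'M[C]_m.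
Proof.
move=> lf fW fU; rewrite -fW (dec_functional lf); apply: eq_bigr => a _.
apply: eq_bigr => i _; have /matrixP fUi := fU a.
rewrite (bigD1 i) //= big1 => [|j]; first last.
  by have := fUi i j; rewrite !mxE eq_sym => -> /negPf->; rewrite scale0r.
by have := fUi i i; rewrite !mxE eqxx => ->; rewrite scale1r addr0.
Qed.

Variables (a0 : I) (e0 : 'I_(n a0)).
Hypothesis na0 : n a0 = 1%N.
Hypothesis Ua0 : forall i j, U a0 i j = 1.
Hypothesis irr0 : forall a v, a != a0 -> inv_vec (U a) v -> v = 0.

Lemma ord_a0 (i : 'I_(n a0)) : i = e0.
Proof.
by move: i e0; rewrite na0 => i j; rewrite !ord1.
Qed.

(** For a fixed entry (p, r), the numbers (rho i k v) p r form, as k varies, an invariant vector of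
    U a; only the trivial representation has nonzero ones. *)
Lemma dec_inv a (i k : 'I_(n a)) q (v : 'M[C]_(m, q)) : a != a0 ->
  W *m cmx (Pol G) v = cmx (Pol G) v -> rho i k *m v = 0.
Proof.
move=> aa0 hv; apply/matrixP => p r.
pose xi : 'cV[C]_(n a) := \col_k (rho i k *m v) p r.
suff /matrixP/(_ k 0) : xi = 0 by rewrite !mxE.
apply: (irr0 aa0) => l.
have : cmx (Pol G) (rho i l) *m W *m cmx (Pol G) v
     = cmx (Pol G) (rho i l *m v) by rewrite -mulmxA hv cmxM.
rewrite dec_mulW mulmx_suml => /matrixP/(_ p r).
rewrite summxE mxE [xi l 0]mxE => <-; apply: eq_bigr => j _.
by rewrite -scalemxAl -cmxM !mxE mulr_algr.
Qed.

Lemma dec_triv_row : cmx (Pol G) (rho e0 e0) *m W = cmx (Pol G) (rho e0 e0).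
Proof.
rewrite dec_mulW (bigD1 e0) //= big1 => [|j]; last by rewrite (ord_a0 j) eqxx.
by rewrite Ua0 scale1r addr0.
Qed.

Hypothesis uW : unitary_mx W.

Lemma dec_triv_col : W *m cmx (Pol G) (rho e0 e0) = cmx (Pol G) (rho e0 e0).
Proof.
have [WW' W'W] := uW.
have : cmx (Pol G) (rho e0 e0) *m star_mx W = cmx (Pol G) (rho e0 e0).
  by rewrite -{1}dec_triv_row -mulmxA WW' mulmx1.
move=> /(congr1 (@star_mx C _ _ _)).
by rewrite star_mxM star_mxK star_cmx (dec_adj dec).
Qed.

Variable f : Pol G -> C^o.
Hypotheses (lf : linear f) (fW : map_mx f W = 1%:M).
Hypothesis fU : forall a, map_mx f (U a) = 1%:M.

(** In the resolution of the identity by the rho i i, every nontrivial block kills v. *)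
Lemma dec_triv_inv q (v : 'M[C]_(m, q)) :
  W *m cmx (Pol G) v = cmx (Pol G) v -> rho e0 e0 *m v = v.
Proof.
move=> hv; rewrite -[RHS]mul1mx -(dec_one lf fW fU) mulmx_suml.
have [aS|aS] := boolP (a0 \in S); last first.
  rewrite (dec_out dec) // mul0mx big1_seq // => a /andP[_ aS'].
  rewrite mulmx_suml big1 // => i _; apply: dec_inv => //.
  by apply: contraNneq aS => <-.
rewrite (bigD1_seq a0) ?(dec_uniq dec) //= [X in _ = _ + X]big1 => [|a aa0].
  rewrite addr0 mulmx_suml (bigD1 e0) //= big1 ?addr0 // => i.
  by rewrite (ord_a0 i) eqxx.
by rewrite mulmx_suml big1 // => i _; apply: dec_inv.
Qed.

End Decomposition.

Section TensorIndices.
Variable C : numClosedFieldType.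

Lemma sum_mxtens (V : nmodType) n p (F : 'I_(n * p) -> V) :
  \sum_a F a = \sum_i \sum_k F (mxtens_index (i, k)).
Proof.
rewrite pair_big /=.
rewrite (reindex (@mxtens_index n p)) /=.
  by apply: eq_bigr => -[i k].
by exists (@mxtens_unindex n p) => a _;
  [exact: mxtens_indexK|exact: mxtens_unindexK].
Qed.

Definition unvec n p (v : 'cV[C]_(n * p)) : 'M[C]_(n, p) :=
  \matrix_(i, k) v (mxtens_index (i, k)) 0.

Definition swap_index n p (a : 'I_(p * n)) : 'I_(n * p) :=
  mxtens_index ((mxtens_unindex a).2, (mxtens_unindex a).1).

Lemma swap_indexE n p i k :
  @swap_index n p (mxtens_index (k, i)) = mxtens_index (i, k).
Proof. by rewrite /swap_index mxtens_indexK. Qed.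

Lemma swap_indexK n p : cancel (@swap_index n p) (@swap_index p n).
Proof. by move=> a; case: (mxtens_indexP a) => k i; rewrite !swap_indexE. Qed.

Definition flip_mx n p (P : 'M[C]_(n * p)) : 'M[C]_(p * n) :=
  \matrix_(a, b) P (swap_index a) (swap_index b).

Lemma flip_mxK n p (P : 'M[C]_(n * p)) : flip_mx (flip_mx P) = P.
Proof. by apply/matrixP => a b; rewrite !mxE !swap_indexK. Qed.

Lemma flip_mxM n p (P Q : 'M[C]_(n * p)) :
  flip_mx (P *m Q) = flip_mx P *m flip_mx Q.
Proof.
apply/matrixP => a b; rewrite !mxE (reindex (@swap_index n p)) /=.
  by apply: eq_bigr => c _; rewrite !mxE.
by exists (@swap_index p n) => c _; exact: swap_indexK.
Qed.

Lemma flip_mx_adj n p (P : 'M[C]_(n * p)) :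
  adjm (flip_mx P) = flip_mx (adjm P).
Proof. by apply/matrixP => a b; rewrite !mxE. Qed.

End TensorIndices.

(** * Tensor products of representations and their invariant vectors *)

Section TensorReps.
Variables (C : numClosedFieldType) (N : nat) (G : quantumGroup C).
Variables (x : 'M[Pol G]_N) (hG : is_free_orthogonal x).
Variables (kap : Pol G -> Pol G) (hkap : is_kappa x kap).
Variables (eps : Pol G -> C^o) (heps : is_counit x eps).

Lemma counitM a b : eps (a * b) = eps a * eps b.
Proof.
have [le e1 er] := heps; move: a; apply: (fo_ext hG).
- by move=> c u v; rewrite mulrDl -scalerAl le.
- by move=> c u v; rewrite le mulrDl -scalerAl.
- by rewrite mul1r e1 mul1r.
- by move=> j k a IH; rewrite -mulrA !er IH mulrA.
Qed.

Lemma skew1M M f a b : is_skew x eps 1 M f ->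
  f (a * b) = f a * eps b + eps a * f b.
Proof.
move=> [lf f1 fr]; have [le e1 er] := heps; move: a; apply: (fo_ext hG).
- by move=> c u v; rewrite mulrDl -scalerAl lf.
- move=> c u v; rewrite lf le !mulrDl -!scalerAl scalerDr.
  by rewrite addrACA.
- by rewrite mul1r f1 e1 mul0r mul1r add0r.
- move=> j k a IH; rewrite -mulrA !fr er IH counitM !mul1r.
  by rewrite mulrDr mulrDl !mulrA addrA.
Qed.

Section TwoReps.
Variables (n p : nat) (V : 'M[Pol G]_n) (W : 'M[Pol G]_p).
Hypotheses (hV : is_unitary_rep V) (hW : is_unitary_rep W).

Lemma bar_unitary : unitary_mx (bar_mx W).
Proof.
split; apply/matrixP => i j; rewrite !mxE.
- rewrite -(rep_kac_row hG hkap heps hW).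
  by apply: eq_bigr => k _; rewrite !mxE starK.
- rewrite -(rep_kac_col hG hkap heps hW).
  by apply: eq_bigr => k _; rewrite !mxE starK.
Qed.

Lemma tens_unitary : unitary_mx (V *t W).
Proof.
split; apply/matrixP => a b; case: (mxtens_indexP a) => i k;
    case: (mxtens_indexP b) => j l.
- rewrite !mxE sum_mxtens.
  transitivity (\sum_m V i m * (k == l)%:R * star (V j m)).
    apply: eq_bigr => m _; rewrite -(rep_row hW) mulr_sumr mulr_suml.
    by apply: eq_bigr => q _; rewrite !mxE !mxtens_indexK starM !mulrA.
  under eq_bigr do rewrite mulr_natr mulrnAl.
  rewrite sumrMnl (rep_row hV).
  by rewrite (can_eq (@mxtens_indexK n p)) xpair_eqE -mulnb natrM mulr_natr.
- rewrite !mxE sum_mxtens exchange_big /=.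
  transitivity (\sum_q star (W q k) * (i == j)%:R * W q l).
    apply: eq_bigr => q _; rewrite -(rep_col hV) mulr_sumr mulr_suml.
    by apply: eq_bigr => m _; rewrite !mxE !mxtens_indexK starM !mulrA.
  under eq_bigr do rewrite mulr_natr mulrnAl.
  rewrite sumrMnl (rep_col hW).
  rewrite (can_eq (@mxtens_indexK n p)) xpair_eqE andbC.
  by rewrite -mulnb natrM mulr_natr.
Qed.

Lemma tens_counit : map_mx eps (V *t W) = 1%:M.
Proof.
have /matrixP eV := rep_counit hG heps hV.
have /matrixP eW := rep_counit hG heps hW.
apply/matrixP => a b; case: (mxtens_indexP a) => i k;
  case: (mxtens_indexP b) => j l.
rewrite mxE tensmxE counitM; have := eV i j; have := eW k l; rewrite !mxE.
move=> -> ->; rewrite (can_eq (@mxtens_indexK n p)) xpair_eqE.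
by rewrite -natrM mulnb.
Qed.

Lemma tens_skew M f : is_skew x eps 1 M f ->
  map_mx f (V *t W) = map_mx f V *t 1%:M + 1%:M *t map_mx f W.
Proof.
move=> hf; have /matrixP eV := rep_counit hG heps hV.
have /matrixP eW := rep_counit hG heps hW.
apply/matrixP => a b; case: (mxtens_indexP a) => i k;
  case: (mxtens_indexP b) => j l.
rewrite [RHS]mxE !tensmxE [LHS]mxE tensmxE (skew1M _ _ hf).
by rewrite -eV -eW !mxE.
Qed.

(** Under [unvec], V (x) W acts as T -> V T W^T, and by the Kac property W^T is the inverse of
    [bar_mx W]. *)
Lemma tens_inv_intw (v : 'cV[C]_(n * p)) :
  (V *t W) *m cmx (Pol G) v = cmx (Pol G) v <->
  intw V (unvec v) (bar_mx W).
Proof.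
have [BB' B'B] := bar_unitary.
have BT : star_mx (bar_mx W) = W^T.
  by apply/matrixP => i j; rewrite !mxE starK.
rewrite BT in BB' B'B.
have E i k : ((V *t W) *m cmx (Pol G) v) (mxtens_index (i, k)) 0
    = (V *m cmx (Pol G) (unvec v) *m W^T) i k.
  rewrite !mxE sum_mxtens exchange_big; apply: eq_bigr => l _ /=.
  rewrite !mxE mulr_suml; apply: eq_bigr => j _.
  by rewrite !mxE !mxtens_indexK !mulr_algr scalerAl.
have F i k : cmx (Pol G) v (mxtens_index (i, k)) 0 = cmx (Pol G) (unvec v) i k.
  by rewrite !mxE.
split=> [h|h].
  have {}h : V *m cmx (Pol G) (unvec v) *m W^T = cmx (Pol G) (unvec v).
    by apply/matrixP => i k; rewrite -E -F h.
  by rewrite /intw -{2}h -mulmxA B'B mulmx1.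
apply/matrixP => a j; rewrite ord1; case: (mxtens_indexP a) => i k.
by rewrite E F h -mulmxA BB' mulmx1.
Qed.

End TwoReps.

(** The flip is in general no intertwiner, Pol(O_N^+) not being commutative, yet it preserves
    invariance: if T intertwines [bar_mx W] and V, the conjugate of its adjoint, which is T^T,
    intertwines [bar_mx V] and W. The trace property of h rests on this. *)
Lemma tens_inv_flip n p (V : 'M[Pol G]_n) (W : 'M[Pol G]_p)
    (P : 'M[C]_(n * p)) : is_unitary_rep V -> is_unitary_rep W ->
  (V *t W) *m cmx (Pol G) P = cmx (Pol G) P ->
  (W *t V) *m cmx (Pol G) (flip_mx P) = cmx (Pol G) (flip_mx P).
Proof.
move=> hV hW hP.
have colE m q (X : 'M[C]_(m, q)) b : cmx (Pol G) (col b X) = col b (cmx _ X).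
  by apply/matrixP => i j; rewrite !mxE.
have colM' m q r (X : 'M[Pol G]_(m, q)) (Y : 'M[Pol G]_(q, r)) b :
  col b (X *m Y) = X *m col b Y.
  by apply/matrixP => i j; rewrite !mxE; apply: eq_bigr => k _; rewrite mxE.
apply/matrixP => a b.
suff /matrixP/(_ a 0) : (W *t V) *m cmx (Pol G) (col b (flip_mx P))
    = cmx (Pol G) (col b (flip_mx P)).
  by rewrite colE -colM' ![col _ _ _ _]mxE.
have hv : (V *t W) *m cmx (Pol G) (col (swap_index b) P)
    = cmx (Pol G) (col (swap_index b) P).
  by rewrite colE -colM' hP.
move/(tens_inv_intw V hW): hv => hv.
apply/(tens_inv_intw W hV).
have := intw_bar (intw_adj hV.1 (bar_unitary hW) hv); rewrite bar_mxK.
congr intw; apply/matrixP => k i; rewrite !mxE conjCK.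
by rewrite swap_indexE.
Qed.

End TensorReps.

Lemma sqn_neq0 (C : numClosedFieldType) m (v : 'cV[C]_m) : v != 0 -> sqn v != 0.
Proof.
apply: contraNneq => /psumr_eq0P s0; apply/eqP/matrixP => i j.
rewrite ord1 mxE; apply/eqP; rewrite -normr_eq0 -sqrf_eq0.
by apply/eqP/s0 => // k _; rewrite exprn_ge0.
Qed.

(** * Projections onto the invariant vectors of U b (x) U c *)

Section TrivialProjections.
Variables (C : numClosedFieldType) (N : nat) (G : quantumGroup C).
Variables (x : 'M[Pol G]_N) (hG : is_free_orthogonal x).
Variables (kap : Pol G -> Pol G) (hkap : is_kappa x kap).
Variables (eps : Pol G -> C^o) (heps : is_counit x eps).
Variables (I : choiceType) (n : I -> nat).
Variables (U : forall alpha, 'M[Pol G]_(n alpha)) (hU : is_Irr U).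
Variables (a0 : I) (e0 : 'I_(n a0)).
Hypothesis na0 : n a0 = 1%N.
Hypothesis Ua0 : forall i j, U a0 i j = 1.
Hypothesis irr0 : forall a v, a != a0 -> inv_vec (U a) v -> v = 0.
Variable S : I -> I -> seq I.
Variable rho : forall b c alpha, 'I_(n alpha) -> 'I_(n alpha) ->
  'M[C]_(n b * n c).
Hypothesis dec : forall b c,
  decomposition U (U b *t U c) (S b c) (fun alpha => @rho b c alpha).

Definition triv_proj b c : 'M[C]_(n b * n c) := @rho b c a0 e0 e0.

Let hUb b : is_unitary_rep (U b) := Irr_unitary hU b.
Let le : linear eps. Proof. by case: heps. Qed.

Lemma triv_projP b c q (v : 'M[C]_(n b * n c, q)) :
  (U b *t U c) *m cmx (Pol G) v = cmx (Pol G) v <-> triv_proj b c *m v = v.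
Proof.
split=> [|<-].
  rewrite /triv_proj.
  apply: (@dec_triv_inv _ _ _ _ _ _ _ _ _ (dec b c) a0 e0 na0 irr0 eps le).
    exact: (tens_counit hG heps (hUb b) (hUb c)).
  by move=> a; exact: (rep_counit hG heps (hUb a)).
have := dec_triv_col (dec b c) e0 na0 Ua0 (tens_unitary (hUb b) (hUb c)).
by move=> E; rewrite cmxM mulmxA E.
Qed.

Lemma triv_proj_idem b c : triv_proj b c *m triv_proj b c = triv_proj b c.
Proof. by rewrite /triv_proj (dec_mul (dec b c)) eqxx scale1r. Qed.

Lemma triv_proj_adj b c : adjm (triv_proj b c) = triv_proj b c.
Proof. exact: dec_adj (dec b c) _ _ _. Qed.

(** By [tens_inv_flip], used in both directions, each of the two self-adjoint projections has its
    range inside that of the other. *)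
Lemma triv_proj_flip b c : flip_mx (triv_proj b c) = triv_proj c b.
Proof.
have E b' c' : triv_proj c' b' *m flip_mx (triv_proj b' c')
    = flip_mx (triv_proj b' c').
  apply/triv_projP; apply: (tens_inv_flip hG hkap heps (hUb b') (hUb c')).
  by apply/triv_projP; exact: triv_proj_idem.
have := congr1 (@flip_mx C _ _) (E c b).
rewrite flip_mxM flip_mxK => <-.
have := congr1 (@adjm C _ _) (E b c).
by rewrite adjmM flip_mx_adj !triv_proj_adj => ->.
Qed.

(** The columns of the projection are invariant vectors, that is, intertwiners between irreducible
    representations. By Schur's lemma they are all proportional to one of them, which is a multiple
    of a unitary. *)
Lemma triv_proj_rank1 b c : triv_proj b c != 0 ->
  exists (v : 'cV[C]_(n b * n c)) (t : C),
    [/\ triv_proj b c = (sqn v)^-1 *: (v *m adjm v), v != 0,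
        unvec v *m adjm (unvec v) = t%:M & adjm (unvec v) *m unvec v = t%:M].
Proof.
set P := triv_proj b c => P0.
have [b1 hb1] : exists b1, col b1 P != 0.
  apply: contrapT => h; case/negP: P0; apply/eqP/matrixP => i j.
  have /matrixP/(_ i 0) : col j P = 0.
    by apply: contrapT => /eqP hj; apply: h; exists j.
  by rewrite !mxE.
have Pcol b2 : P *m col b2 P = col b2 P.
  by rewrite !colE mulmxA triv_proj_idem.
have intwP b2 : intw (U b) (unvec (col b2 P)) (bar_mx (U c)).
  by apply/(tens_inv_intw hG hkap heps (U b) (hUb c))/triv_projP/Pcol.
pose v := col b1 P; pose T := unvec v.
have sch b2 := schur_adj (hUb b).1 (bar_unitary hG hkap heps (hUb c))
  (Irr_irreducible hU b) (Irr_irreducible hU c) (intwP b2) (intwP b1).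
have T0 : T != 0.
  apply: contraNneq hb1 => /matrixP T0; apply/eqP/matrixP => a j.
  case: (mxtens_indexP a) => i k; have := T0 i k.
  by rewrite ord1 !mxE.
have [[t ht] [t' ht']] := sch b1.
rewrite -/v -/T in ht ht'.
have tt' : t = t'.
  have : T *m adjm T *m T = T *m (adjm T *m T) by rewrite mulmxA.
  rewrite ht ht' mul_scalar_mx mul_mx_scalar => /eqP.
  rewrite -subr_eq0 -scalerBl scaler_eq0 (negPf T0) orbF subr_eq0.
  by move/eqP.
have t0 : t != 0.
  apply: contraNneq hb1 => t0; apply/eqP/matrixP => a j.
  case: (mxtens_indexP a) => i k; rewrite ord1.
  have := sqnE (col k T); rewrite -tt' t0 in ht'.
  have -> : adjm (col k T) *m col k T = 0.
    apply/matrixP => p q; have /matrixP/(_ k k) := ht'.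
    rewrite !mxE mul0rn => tr0; rewrite -[RHS]tr0.
    by apply: eq_bigr => m _; rewrite !mxE.
  rewrite mxE => /eqP /(contraTeq (@sqn_neq0 _ _ _)) /matrixP/(_ i 0).
  by rewrite !mxE.
have Pcols b2 : exists l, col b2 P = l *: v.
  have [[c1 hc1] _] := sch b2.
  (* With T2 the intertwiner of column [b2], T2 [adjm T] = c1 and [adjm T] T = t give t T2 = c1
     T. *)
  exists (c1 / t); have /matrixP E : unvec (col b2 P) = (c1 / t) *: T.
    apply: (scalerI t0); rewrite scalerA mulrCA mulfV // mulr1.
    rewrite -[RHS]mul_scalar_mx -hc1 -mulmxA ht' -tt'.
    by rewrite mul_mx_scalar.
  apply/matrixP => a j; case: (mxtens_indexP a) => i k.
  by have := E i k; rewrite ord1 !mxE.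
pose l : 'rV[C]_(n b * n c) := \row_j xget 0 [set l | col j P = l *: v].
have Pl : P = v *m l.
  apply/matrixP => a j; have [l0 hl0] := Pcols j.
  have /matrixP/(_ a 0) := @xgetI _ 0 [set l | col j P = l *: v] l0 hl0.
  rewrite !mxE big_ord1 !mxE => ->; exact: mulrC.
have Pv : adjm v *m P = adjm v.
  by rewrite -[P in LHS]triv_proj_adj -adjmM Pcol.
have lE : l = (sqn v)^-1 *: adjm v.
  rewrite -[in RHS]Pv Pl mulmxA [adjm v *m v]mx11_scalar -sqnE.
  by rewrite mul_scalar_mx scalerA mulVf ?scale1r ?sqn_neq0.
exists v, t; split=> //; first by rewrite {1}Pl lE -scalemxAr.
by rewrite tt'.
Qed.

(** This is the source of the division by n b. With T = [unvec v], pairing the second leg of the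
    projection with y leaves T y [adjm T] / [sqn v]. Here T multiplies squared norms by t, whereas
    [sqn v] is the trace of T [adjm T], namely (n b) t. *)
Lemma triv_proj_bound b c (y : 'M[C]_(n c)) (d : C) (w : 'cV[C]_(n b)) :
  0 <= d -> (forall v, sqn (y *m v) <= d * sqn v) ->
  sqn ((\matrix_(i, j) \sum_k \sum_l y k l *
     triv_proj b c (mxtens_index (i, k)) (mxtens_index (j, l))) *m w)
  <= (n b)%:R ^- 2 * d * sqn w.
Proof.
move=> d_ge0 hy; have nb0 : (n b)%:R != 0 :> C.
  by rewrite pnatr_eq0 -lt0n; have [] := Irr_irreducible hU b.
have sqn_ge0 m (v : 'cV[C]_m) : 0 <= sqn v.
  by apply: sumr_ge0 => i _; rewrite exprn_ge0.
have [P0|/triv_proj_rank1[v [t [PE v0 TT' T'T]]]] := eqVneq (triv_proj b c) 0.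
  have -> : \matrix_(i, j) (\sum_k \sum_l y k l *
     triv_proj b c (mxtens_index (i, k)) (mxtens_index (j, l)))
     = 0 :> 'M[C]_(n b).
    apply/matrixP => i j; rewrite !mxE big1 // => k _; rewrite big1 // => l _.
    by rewrite P0 mxE mulr0.
  rewrite mul0mx {1}/sqn big1 => [|i _]; last by rewrite mxE normr0 expr0n.
  by rewrite !mulr_ge0 ?invr_ge0 ?exprn_ge0.
set T := unvec v in TT' T'T.
have -> : \matrix_(i, j) (\sum_k \sum_l y k l *
     triv_proj b c (mxtens_index (i, k)) (mxtens_index (j, l)))
    = (sqn v)^-1 *: (T *m y *m adjm T).
  apply/matrixP => i j; rewrite !mxE mulr_sumr exchange_big.
  apply: eq_bigr => l _ /=; rewrite !mxE mulr_suml mulr_sumr.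
  apply: eq_bigr => k _; rewrite PE !mxE big_ord1 !mxE.
  by ring.
have sqn_t : sqn v = (n b)%:R * t.
  rewrite mulr_natl -(mxtrace_scalar (n b) t) -TT' /sqn sum_mxtens.
  apply: eq_bigr => i _; rewrite mxE; apply: eq_bigr => k _.
  by rewrite adjmE !mxE normCK.
have sv0 := sqn_neq0 v0.
have t_ge0 : 0 <= t.
  have -> : t = (n b)%:R^-1 * sqn v by rewrite sqn_t mulrA mulVf ?mul1r.
  by rewrite mulr_ge0 // invr_ge0.
have t0 : t != 0 by apply: contraNneq sv0; rewrite sqn_t => ->; rewrite mulr0.
have sqnZ m (u : 'cV[C]_m) c' : sqn (c' *: u) = `|c'| ^+ 2 * sqn u.
  by rewrite /sqn mulr_sumr; apply: eq_bigr => i _; rewrite mxE normrM exprMn.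
rewrite -scalemxAl sqnZ -!mulmxA (sqn_scaled_isometry _ T'T).
have -> : (n b)%:R ^- 2 * d * sqn w
    = `|(sqn v)^-1| ^+ 2 * (t * (d * (t * sqn w))).
  rewrite ger0_norm ?invr_ge0 // sqn_t.
  by field; rewrite nb0 t0.
rewrite ler_wpM2l ?exprn_ge0 // ler_wpM2l // (le_trans (hy _)) //.
rewrite (sqn_scaled_isometry (t := t)) //.
by rewrite adjmK.
Qed.

End TrivialProjections.

(** * Operator and trace norms *)

Section Norms.
Variable R : realType.
Local Notation C := R[i].
Local Notation nc := (@Normc.normc R).
Local Notation "r %:C" := (real_complex R r).

Lemma normC_nc (z : C) : `|z| = (nc z)%:C.
Proof. by case: z. Qed.

Lemma nc_ge0 z : 0 <= nc z.
Proof. by case: z => a b; rewrite /Normc.normc sqrtr_ge0. Qed.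

Lemma nc_sum (J : Type) (r : seq J) (P : pred J) (F : J -> C) :
  nc (\sum_(i <- r | P i) F i) <= \sum_(i <- r | P i) nc (F i).
Proof.
elim/big_rec2: _ => [|i u v _ IH]; first by rewrite Normc.normc0.
by rewrite (le_trans (le_normcD _ _)) // lerD2l.
Qed.

Lemma ncJ (z : C) : nc z^* = nc z.
Proof. by apply: (@complexI R); rewrite -!normC_nc norm_conjC. Qed.

Lemma l2norm_ge0 n (v : 'cV[C]_n) : 0 <= l2norm v.
Proof. exact: sqrtr_ge0. Qed.

Lemma l2norm_sq n (v : 'cV[C]_n) : l2norm v ^+ 2 = \sum_i nc (v i 0) ^+ 2.
Proof.
by rewrite sqr_sqrtr // sumr_ge0 // => i _; rewrite exprn_ge0 ?nc_ge0.
Qed.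

Lemma sqn_l2norm n (v : 'cV[C]_n) : sqn v = (l2norm v ^+ 2)%:C.
Proof.
rewrite l2norm_sq rmorph_sum; apply: eq_bigr => i _.
by rewrite normC_nc rmorphXn.
Qed.

Lemma l2norm_leP m n (w : 'cV[C]_m) (v : 'cV[C]_n) (c : R) : 0 <= c ->
  (l2norm w <= c * l2norm v) = (sqn w <= (c ^+ 2)%:C * sqn v).
Proof.
move=> c0; rewrite !sqn_l2norm -rmorphM lecR -exprMn ler_pXn2r //.
  by rewrite nnegrE l2norm_ge0.
by rewrite nnegrE mulr_ge0 ?l2norm_ge0.
Qed.

Lemma l2norm_eq0 n (v : 'cV[C]_n) : l2norm v = 0 -> v = 0.
Proof.
move=> v0; apply/eqP/negPn/negP => /sqn_neq0.
by rewrite sqn_l2norm v0 expr0n /= rmorph0 eqxx.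
Qed.

Lemma l2norm0 n : l2norm (0 : 'cV[C]_n) = 0.
Proof.
by rewrite /l2norm big1 ?sqrtr0 // => i _; rewrite mxE Normc.normc0 expr0n.
Qed.

Lemma l2normZ n (c : C) (v : 'cV[C]_n) : l2norm (c *: v) = nc c * l2norm v.
Proof.
rewrite /l2norm -[X in X * _](@ger0_norm R) ?nc_ge0 // -sqrtr_sqr.
rewrite -sqrtrM ?sqr_ge0 //.
rewrite mulr_sumr; congr Num.sqrt; apply: eq_bigr => i _.
by rewrite mxE Normc.normcM exprMn.
Qed.

Lemma cauchy_schwarz_real n (a b : 'I_n -> R) :
  (\sum_i a i * b i) ^+ 2 <= (\sum_i a i ^+ 2) * (\sum_i b i ^+ 2).
Proof.
have h : 0 <= \sum_i \sum_j (a i * b j - a j * b i) ^+ 2.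
  by apply: sumr_ge0 => i _; apply: sumr_ge0 => j _; rewrite sqr_ge0.
have E : \sum_i \sum_j (a i * b j - a j * b i) ^+ 2 =
    ((\sum_i a i ^+ 2) * (\sum_i b i ^+ 2) - (\sum_i a i * b i) ^+ 2) *+ 2.
  transitivity (\sum_i \sum_j (a i ^+ 2 * b j ^+ 2 + b i ^+ 2 * a j ^+ 2
      - a i * b i * (a j * b j) *+ 2)).
    by apply: eq_bigr => i _; apply: eq_bigr => j _; ring.
  under eq_bigr do rewrite sumrB big_split /= sumrMnl -!mulr_sumr.
  rewrite sumrB big_split /= sumrMnl -!mulr_suml.
  by ring.
by move: h; rewrite E pmulrn_lge0 // subr_ge0.
Qed.

Lemma cauchy_schwarz n (u v : 'cV[C]_n) :
  nc (\sum_i u i 0 * v i 0) <= l2norm u * l2norm v.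
Proof.
apply: le_trans (nc_sum _ _ _) _.
under eq_bigr do rewrite Normc.normcM.
rewrite -(@ler_pXn2r _ 2) // ?nnegrE ?mulr_ge0 ?l2norm_ge0 //; last first.
  by apply: sumr_ge0 => i _; rewrite mulr_ge0 ?nc_ge0.
by rewrite exprMn !l2norm_sq cauchy_schwarz_real.
Qed.

Lemma mulmx_bounded n (y : 'M[C]_n) : exists2 M, 0 <= M &
  forall v, l2norm (y *m v) <= M * l2norm v.
Proof.
pose f i : 'cV[C]_n := \col_j y i j.
exists (Num.sqrt (\sum_i l2norm (f i) ^+ 2)); first exact: sqrtr_ge0.
move=> v.
rewrite -(@ler_pXn2r _ 2) // ?nnegrE ?mulr_ge0 ?l2norm_ge0 ?sqrtr_ge0 //.
rewrite exprMn [X in X * _]sqr_sqrtr; last first.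
  by apply: sumr_ge0 => i _; rewrite sqr_ge0.
rewrite l2norm_sq mulr_suml; apply: ler_sum => i _.
rewrite -exprMn ler_pXn2r // ?nnegrE ?mulr_ge0 ?l2norm_ge0 ?nc_ge0 //.
apply: le_trans (cauchy_schwarz _ _).
rewrite mxE (eq_bigr (fun j => f i j 0 * v j 0)) // => j _.
by rewrite mxE.
Qed.

Let opset n (y : 'M[C]_n) :=
  [set l2norm (y *m v) | v in [set v | l2norm v <= 1]].

Lemma opset_sup n (y : 'M[C]_n) : has_sup (opset y).
Proof.
split; first by exists (l2norm (y *m 0)), 0 => //=; rewrite l2norm0.
have [M M0 hM] := mulmx_bounded y; exists M => _ [v /= v1 <-].
by rewrite (le_trans (hM v)) // ler_piMr.
Qed.

Lemma opnorm_ge0 n (y : 'M[C]_n) : 0 <= opnorm y.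
Proof.
apply: le_trans (sup_upper_bound (opset_sup y) _).
  exact: (l2norm_ge0 (y *m 0)).
by exists 0 => //=; rewrite l2norm0.
Qed.

Lemma opnorm_ub n (y : 'M[C]_n) v : l2norm (y *m v) <= opnorm y * l2norm v.
Proof.
have [->|v0] := eqVneq v 0; first by rewrite mulmx0 !l2norm0 mulr0.
have lv : 0 < l2norm v.
  rewrite lt_neqAle l2norm_ge0 andbT eq_sym.
  by apply: contraNneq v0 => /l2norm_eq0 ->.
have nci : nc ((l2norm v)^-1)%:C = (l2norm v)^-1.
  by apply: (@complexI R); rewrite -normC_nc ger0_norm // lecR invr_ge0 ltW.
rewrite -ler_pdivrMr // mulrC -{1}nci -l2normZ scalemxAr.
apply: (sup_upper_bound (opset_sup y)); exists (((l2norm v)^-1)%:C *: v) => //=.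
by rewrite l2normZ nci mulVf ?gt_eqF.
Qed.

Lemma opnorm_le n (y : 'M[C]_n) c : 0 <= c ->
  (forall v, l2norm (y *m v) <= c * l2norm v) -> opnorm y <= c.
Proof.
move=> c0 hc; apply: ge_sup; first by case: (opset_sup y).
by move=> _ [v /= v1 <-]; rewrite (le_trans (hc v)) // ler_piMr.
Qed.

Lemma opnorm0 n : opnorm (0 : 'M[C]_n) = 0.
Proof.
apply/eqP; rewrite eq_le opnorm_ge0 andbT opnorm_le // => v.
by rewrite mul0mx l2norm0 mul0r.
Qed.

Lemma opnorm_rank1 n (u v : 'cV[C]_n) :
  opnorm (\matrix_(i, j) (u i 0 * v j 0)) <= l2norm u * l2norm v.
Proof.
apply: opnorm_le => [|w]; first by rewrite mulr_ge0 ?l2norm_ge0.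
have -> : (\matrix_(i, j) (u i 0 * v j 0)) *m w = (\sum_j v j 0 * w j 0) *: u.
  apply/matrixP => i j; rewrite ord1 !mxE mulr_suml; apply: eq_bigr => k _.
  by rewrite mxE -mulrA mulrC.
rewrite l2normZ mulrC -mulrA ler_wpM2l ?l2norm_ge0 //; exact: cauchy_schwarz.
Qed.

Lemma l2norm_delta n (i : 'I_n) : l2norm (delta_mx i 0 : 'cV[C]_n) = 1.
Proof.
rewrite /l2norm (bigD1 i) //= big1 => [|j]; last first.
  by rewrite mxE => /negPf->; rewrite Normc.normc0 expr0n.
by rewrite mxE !eqxx Normc.normc1 addr0 expr1n sqrtr1.
Qed.

Lemma opnorm_delta n (i j : 'I_n) : opnorm (delta_mx i j : 'M[C]_n) <= 1.
Proof.
have -> : delta_mx i j = \matrix_(k, l)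
    ((delta_mx i 0 : 'cV[C]_n) k 0 * (delta_mx j 0 : 'cV[C]_n) l 0).
  by apply/matrixP => k l; rewrite !mxE -natrM mulnb !andbT.
by rewrite (le_trans (opnorm_rank1 _ _)) // !l2norm_delta mulr1.
Qed.

Lemma mx_entry_le n (y : 'M[C]_n) i j : nc (y i j) <= opnorm y.
Proof.
rewrite -[leRHS]mulr1 -(l2norm_delta j); apply: le_trans (opnorm_ub y _).
have -> : y i j = (y *m (delta_mx j 0 : 'cV[C]_n)) i 0.
  by rewrite -colE mxE.
rewrite -ler_sqr ?nnegrE ?nc_ge0 ?l2norm_ge0 // l2norm_sq (bigD1 i) //=.
by rewrite lerDl sumr_ge0 // => k _; rewrite exprn_ge0 ?nc_ge0.
Qed.

Let prset n (a : 'M[C]_n) :=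
  [set nc (mxpair a y) | y in [set y | opnorm y <= 1]].

Lemma mxpairZr n (a y : 'M[C]_n) c : mxpair a (c *: y) = c * mxpair a y.
Proof.
rewrite /mxpair mulr_sumr; apply: eq_bigr => i _; rewrite mulr_sumr.
by apply: eq_bigr => j _; rewrite mxE mulrCA.
Qed.

Lemma prset_sup n (a : 'M[C]_n) : has_sup (prset a).
Proof.
split; first by exists (nc (mxpair a 0)), 0 => //=; rewrite opnorm0.
exists (\sum_i \sum_j nc (a i j)) => _ [y /= y1 <-].
apply: le_trans (nc_sum _ _ _) _; apply: ler_sum => i _.
apply: le_trans (nc_sum _ _ _) _; apply: ler_sum => j _.
by rewrite Normc.normcM ler_piMr ?nc_ge0 // (le_trans (mx_entry_le _ _ _)).
Qed.

Lemma predual_ge0 n (a : 'M[C]_n) : 0 <= predual_norm a.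
Proof.
apply: le_trans (sup_upper_bound (prset_sup a) _).
  exact: (nc_ge0 (mxpair a 0)).
by exists 0 => //=; rewrite opnorm0.
Qed.

Lemma opnormZ n (c : C) (y : 'M[C]_n) : opnorm (c *: y) <= nc c * opnorm y.
Proof.
apply: opnorm_le => [|v]; first by rewrite mulr_ge0 ?nc_ge0 ?opnorm_ge0.
by rewrite -scalemxAl l2normZ -mulrA ler_wpM2l ?nc_ge0 // opnorm_ub.
Qed.

Lemma opnorm_eq0 n (y : 'M[C]_n) : opnorm y = 0 -> y = 0.
Proof.
move=> y0; apply/matrixP => i j; rewrite mxE; apply: Normc.eq0_normc.
by apply/eqP; rewrite eq_le nc_ge0 andbT -y0 mx_entry_le.
Qed.

Lemma mxpair_le n (a y : 'M[C]_n) :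
  nc (mxpair a y) <= predual_norm a * opnorm y.
Proof.
have [/opnorm_eq0->|y0] := eqVneq (opnorm y) 0.
  by rewrite opnorm0 mulr0 -(scale0r (0 : 'M[C]_n)) mxpairZr mul0r Normc.normc0.
have yp : 0 < opnorm y by rewrite lt_neqAle eq_sym y0 opnorm_ge0.
have nci : nc ((opnorm y)^-1)%:C = (opnorm y)^-1.
  by apply: (@complexI R); rewrite -normC_nc ger0_norm // lecR invr_ge0 ltW.
rewrite -ler_pdivrMr // mulrC -{1}nci -Normc.normcM -mxpairZr.
apply: (sup_upper_bound (prset_sup a)); exists (((opnorm y)^-1)%:C *: y) => //=.
by rewrite (le_trans (opnormZ _ _)) // nci mulVf.
Qed.

Lemma mxpair_deltar n (a : 'M[C]_n) i j : mxpair a (delta_mx i j) = a i j.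
Proof.
rewrite /mxpair (bigD1 i) //= [X in _ + X]big1 => [|k /negPf ki]; last first.
  by rewrite big1 // => l _; rewrite mxE ki mulr0.
rewrite addr0 (bigD1 j) //= big1 => [|l /negPf lj].
  by rewrite mxE !eqxx mulr1 addr0.
by rewrite mxE lj andbF mulr0.
Qed.

Lemma predual_entry n (a : 'M[C]_n) i j : nc (a i j) <= predual_norm a.
Proof.
rewrite -(mxpair_deltar a) (le_trans (mxpair_le _ _)) //.
by rewrite ler_piMr ?predual_ge0 // opnorm_delta.
Qed.

(** Pairing a with the rank-one matrix built from v and the conjugate of w = a v gives the squared
    norm of w. *)
Lemma opnorm_predual n (a : 'M[C]_n) : opnorm a <= predual_norm a.
Proof.
apply: opnorm_le => [|v]; first exact: predual_ge0.
set w := a *m v; have [->|w0] := eqVneq w 0.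
  by rewrite l2norm0 mulr_ge0 ?predual_ge0 ?l2norm_ge0.
have lw : 0 < l2norm w.
  rewrite lt_neqAle l2norm_ge0 andbT eq_sym.
  by apply: contraNneq w0 => /l2norm_eq0 ->.
pose wc : 'cV[C]_n := \col_i (w i 0)^*.
have lwc : l2norm wc = l2norm w.
  by congr Num.sqrt; apply: eq_bigr => i _; rewrite mxE ncJ.
rewrite -(ler_pM2l lw) -expr2.
have -> : l2norm w ^+ 2 = nc (mxpair a (\matrix_(i, j) (wc i 0 * v j 0))).
  apply: (@complexI R); rewrite -sqn_l2norm -normC_nc.
  have -> : mxpair a (\matrix_(i, j) (wc i 0 * v j 0)) = sqn w.
    apply: eq_bigr => i _; rewrite normCK {2}/w mxE mulr_suml.
    by apply: eq_bigr => j _; rewrite !mxE -/w; ring.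
  by rewrite ger0_norm // sumr_ge0 // => i _; rewrite exprn_ge0.
rewrite (le_trans (mxpair_le _ _)) // mulrCA ler_wpM2l ?predual_ge0 //.
by rewrite (le_trans (opnorm_rank1 _ _)) // lwc.
Qed.

Lemma predual0 n : predual_norm (0 : 'M[C]_n) = 0.
Proof.
apply/eqP; rewrite eq_le predual_ge0 andbT; apply: ge_sup.
  by case: (prset_sup (0 : 'M[C]_n)).
move=> _ [y _ <-]; rewrite /mxpair big1 ?Normc.normc0 // => i _.
by rewrite big1 // => j _; rewrite mxE mul0r.
Qed.

End Norms.

(** * Unconditional sums *)

Section UnconditionalSums.
Variables (R : realType) (I : choiceType).
Local Notation C := R[i].
Local Notation nc := (@Normc.normc R).
#[local] Existing Instance summability.totally_filter.
Implicit Types (J : {fset I}) (f : I -> C) (g u : I -> R).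

Definition has_sum f (L : C) := forall e : R, 0 < e ->
  exists J0, forall J, (J0 `<=` J)%fset -> nc (\sum_(i <- J) f i - L) <= e.

Lemma has_sumP f L : has_sum f L ->
  summability.sum (f : I -> C^o) = L.
Proof.
move=> hf; apply: cvg_lim; first exact: norm_hausdorff.
apply/cvgrPdist_le => -[e b]; rewrite ltcE /= => /andP[/eqP -> e0].
have [J0 hJ0] := hf e e0; exists J0 => // J /= J0J.
rewrite /summability.partial_sum -(big_seq_fsetE _ J xpredT f) /=.
by rewrite distrC normC_nc lecR hJ0.
Qed.

Lemma has_sum_linear f f' c L L' : has_sum f L -> has_sum f' L' ->
  has_sum (fun i => c * f i + f' i) (c * L + L').
Proof.
move=> hf hf' e e0.
have c1 : 0 < nc c + 1 by rewrite ltr_wpDl ?nc_ge0.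
have e2 : 0 < e / 2 by rewrite divr_gt0.
have [J0 h0] := hf _ (divr_gt0 e2 c1); have [J1 h1] := hf' _ e2.
exists (J0 `|` J1)%fset => J; rewrite fsubUset => /andP[/h0 {}h0 /h1 {}h1].
have -> : \sum_(i <- J) (c * f i + f' i) - (c * L + L')
    = c * (\sum_(i <- J) f i - L) + (\sum_(i <- J) f' i - L').
  by rewrite big_split -mulr_sumr /=; ring.
apply: le_trans (le_normcD _ _) _; rewrite Normc.normcM.
rewrite [leRHS]splitr lerD //.
apply: le_trans (ler_wpM2l (nc_ge0 _) h0) _.
by rewrite mulrCA ler_piMr ?(ltW e2) // ler_pdivrMr // mul1r lerDl.
Qed.

Lemma has_sum_point f i0 : (forall i, i != i0 -> f i = 0) -> has_sum f (f i0).
Proof.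
move=> f0 e e0; exists [fset i0]%fset => J; rewrite fsub1set => iJ.
rewrite (big_fsetD1 i0) //= big_seq big1 => [|i].
  by rewrite addr0 subrr Normc.normc0 ltW.
by rewrite !inE => /andP[/f0].
Qed.

Lemma sum_fset_split (V : nmodType) (F : I -> V) J J' : (J `<=` J')%fset ->
  \sum_(i <- J') F i = \sum_(i <- J) F i + \sum_(i <- J' | i \notin J) F i.
Proof.
move=> /fsubsetP JJ'; rewrite (bigID (mem J)) /=; congr (_ + _).
rewrite -big_filter; apply: perm_big; apply: uniq_perm => [||i].
- by rewrite filter_uniq // fset_uniq.
- exact: fset_uniq.
- by rewrite mem_filter; apply/andP/idP => [[]//|iJ]; split=> //; exact: JJ'.
Qed.

Lemma sum_fset_le u J J' : (forall i, 0 <= u i) -> (J `<=` J')%fset ->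
  \sum_(i <- J) u i <= \sum_(i <- J') u i.
Proof. by move=> u0 /sum_fset_split->; rewrite lerDl sumr_ge0. Qed.

Lemma has_sum_nneg u K : (forall i, 0 <= u i) ->
  (forall J, \sum_(i <- J) u i <= K) ->
  exists L : R, forall e, 0 < e ->
    exists J0, forall J, (J0 `<=` J)%fset -> `|\sum_(i <- J) u i - L| <= e.
Proof.
move=> u0 uK; pose A := [set \sum_(i <- J) u i | J in [set: {fset I}]].
have hA : has_sup A.
  split; first by exists (\sum_(i <- fset0) u i), fset0%fset.
  by exists K => _ [J _ <-].
exists (sup A) => e e0; have [_ [J0 _ <-] hJ0] := sup_adherent e0 hA.
exists J0 => J J0J; rewrite ler_distl; apply/andP; split.
  by rewrite (le_trans (ltW hJ0)) // sum_fset_le.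
apply: (@le_trans _ _ (sup A)); last by rewrite lerDl ltW.
by apply: (sup_upper_bound hA); exists J.
Qed.

(** f is the difference of the nonnegative families f + g and g, both with bounded partial sums. *)
Lemma has_sum_real (f : I -> R) g K : (forall i, `|f i| <= g i) ->
  (forall J, \sum_(i <- J) g i <= K) ->
  exists L : R, forall e, 0 < e ->
    exists J0, forall J, (J0 `<=` J)%fset -> `|\sum_(i <- J) f i - L| <= e.
Proof.
move=> fg gK; have g0 i : 0 <= g i by exact: le_trans (fg i).
have [L1 h1] : exists L : R, forall e, 0 < e ->
    exists J0, forall J, (J0 `<=` J)%fset ->
      `|\sum_(i <- J) (f i + g i) - L| <= e.
  apply: (@has_sum_nneg _ (K + K)) => [i|J].
    by have := fg i; rewrite ler_norml -subr_ge0 opprK => /andP[].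
  rewrite big_split lerD // (le_trans _ (gK J)) // ler_sum // => i _.
  by rewrite (le_trans (ler_norm _)).
have [L2 h2] := has_sum_nneg g0 gK.
exists (L1 - L2) => e e0; have e2 : 0 < e / 2 by rewrite divr_gt0.
have [J1 {}h1] := h1 _ e2; have [J2 {}h2] := h2 _ e2.
exists (J1 `|` J2)%fset => J; rewrite fsubUset => /andP[/h1 {}h1 /h2 {}h2].
have -> : \sum_(i <- J) f i - (L1 - L2) =
    (\sum_(i <- J) (f i + g i) - L1) - (\sum_(i <- J) g i - L2).
  by rewrite big_split /=; ring.
by rewrite (le_trans (ler_normB _ _)) // [leRHS](splitr e) lerD.
Qed.

Lemma nc_Re (z : C) : `|complex.Re z| <= nc z.
Proof. by rewrite -lecR -normC_nc; exact: normc_ge_Re. Qed.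

Lemma nc_Im (z : C) : `|complex.Im z| <= nc z.
Proof.
case: z => a b; rewrite /= -sqrtr_sqr ler_wsqrtr // lerDr sqr_ge0 //.
Qed.

Lemma nc_ReIm (z : C) : nc z <= `|complex.Re z| + `|complex.Im z|.
Proof.
case: z => a b; rewrite /= -[leRHS]ger0_norm ?addr_ge0 // -sqrtr_sqr.
rewrite ler_wsqrtr // sqrrD !real_normK ?num_real //.
by rewrite addrAC lerDl mulrn_wge0 // mulr_ge0.
Qed.

Lemma has_sum_dominated f g K : (forall i, nc (f i) <= g i) ->
  (forall J, \sum_(i <- J) g i <= K) ->
  exists2 L, has_sum f L & nc L <= K.
Proof.
move=> fg gK.
have [a ha] := @has_sum_real (fun i => complex.Re (f i)) g K
  (fun i => le_trans (nc_Re _) (fg i)) gK.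
have [b hb] := @has_sum_real (fun i => complex.Im (f i)) g K
  (fun i => le_trans (nc_Im _) (fg i)) gK.
have hL : has_sum f (a +i* b)%C.
  move=> e e0; have e2 : 0 < e / 2 by rewrite divr_gt0.
  have [J1 {}h1] := ha _ e2; have [J2 {}h2] := hb _ e2.
  exists (J1 `|` J2)%fset => J; rewrite fsubUset => /andP[/h1 {}h1 /h2 {}h2].
  apply: le_trans (nc_ReIm _) _; rewrite [leRHS]splitr lerD //.
    rewrite (_ : complex.Re _ = \sum_(i <- J) complex.Re (f i) - a) //.
    rewrite -(big_morph (@complex.Re R) (id1 := 0) (op1 := +%R) (id2 := 0)
      (op2 := +%R)) //; last by case=> ? ? [].
    by case: (\sum_(i <- J) f i).
  rewrite (_ : complex.Im _ = \sum_(i <- J) complex.Im (f i) - b) //.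
  rewrite -(big_morph (@complex.Im R) (id1 := 0) (op1 := +%R) (id2 := 0)
    (op2 := +%R)) //; last by case=> ? ? [].
  by case: (\sum_(i <- J) f i).
exists (a +i* b)%C => //; apply/ler_addgt0Pr => e e0.
have [J0 /(_ J0 (fsubset_refl _)) hJ0] := hL e e0.
set s := \sum_(i <- J0) f i in hJ0.
have -> : (a +i* b)%C = s + - (s - (a +i* b)%C) by ring.
apply: le_trans (le_normcD _ _) _; rewrite normcN lerD //.
apply: le_trans (nc_sum _ _ _) _; apply: le_trans (gK J0).
exact: ler_sum.
Qed.

End UnconditionalSums.

Section MatrixFamilies.
Variables (R : realType) (I : choiceType) (n : I -> nat).
Local Notation C := R[i].
Local Notation nc := (@Normc.normc R).
Local Notation F := (mxfamily R n).
Implicit Types (a b y z : F) (J : {fset I}).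

Lemma l1_sum_le a J : l1 a ->
  \sum_(i <- J) predual_norm (a i) <= fine (l1norm a).
Proof.
move=> ha; have h0 : (0 <= l1norm a)%E.
  by apply: esum_ge0 => i _; rewrite lee_fin predual_ge0.
rewrite -lee_fin fineK; last by rewrite ge0_fin_numE.
apply: esum_ge; exists [set` J].
  by split=> //; exact: finite_fset.
by rewrite -fsbig_seq ?fset_uniq // sumEFin.
Qed.

Lemma l1_of_sum a K : (forall J, \sum_(i <- J) predual_norm (a i) <= K) ->
  l1 a /\ fine (l1norm a) <= K.
Proof.
move=> hK; have h : (l1norm a <= K%:E)%E.
  apply: ge_ereal_sup => _ [X [finX _] <-].
  rewrite fsbig_finite // sumEFin lee_fin; exact: hK.
have ha : l1 a by rewrite /l1 /= (le_lt_trans h) // ltry.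
split=> //; have h0 : (0 <= l1norm a)%E.
  by apply: esum_ge0 => i _; rewrite lee_fin predual_ge0.
by rewrite -lee_fin fineK // ge0_fin_numE.
Qed.

Lemma l1_approx a e : l1 a -> 0 < e -> exists J,
  fine (l1norm a) - e <= \sum_(i <- J) predual_norm (a i).
Proof.
move=> ha e0; apply: contrapT => hJ.
have [|_] := @l1_of_sum a (fine (l1norm a) - e).
  move=> J; rewrite leNgt; apply/negP => /ltW h; apply: hJ; by exists J.
by rewrite lerBrDl gerDr leNgt e0.
Qed.

Lemma l1_fine_ge0 a : 0 <= fine (l1norm a).
Proof.
by apply: fine_ge0; apply: esum_ge0 => i _; rewrite lee_fin predual_ge0.
Qed.

(** The maximum with 0 covers an empty index set, where M may be negative. *)
Lemma pairing_has_sum a y M : l1 a -> (forall i, opnorm (y i) <= M) ->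
  has_sum (fun i => mxpair (a i) (y i)) (pairing a y) /\
  nc (pairing a y) <= fine (l1norm a) * Num.max 0 M.
Proof.
move=> ha hM; have M0 : 0 <= Num.max 0 M by rewrite le_max lexx.
have [i|J|L hL nL] := @has_sum_dominated R I (fun i => mxpair (a i) (y i))
    (fun i => predual_norm (a i) * Num.max 0 M) (fine (l1norm a) * Num.max 0 M).
- rewrite (le_trans (mxpair_le _ _)) // ler_wpM2l ?predual_ge0 //.
  by rewrite (le_trans (hM i)) // le_max lexx orbT.
- by rewrite -mulr_suml ler_wpM2r // l1_sum_le.
by rewrite /pairing (has_sumP hL).
Qed.

Lemma pairing_point a y i : (forall j, j != i -> mxpair (a j) (y j) = 0) ->
  pairing a y = mxpair (a i) (y i).
Proof.
move=> h; apply: has_sumP.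
exact: (has_sum_point (f := fun i => mxpair (a i) (y i)) h).
Qed.

Lemma mxpairDl m (a b y : 'M[C]_m) c :
  mxpair (c *: a + b) y = c * mxpair a y + mxpair b y.
Proof.
rewrite /mxpair mulr_sumr -big_split; apply: eq_bigr => i _ /=.
rewrite mulr_sumr -big_split; apply: eq_bigr => j _ /=.
by rewrite !mxE; ring.
Qed.

Lemma mxpairDr m (a y z : 'M[C]_m) c :
  mxpair a (c *: y + z) = c * mxpair a y + mxpair a z.
Proof.
rewrite /mxpair mulr_sumr -big_split; apply: eq_bigr => i _ /=.
rewrite mulr_sumr -big_split; apply: eq_bigr => j _ /=.
by rewrite !mxE; ring.
Qed.

Lemma pairing_linl a b y c : l1 a -> l1 b -> linfty y ->
  pairing (fam_lin c a b) y = c * pairing a y + pairing b y.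
Proof.
move=> ha hb [M hM]; apply: has_sumP.
have [h1 _] := pairing_has_sum ha hM; have [h2 _] := pairing_has_sum hb hM.
have := has_sum_linear c h1 h2.
by congr has_sum; apply: funext => i; rewrite mxpairDl.
Qed.

Lemma pairing_linr a y z c : l1 a -> linfty y -> linfty z ->
  pairing a (fam_lin c y z) = c * pairing a y + pairing a z.
Proof.
move=> ha [M hM] [M' hM']; apply: has_sumP.
have [h1 _] := pairing_has_sum ha hM; have [h2 _] := pairing_has_sum ha hM'.
have := has_sum_linear c h1 h2.
by congr has_sum; apply: funext => i; rewrite mxpairDr.
Qed.

Lemma mxunit_in (i : I) (k l : 'I_(n i)) : mxunit R k l i = delta_mx k l.
Proof. by rewrite /mxunit dfwithin. Qed.

Lemma mxunit_out (i j : I) (k l : 'I_(n i)) : i != j -> mxunit R k l j = 0.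
Proof. by move=> ij; rewrite /mxunit dfwithout. Qed.

Lemma mxunit_linfty (i : I) (k l : 'I_(n i)) : linfty (mxunit R k l).
Proof.
exists 1 => j; have [<-|ij] := eqVneq i j.
  by rewrite mxunit_in opnorm_delta.
by rewrite mxunit_out // opnorm0.
Qed.

Lemma l1_point a i : (forall j, j != i -> a j = 0) ->
  l1 a /\ fine (l1norm a) <= predual_norm (a i).
Proof.
move=> h; apply: l1_of_sum => J.
have [iJ|iJ] := boolP (i \in J).
  rewrite (big_fsetD1 i) //= big_seq big1 => [|j]; first by rewrite addr0.
  by rewrite !inE => /andP[/h-> _]; rewrite predual0.
rewrite big_seq big1 ?predual_ge0 // => j jJ.
by rewrite h ?predual0 //; apply: contraNneq iJ => <-.
Qed.

Lemma mxunit_l1 (i : I) (k l : 'I_(n i)) : l1 (mxunit R k l).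
Proof.
apply: (l1_point (i := i) _).1 => j ji.
by rewrite mxunit_out // eq_sym.
Qed.

Lemma mxpairC m (a y : 'M[C]_m) : mxpair a y = mxpair y a.
Proof. by apply: eq_bigr => i _; apply: eq_bigr => j _; rewrite mulrC. Qed.

Lemma mxpair0l m (y : 'M[C]_m) : mxpair 0 y = 0.
Proof.
by rewrite /mxpair big1 // => i _; rewrite big1 // => j _; rewrite mxE mul0r.
Qed.

Lemma mxpair0r m (y : 'M[C]_m) : mxpair y 0 = 0.
Proof. by rewrite mxpairC mxpair0l. Qed.

Lemma pairing_unitr a (i : I) (k l : 'I_(n i)) :
  pairing a (mxunit R k l) = a i k l.
Proof.
rewrite (@pairing_point _ _ i) ?mxunit_in ?mxpair_deltar // => j ji.
by rewrite mxunit_out ?mxpair0r // eq_sym.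
Qed.

Lemma pairing_unitl y (i : I) (k l : 'I_(n i)) :
  pairing (mxunit R k l) y = y i k l.
Proof.
have -> : pairing (mxunit R k l) y = mxpair (mxunit R k l i) (y i).
  by apply: pairing_point => j ji; rewrite mxunit_out ?mxpair0l // eq_sym.
by rewrite mxunit_in mxpairC mxpair_deltar.
Qed.

End MatrixFamilies.

(** * The Fourier algebra *)

Section DualCoproduct.
Variables (R : realType) (G : quantumGroup R[i]).
Local Notation C := R[i].
Variables (I : choiceType) (n : I -> nat).
Variable U : forall alpha, 'M[Pol G]_(n alpha).
Variables (D : mxfamily R n -> mxfamily R (dim2 n)).
Hypothesis hD : is_dual_coproduct U D.

Definition dual_rho (b c alpha : I) (i j : 'I_(n alpha)) : 'M[C]_(n b * n c) :=
  D (mxunit R i j) (b, c).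

Definition dual_supp (b c : I) : seq I :=
  fset_set [set alpha |
    exists i j : 'I_(n alpha), D (mxunit R i j) (b, c) <> 0].

Let fam0 : mxfamily R n := fun=> 0.

Lemma linfty0 : linfty fam0.
Proof. by exists 0 => i; rewrite opnorm0. Qed.

Lemma dual_coproduct0 : D fam0 = fun=> 0.
Proof.
have E : fam_lin (-1) fam0 fam0 = fam0.
  by apply: functional_extensionality_dep => i; rewrite /fam_lin scaler0 addr0.
have := dc_linear hD (-1) linfty0 linfty0; rewrite E => E2.
apply: functional_extensionality_dep => p.
by rewrite E2 /fam_lin scaleN1r addNr.
Qed.

Lemma dual_rho_out b c alpha (i j : 'I_(n alpha)) :
  alpha \notin dual_supp b c -> dual_rho b c i j = 0.
Proof.
rewrite /dual_supp in_fset_set; last exact: (dc_finite hD (b, c)).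
move=> /negP h.
by apply: contrapT => hr; apply: h; rewrite inE; exists i, j.
Qed.

Lemma dual_decomposition b c :
  decomposition U (U b *t U c) (dual_supp b c)
    (fun alpha => @dual_rho b c alpha).
Proof.
split.
- exact: dual_rho_out.
- exact: fset_uniq.
- apply/matrixP => p q; case: (mxtens_indexP p) => k m.
  case: (mxtens_indexP q) => l r.
  rewrite tensmxE -(dc_coef hD) (@fsbigTE _ _ _ _ (fset_set [set alpha |
    exists i j : 'I_(n alpha), D (mxunit R i j) (b, c) <> 0])).
    rewrite summxE; apply: eq_bigr => a _.
    rewrite summxE; apply: eq_bigr => i _.
    rewrite summxE; apply: eq_bigr => j _.
    by rewrite !mxE mulr_algr.
  move=> a /dual_rho_out h; rewrite big1 // => i _; rewrite big1 // => j _.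
  by have := h i j; rewrite /dual_rho => ->; rewrite mxE scale0r.
- move=> a i j k l.
  have E : fam_mul (mxunit R i j) (mxunit R k l)
      = fam_lin (j == k)%:R (mxunit R i l) fam0.
    apply: functional_extensionality_dep => b'; rewrite /fam_mul /fam_lin.
    have [<-|ab] := eqVneq a b'.
      by rewrite !mxunit_in mul_delta_mx_cond addr0 scaler_nat.
    by rewrite !mxunit_out // mul0mx scaler0 addr0.
  have := congr1 (fun y => D y (b, c)) E.
  have u0 := mxunit_linfty R.
  rewrite (dc_mul hD (u0 _ _ _ _ _) (u0 _ _ _ _ _)).
  rewrite (dc_linear hD _ (u0 _ _ _ _ _) linfty0).
  by rewrite dual_coproduct0 /fam_lin addr0.
- move=> a a' i j k l aa'.
  have E : fam_mul (mxunit R i j) (mxunit R k l) = fam0.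
    apply: functional_extensionality_dep => b'; rewrite /fam_mul /fam0.
    have [ab|ab] := eqVneq a b'; last by rewrite mxunit_out // mul0mx.
    by rewrite (mxunit_out R k l) ?mulmx0 // -ab eq_sym.
  have := congr1 (fun y => D y (b, c)) E.
  have u0 := mxunit_linfty R.
  by rewrite (dc_mul hD (u0 _ _ _ _ _) (u0 _ _ _ _ _)) /= dual_coproduct0.
- move=> a i j.
  have E : fam_adj (mxunit R i j) = mxunit R j i.
    apply: functional_extensionality_dep => b'; rewrite /fam_adj.
    have [<-|ab] := eqVneq a b'.
      by rewrite !mxunit_in trmx_delta map_delta_mx.
    by rewrite !mxunit_out // trmx0 map_mx0.
  have := congr1 (fun y => D y (b, c)) E.
  by rewrite (dc_adj hD (mxunit_linfty R i j)).
Qed.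

End DualCoproduct.

Section FourierAlgebra.
Variables (R : realType) (G : quantumGroup R[i]).
Local Notation C := R[i].
Local Notation nc := (@Normc.normc R).
Variables (I : choiceType) (n : I -> nat).
Variable U : forall alpha, 'M[Pol G]_(n alpha).
Variables (D : mxfamily R n -> mxfamily R (dim2 n)).
Hypothesis hD : is_dual_coproduct U D.
Variables (A : banachAlgebra C) (Phi : A -> mxfamily R n).
Hypothesis hA : is_Fourier_algebra D Phi.
Local Notation "a ** b" := (ba_mul a b) (at level 40).

Definition normA (a : A) : R := fine (l1norm (Phi a)).

Lemma normAE a : `|a| = real_complex R (normA a).
Proof. exact: fa_norm hA a. Qed.

Lemma normA_ge0 a : 0 <= normA a.
Proof. exact: l1_fine_ge0. Qed.

Lemma Phi_l1 a : l1 (Phi a).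
Proof. by rewrite -(fa_range hA); exists a. Qed.

Lemma coor_linear i (k l : 'I_(n i)) : linear (fun a => Phi a i k l : C^o).
Proof. by move=> c a b; rewrite (fa_linear hA) !mxE. Qed.

Lemma Phi_inj : injective Phi.
Proof.
move=> a b ab; apply/eqP; rewrite -subr_eq0 -normr_eq0 normAE /normA.
have -> : Phi (a - b) = fun=> 0.
  rewrite addrC -scaleN1r (fa_linear hA) ab.
  apply: functional_extensionality_dep => i.
  by rewrite /fam_lin scaleN1r addNr.
have [|_] := @l1_of_sum R I n (fun=> 0) 0.
  by move=> J; rewrite big1 // => i _; exact: predual0.
move=> h; apply/eqP; rewrite -(rmorph0 (real_complex R)); congr (_%:C)%C.
by apply/eqP; rewrite eq_le h l1_fine_ge0.
Qed.

Lemma matrix_unit_ex i (k l : 'I_(n i)) : exists a, Phi a = mxunit R k l.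
Proof.
have : l1 (mxunit R k l) by exact: mxunit_l1.
by rewrite -(fa_range hA) => -[a _ <-]; exists a.
Qed.

(** This element stands for the coefficient [U i k l]: the structure constants in [munitM_expand]
    are those by which [dc_coef] expands a product of coefficients. *)
Definition munit i (k l : 'I_(n i)) : A := sval (cid (matrix_unit_ex k l)).

Lemma Phi_munit i (k l : 'I_(n i)) : Phi (munit k l) = mxunit R k l.
Proof. by rewrite /munit; case: cid. Qed.

Definition blk i (y : 'M[C]_(n i)) : A := \sum_k \sum_l y k l *: munit k l.

Lemma Phi_blk_in i (y : 'M[C]_(n i)) : Phi (blk y) i = y.
Proof.
apply/matrixP => k l; rewrite (lin_sum _ _ _ (coor_linear k l)).
under eq_bigr => k' _.
  rewrite (lin_sum _ _ _ (coor_linear k l)).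
  under eq_bigr do rewrite (lin_Z _ _ (coor_linear k l)) Phi_munit mxunit_in
    mxE -mulnb natrM.
  over.
rewrite (bigD1 k) //= [X in _ + X]big1 => [|k' /negPf kk]; last first.
  by rewrite big1 // => l' _; rewrite eq_sym kk mul0r scaler0.
rewrite addr0 (bigD1 l) //= big1 => [|l' /negPf ll].
  by rewrite !eqxx mul1r addr0 [LHS]mulr1.
by rewrite (eq_sym l) ll mulr0 scaler0.
Qed.

Lemma Phi_blk_out i j (y : 'M[C]_(n i)) : i != j -> Phi (blk y) j = 0.
Proof.
move=> ij; apply/matrixP => k l; rewrite (lin_sum _ _ _ (coor_linear k l)).
rewrite big1 ?mxE // => k' _; rewrite (lin_sum _ _ _ (coor_linear k l)).
rewrite big1 // => l' _.
by rewrite (lin_Z _ _ (coor_linear k l)) Phi_munit mxunit_out // mxE scaler0.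
Qed.

Lemma Phi_blk_sum (s : seq I) (y : mxfamily R n) j : uniq s ->
  Phi (\sum_(i <- s) blk (y i)) j = if j \in s then y j else 0.
Proof.
move=> us; apply/matrixP => k l; rewrite (lin_sum _ _ _ (coor_linear k l)).
have [js|js] := boolP (j \in s).
  rewrite (bigD1_seq j) //= Phi_blk_in big1 ?addr0 // => i ij.
  by rewrite Phi_blk_out // mxE.
rewrite big1_seq ?mxE // => i /andP[_ is_].
by rewrite Phi_blk_out ?mxE //; apply: contraNneq js => <-.
Qed.

Lemma blk_expand (s : seq I) a : uniq s ->
  (forall i, i \notin s -> Phi a i = 0) -> a = \sum_(i <- s) blk (Phi a i).
Proof.
move=> us ha; apply: Phi_inj; apply: functional_extensionality_dep => j.
rewrite Phi_blk_sum //; case: ifPn => // /ha ->.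
by [].
Qed.

(** The norm of A is the sum of the norms of the blocks, so a constant valid on single blocks is
    valid on finite sums of blocks. The a priori constant K gives the continuity needed to pass to
    the limit and does not enter the result. *)
Lemma block_bound (phi : A -> C^o) K c : linear phi ->
  (forall a, nc (phi a) <= K * normA a) -> 0 <= c ->
  (forall i (y : 'M[C]_(n i)), nc (phi (blk y)) <= c * predual_norm y) ->
  forall a, nc (phi a) <= c * normA a.
Proof.
move=> lphi hK c0 hblk a; apply/ler_addgt0Pr => e e0.
(* K may be zero or negative, hence the divisor |K| + 1. *)
have K1 : 0 < `|K| + 1 by rewrite ltr_wpDl.
have [J hJ] := l1_approx (Phi_l1 a) (divr_gt0 e0 K1).
pose b := \sum_(i <- J) blk (Phi a i).
have hb : nc (phi b) <= c * normA a.
  rewrite (lin_sum _ _ _ lphi) (le_trans (nc_sum _ _ _)) //.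
  apply: le_trans (ler_wpM2l c0 (l1_sum_le J (Phi_l1 a))).
  by rewrite mulr_sumr; apply: ler_sum => i _; exact: hblk.
have hab : normA (a - b) <= e / (`|K| + 1).
  have E i : Phi (a - b) i = if i \in J then 0 else Phi a i.
    have := fa_linear hA (-1) b a; rewrite scaleN1r addrC => ->.
    rewrite /fam_lin Phi_blk_sum ?fset_uniq //.
    by case: ifP => _; rewrite ?scaler0 ?add0r // scaleN1r addNr.
  apply: (l1_of_sum _).2 => J'.
  rewrite (bigID (mem J)) /= big1 => [|i iJ]; last by rewrite E iJ predual0.
  rewrite add0r.
  have -> : \sum_(i <- J' | i \notin J) predual_norm (Phi (a - b) i)
      = \sum_(i <- J' | i \notin J) predual_norm (Phi a i).
    by apply: eq_bigr => i /negPf iJ; rewrite E iJ.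
  have h1 : \sum_(i <- J' | i \notin J) predual_norm (Phi a i)
      <= \sum_(i <- (J `|` J')%fset | i \notin J) predual_norm (Phi a i).
    rewrite big_mkcond [leRHS]big_mkcond /=.
    apply: sum_fset_le; last exact: fsubsetUr.
    by move=> i; case: ifP => // _; exact: predual_ge0.
  apply: le_trans h1 _.
  have := sum_fset_split (fun i => predual_norm (Phi a i)) (fsubsetUl J J').
  have := l1_sum_le (J `|` J')%fset (Phi_l1 a).
  by move=> h2 h3; rewrite h3 in h2; lra.
have -> : a = 1 *: b + (a - b) by rewrite scale1r addrC subrK.
rewrite lphi scale1r (le_trans (le_normcD _ _)) // lerD //.
  by rewrite [X in normA X](_ : _ = a) // scale1r addrC subrK.
apply: le_trans (hK _) _.
apply: le_trans (ler_wpM2r (normA_ge0 _) (ler_norm K)) _.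
apply: le_trans (ler_wpM2l (normr_ge0 K) hab) _.
by rewrite mulrCA ler_piMr ?(ltW e0) // ler_pdivrMr // mul1r lerDl.
Qed.

Lemma munit_ext (f g : A -> C^o) K : linear f -> linear g ->
  (forall a, nc (f a - g a) <= K * normA a) ->
  (forall i (k l : 'I_(n i)), f (munit k l) = g (munit k l)) -> f =1 g.
Proof.
move=> lf lg hK hfg a; apply/eqP; rewrite -subr_eq0; apply/eqP.
apply: Normc.eq0_normc; apply/eqP; rewrite eq_le nc_ge0 andbT.
have lfg : linear ((fun a => f a - g a) : A -> C^o).
  by move=> c u v; rewrite lf lg scalerBr opprD addrACA.
rewrite -(mul0r (normA a)); apply: (block_bound lfg hK) => // i y.
rewrite mul0r (lin_sum _ _ _ lfg) big1 ?Normc.normc0 // => k _.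
rewrite (lin_sum _ _ _ lfg) big1 // => l _.
by rewrite (lin_Z _ _ lfg) hfg subrr scaler0.
Qed.

Lemma mull_lin b : linear (fun a : A => a ** b).
Proof. by have [h _] := ba_mul_bilinear A; exact: h. Qed.

Lemma mulr_lin (a : A) : linear (fun b : A => a ** b).
Proof. by have [_ h] := ba_mul_bilinear A; exact: h. Qed.

Lemma normAM a b : normA (a ** b) <= normA a * normA b.
Proof. by rewrite -lecR rmorphM /= -!normAE ba_mul_norm. Qed.

Lemma coor_le i (k l : 'I_(n i)) a : nc (Phi a i k l) <= normA a.
Proof.
apply: le_trans (predual_entry _ _ _) _.
have := l1_sum_le [fset i]%fset (Phi_l1 a).
by rewrite big_seq_fset1.
Qed.

Lemma munitM b c (k l : 'I_(n b)) (p q : 'I_(n c)) i (r s : 'I_(n i)) :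
  Phi (munit k l ** munit p q) i r s
  = dual_rho D b c r s (mxtens_index (k, p)) (mxtens_index (l, q)).
Proof.
transitivity (pairing (Phi (munit k l ** munit p q)) (mxunit R r s)).
  by rewrite pairing_unitr.
rewrite (fa_mul hA _ _ (mxunit_linfty R r s)) !Phi_munit.
have -> : fam_tens (mxunit R k l) (mxunit R p q) =
    @mxunit R _ (dim2 n) (b, c) (mxtens_index (k, p)) (mxtens_index (l, q)).
  apply: functional_extensionality_dep => -[b' c']; rewrite /fam_tens /=.
  have [bb|bb] := eqVneq b b'; last first.
    rewrite (mxunit_out R k l bb) tens0mx mxunit_out //.
    by apply: contraNneq bb => -[->].
  have [cc|cc] := eqVneq c c'; last first.
    rewrite (mxunit_out R p q cc) tensmx0 mxunit_out //.
    by apply: contraNneq cc => -[_ ->].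
  case: b' / bb; case: c' / cc; rewrite !mxunit_in.
  apply/matrixP => x y; case: (mxtens_indexP x) => x1 x2.
  case: (mxtens_indexP y) => y1 y2; rewrite tensmxE !mxE.
  rewrite !(can_eq (@mxtens_indexK _ _)) !xpair_eqE -natrM mulnb.
  by rewrite andbACA.
by rewrite pairing_unitl.
Qed.

Lemma munitM_expand b c (k l : 'I_(n b)) (p q : 'I_(n c)) :
  munit k l ** munit p q = \sum_(i <- dual_supp D b c) \sum_r \sum_s
    dual_rho D b c r s (mxtens_index (k, p)) (mxtens_index (l, q))
      *: @munit i r s.
Proof.
rewrite {1}(@blk_expand (dual_supp D b c) (munit k l ** munit p q)).
- apply: eq_bigr => i _; apply: eq_bigr => r _; apply: eq_bigr => s _.
  by rewrite munitM.
- exact: fset_uniq.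
- move=> i hi; apply/matrixP => r s.
  by rewrite munitM (dual_rho_out hD) // !mxE.
Qed.

End FourierAlgebra.

(** * The derivation *)

Section Derivation.
Variables (R : realType) (G : quantumGroup R[i]).
Local Notation C := R[i].
Local Notation nc := (@Normc.normc R).
Variables (N : nat) (x : 'M[Pol G]_N) (hG : is_free_orthogonal x).
Variables (kap : Pol G -> Pol G) (hkap : is_kappa x kap).
Variables (eps : Pol G -> C^o) (heps : is_counit x eps).
Variables (I : choiceType) (n : I -> nat).
Variables (U : forall alpha, 'M[Pol G]_(n alpha)) (hU : is_Irr U).
Variables (a0 : I) (e0 : 'I_(n a0)).
Hypothesis na0 : n a0 = 1%N.
Hypothesis Ua0 : forall i j, U a0 i j = 1.
Hypothesis irr0 : forall a v, a != a0 -> inv_vec (U a) v -> v = 0.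
Variables (D : mxfamily R n -> mxfamily R (dim2 n)).
Hypothesis hD : is_dual_coproduct U D.
Variables (A : banachAlgebra C) (Phi : A -> mxfamily R n).
Hypothesis hA : is_Fourier_algebra D Phi.
Local Notation "a ** b" := (ba_mul a b) (at level 40).
Local Notation munit := (munit hA).
Local Notation blk := (blk hA).
Local Notation normA := (normA Phi).

Local Notation proj := (triv_proj e0 (dual_rho D)).
Let dec := dual_decomposition hD.

Definition haar (a : A) : C^o := Phi a a0 e0 e0.

Lemma haar_linear : linear haar.
Proof. exact: (coor_linear hA e0 e0). Qed.

Lemma haar_le a : nc (haar a) <= normA a.
Proof. exact: (coor_le hA). Qed.

Lemma haar_munit b c (k l : 'I_(n b)) (p q : 'I_(n c)) :
  haar (munit k l ** munit p q)
  = proj b c (mxtens_index (k, p)) (mxtens_index (l, q)).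
Proof. exact: munitM. Qed.

Lemma haarM_le a b : nc (haar (a ** b)) <= normA a * normA b.
Proof. exact: le_trans (haar_le _) (normAM hA a b). Qed.

Lemma haarM_linl b : linear (fun a => haar (a ** b)).
Proof. by move=> c u v; rewrite (mull_lin b) haar_linear. Qed.

Lemma haarM_linr a : linear (fun b => haar (a ** b)).
Proof. by move=> c u v; rewrite (mulr_lin a) haar_linear. Qed.

Lemma nc_sub_le (u v : C) (r s : R) : nc u <= r -> nc v <= s ->
  nc (u - v) <= r + s.
Proof.
by move=> ur vs; rewrite (le_trans (le_normcD _ _)) // normcN lerD.
Qed.

(** On matrix units the two sides are matching entries of [triv_proj] and of its flip; continuity in
    each variable does the rest. *)
Lemma haar_trace a b : haar (a ** b) = haar (b ** a).
Proof.
have bound u v : nc (haar (u ** v) - haar (v ** u)) <= 2 * normA u * normA v.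
  rewrite -mulrA mulr_natl mulr2n; apply: nc_sub_le (haarM_le _ _) _.
  by rewrite (mulrC (normA u)) haarM_le.
move: a; apply: (munit_ext (hA := hA) (K := 2 * normA b)
  (haarM_linl b) (haarM_linr b)).
  by move=> a; rewrite mulrAC bound.
move=> i k l; move: b; apply: (munit_ext (hA := hA) (K := 2 * normA (munit k l))
  (haarM_linr (munit k l)) (haarM_linl (munit k l))) => [b|].
  by rewrite bound.
move=> c p q; rewrite !haar_munit.
rewrite -(triv_proj_flip hG hkap heps hU e0 na0 Ua0 irr0 dec c i).
by rewrite mxE !swap_indexE.
Qed.

Variables (M : 'M[C]_N) (eta : Pol G -> C^o) (heta : is_skew x eps 1 M eta).
Definition gen_mx i : 'M[C]_(n i) := map_mx eta (U i).
Hypothesis gen_bound : forall i v,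
  l2norm (gen_mx i *m v) <= (n i)%:R * l2norm v.

(* [delta (munit k l)] for the derivation [delta = (id (x) eta) Delta], which is
   unbounded and defined only on the span of the matrix units. *)
Definition delta_munit i (k l : 'I_(n i)) : A :=
  \sum_m gen_mx i m l *: munit k m.

(** The left side is delta applied term by term to the expansion of [munit k l ** munit p q]. The
    identity compares two values of eta(U b (x) U c): the sum of the eta(U i r s) rho r s, and eta(U
    b) (x) 1 + 1 (x) eta(U c). *)
Lemma delta_leibniz b c (k l : 'I_(n b)) (p q : 'I_(n c)) :
  \sum_(i <- dual_supp D b c) \sum_r \sum_s
    dual_rho D b c r s (mxtens_index (k, p)) (mxtens_index (l, q))
      *: @delta_munit i r s
  = delta_munit k l ** munit p q + munit k l ** delta_munit p q.
Proof.
rewrite /delta_munit (lin_sum _ _ _ (mull_lin _)) (lin_sum _ _ _ (mulr_lin _)).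
under [X in _ = X + _]eq_bigr do
  rewrite (lin_Z _ _ (mull_lin _)) (munitM_expand hD) scaler_sumr.
under [X in _ = _ + X]eq_bigr do
  rewrite (lin_Z _ _ (mulr_lin _)) (munitM_expand hD) scaler_sumr.
rewrite [X in _ = X + _]exchange_big [X in _ = _ + X]exchange_big -big_split.
apply: eq_bigr => i _ /=.
under [X in _ = X + _]eq_bigr do rewrite scaler_sumr.
under [X in _ = _ + X]eq_bigr do rewrite scaler_sumr.
rewrite [X in _ = X + _]exchange_big [X in _ = _ + X]exchange_big -big_split.
apply: eq_bigr => r _ /=.
under [X in _ = X + _]eq_bigr do rewrite scaler_sumr.
under [X in _ = _ + X]eq_bigr do rewrite scaler_sumr.
rewrite [X in _ = X + _]exchange_big [X in _ = _ + X]exchange_big -big_split.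
under eq_bigr do rewrite scaler_sumr.
rewrite exchange_big /=; apply: eq_bigr => s _.
under eq_bigr do rewrite scalerA mulrC.
under [X in _ = X + _]eq_bigr do rewrite scalerA.
under [X in _ = _ + X]eq_bigr do rewrite scalerA.
rewrite -!scaler_suml -scalerDl; congr (_ *: _).
have [le _ _] := heta.
have W := dec_functional (dec b c) le.
rewrite (tens_skew hG heps (Irr_unitary hU b) (Irr_unitary hU c) heta) in W.
have E := dec_mul_sum (dec b c) (fun i p q => eta (U i p q)) r s.
rewrite -W in E.
have /matrixP/(_ (mxtens_index (k, p)) (mxtens_index (l, q))) := E.
rewrite [RHS]summxE => E2.
transitivity (\sum_(q0 < n i)
  (eta (U i s q0) *: dual_rho D b c r q0)
    (mxtens_index (k, p)) (mxtens_index (l, q))).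
  by apply: eq_bigr => t _; rewrite !mxE.
rewrite -E2 mxE sum_mxtens.
pose rho i0 k0 :=
  dual_rho D b c r s (mxtens_index (k, p)) (mxtens_index (i0, k0)).
transitivity (\sum_i0 \sum_k0 (rho i0 k0 * (gen_mx b i0 l * (k0 == q)%:R)
    + rho i0 k0 * ((i0 == l)%:R * gen_mx c k0 q))).
  apply: eq_bigr => i0 _; apply: eq_bigr => k0 _.
  by rewrite mxE !tensmxE -mulrDr; congr (_ * (_ + _)); rewrite [1%:M _ _]mxE.
under eq_bigr do rewrite big_split.
rewrite big_split /=; congr (_ + _).
  apply: eq_bigr => i0 _; under eq_bigr do rewrite mulrA.
  by rewrite sum_deltar mulrC.
rewrite exchange_big /=; apply: eq_bigr => k0 _.
under eq_bigr do rewrite mulrCA mulrC.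
by rewrite sum_deltar mulrC.
Qed.

(** The functional a -> h(delta(a) b) as an element of l^oo, given by its values on matrix units. *)
Definition deriv_dual (b : A) : mxfamily R n :=
  fun i => \matrix_(k, l) haar (delta_munit k l ** b).

(** The squared norm of w is a linear functional phi evaluated at b, so by [block_bound] it suffices
    to treat a single block y. There the matrix is Z eta(U i), where Z has norm at most [opnorm y] /
    n i by [triv_proj_bound], and eta(U i) has norm at most n i: the dimensions cancel. *)
Lemma deriv_dual_bound b i : opnorm (deriv_dual b i) <= normA b.
Proof.
apply: opnorm_le => [|v]; first exact: normA_ge0.
set w := deriv_dual b i *m v.
have [->|w0] := eqVneq w 0.
  by rewrite l2norm0 mulr_ge0 ?normA_ge0 ?l2norm_ge0.
have lw : 0 < l2norm w.
  rewrite lt_neqAle l2norm_ge0 andbT eq_sym.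
  by apply: contraNneq w0 => /l2norm_eq0 ->.
pose wc : 'cV[C]_(n i) := \col_k (w k 0)^*.
have lwc : l2norm wc = l2norm w.
  by congr Num.sqrt; apply: eq_bigr => k _; rewrite mxE ncJ.
pose phi (a : A) : C^o :=
  \sum_k wc k 0 * \sum_l v l 0 * haar (delta_munit k l ** a).
have phi_lin : linear phi.
  apply: linear_suml => k; apply: (linear_Z (wc k 0)).
  by apply: linear_suml => l; apply: (linear_Z (v l 0)); exact: haarM_linr.
have phib : phi b = sqn w.
  apply: eq_bigr => k _; rewrite normCK mulrC [wc _ _]mxE.
  congr (_ * _); rewrite /w mxE.
  by apply: eq_bigr => l _; rewrite [deriv_dual b i k l]mxE mulrC.
(* This constant depends on i, v and w; it is only the a priori continuity asked for by
   [block_bound]. *)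
have phi_le a : nc (phi a) <=
    (\sum_k \sum_l nc (wc k 0) * nc (v l 0) * normA (delta_munit k l))
      * normA a.
  rewrite (le_trans (nc_sum _ _ _)) // mulr_suml; apply: ler_sum => k _.
  rewrite Normc.normcM mulr_suml; apply: (@le_trans _ _ (nc (wc k 0) *
    \sum_l nc (v l 0 * haar (delta_munit k l ** a)))).
    by rewrite ler_wpM2l ?nc_ge0 // nc_sum.
  rewrite mulr_sumr; apply: ler_sum => l _; rewrite Normc.normcM -!mulrA.
  by rewrite !ler_wpM2l ?nc_ge0 // haarM_le.
have phi_blk c (y : 'M[C]_(n c)) :
    nc (phi (blk y)) <= (l2norm w * l2norm v) * predual_norm y.
  pose Z : 'M[C]_(n i) := \matrix_(k, m) \sum_p \sum_q y p q *
     proj i c (mxtens_index (k, p)) (mxtens_index (m, q)).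
  have haar_blk k l : haar (delta_munit k l ** blk y) = (Z *m gen_mx i) k l.
    rewrite mxE (lin_sum _ _ _ (haarM_linl _)); apply: eq_bigr => m _.
    rewrite (lin_Z _ _ (haarM_linl _)) mulrC; congr (_ * _).
    rewrite mxE (lin_sum _ _ _ (haarM_linr _)); apply: eq_bigr => p _.
    rewrite (lin_sum _ _ _ (haarM_linr _)); apply: eq_bigr => q _.
    by rewrite (lin_Z _ _ (haarM_linr _)) haar_munit.
  have -> : phi (blk y) = \sum_k wc k 0 * (Z *m (gen_mx i *m v)) k 0.
    apply: eq_bigr => k _; congr (_ * _); rewrite mulmxA mxE.
    by apply: eq_bigr => l _; rewrite haar_blk mulrC.
  apply: le_trans (cauchy_schwarz _ _) _; rewrite lwc -mulrA.
  rewrite ler_wpM2l ?l2norm_ge0 //.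
  have ni : 0 < (n i)%:R :> R.
    by rewrite ltr0n; have [] := Irr_irreducible hU i.
  have Zle u : l2norm (Z *m u) <= ((n i)%:R^-1 * opnorm y) * l2norm u.
    rewrite l2norm_leP; last by rewrite mulr_ge0 ?opnorm_ge0 // invr_ge0 ltW.
    have -> : real_complex R (((n i)%:R^-1 * opnorm y) ^+ 2)
        = (n i)%:R ^- 2 * real_complex R (opnorm y ^+ 2).
      rewrite exprMn rmorphM /= rmorphXn /= rmorphV ?unitfE ?gt_eqF //=.
      by rewrite rmorph_nat exprVn.
    have d_ge0 : 0 <= real_complex R (opnorm y ^+ 2).
      by rewrite -(rmorph0 (real_complex R)) lecR sqr_ge0.
    have hy u' : sqn (y *m u') <= real_complex R (opnorm y ^+ 2) * sqn u'.
      by rewrite -l2norm_leP ?opnorm_ge0 ?opnorm_ub.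
    exact: (triv_proj_bound hG hkap heps hU e0 na0 Ua0 irr0 dec u d_ge0 hy).
  apply: le_trans (Zle _) _.
  have := gen_bound v; rewrite -ler_pdivrMl // mulrC => hv.
  rewrite -mulrA mulrCA [leRHS]mulrC ler_pM ?opnorm_ge0 ?opnorm_predual //.
    by rewrite mulr_ge0 ?l2norm_ge0 ?invr_ge0 ?ltW.
  by rewrite mulrC.
have := block_bound (hA := hA) phi_lin phi_le _ phi_blk b.
rewrite phib sqn_l2norm mulr_ge0 ?l2norm_ge0 // => /(_ isT).
have -> : nc (real_complex R (l2norm w ^+ 2)) = l2norm w ^+ 2.
  apply: (@complexI R); rewrite -normC_nc ger0_norm //.
  by rewrite -(rmorph0 (real_complex R)) lecR sqr_ge0.
by rewrite expr2 -mulrA ler_pM2l // mulrC.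
Qed.

Definition deriv (a b : A) : C := pairing (Phi a) (deriv_dual b).

Lemma deriv_dual_linfty b : linfty (deriv_dual b).
Proof. by exists (normA b) => i; exact: deriv_dual_bound. Qed.

Lemma deriv_le a b : nc (deriv a b) <= normA a * normA b.
Proof.
have [_] := pairing_has_sum (Phi_l1 hA a) (deriv_dual_bound b).
by rewrite max_r // normA_ge0.
Qed.

Lemma deriv_munit i (k l : 'I_(n i)) b :
  deriv (munit k l) b = haar (delta_munit k l ** b).
Proof. by rewrite /deriv Phi_munit pairing_unitl mxE. Qed.

Lemma deriv_linl b : linear ((fun a => deriv a b) : A -> C^o).
Proof.
move=> c u v; rewrite /deriv (fa_linear hA) pairing_linl //.
- exact: (Phi_l1 hA).
- exact: (Phi_l1 hA).
- exact: deriv_dual_linfty.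
Qed.

Lemma deriv_linr a : linear ((fun b => deriv a b) : A -> C^o).
Proof.
move=> c u v; rewrite /deriv -pairing_linr //; last 3 first.
- exact: (Phi_l1 hA).
- exact: deriv_dual_linfty.
- exact: deriv_dual_linfty.
congr pairing; apply: functional_extensionality_dep => i.
by apply/matrixP => k l; rewrite !mxE haarM_linr.
Qed.

(** Each of the three terms is bounded by the product of the norms, whence the constant 3 in the
    continuity estimate; this reduces a and then b to matrix units, where [delta_leibniz]
    applies. *)
Lemma deriv_leibniz a b c :
  deriv (a ** b) c = deriv b (c ** a) + deriv a (b ** c).
Proof.
have mA : associative (@ba_mul C A) := @ba_mulA C A.
have bound u v w : nc (deriv (u ** v) w - (deriv v (w ** u) + deriv u (v ** w)))
    <= 3 * (normA u * normA v * normA w).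
  have -> : 3 = 1 + (1 + 1) :> R by ring.
  rewrite !mulrDl mul1r; apply: nc_sub_le.
    by rewrite (le_trans (deriv_le _ _)) // ler_wpM2r ?normA_ge0 ?(normAM hA).
  rewrite (le_trans (le_normcD _ _)) // lerD // (le_trans (deriv_le _ _)) //.
    rewrite (mulrC (normA u)) -mulrA ler_wpM2l ?normA_ge0 // mulrC.
    exact: (normAM hA).
  by rewrite -mulrA ler_wpM2l ?normA_ge0 // (normAM hA).
move: a; apply: (munit_ext (hA := hA) (K := 3 * (normA b * normA c))
  (f := fun a => deriv (a ** b) c)
  (g := fun a => deriv b (c ** a) + deriv a (b ** c))).
- by move=> d u v; rewrite (mull_lin b) deriv_linl.
- move=> d u v; rewrite (mulr_lin c) deriv_linr deriv_linl.
  by rewrite scalerDr addrACA.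
- move=> a; rewrite (_ : _ * normA a = 3 * (normA a * normA b * normA c)) //.
  by ring.
move=> i k l; move: b; apply: (munit_ext (hA := hA)
  (K := 3 * (normA (munit k l) * normA c))
  (f := fun b => deriv (munit k l ** b) c)
  (g := fun b => deriv b (c ** munit k l) + deriv (munit k l) (b ** c))).
- by move=> d u v; rewrite (mulr_lin (munit k l)) deriv_linl.
- move=> d u v; rewrite (mull_lin c) deriv_linr deriv_linl.
  by rewrite scalerDr addrACA.
- move=> b; rewrite (_ : _ * normA b =
    3 * (normA (munit k l) * normA b * normA c)) //.
  by ring.
move=> j p q; rewrite !deriv_munit (munitM_expand hD).
rewrite (lin_sum _ _ _ (deriv_linl c)).
transitivity (haar ((\sum_(i0 <- dual_supp D i j) \sum_r \sum_s
    dual_rho D i j r s (mxtens_index (k, p)) (mxtens_index (l, q))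
      *: @delta_munit i0 r s) ** c)).
  rewrite (lin_sum _ _ _ (haarM_linl c)); apply: eq_bigr => i0 _.
  rewrite (lin_sum _ _ _ (deriv_linl c)) (lin_sum _ _ _ (haarM_linl c)).
  apply: eq_bigr => r _.
  rewrite (lin_sum _ _ _ (deriv_linl c)) (lin_sum _ _ _ (haarM_linl c)).
  apply: eq_bigr => s _.
  by rewrite (lin_Z _ _ (deriv_linl c)) (lin_Z _ _ (haarM_linl c)) deriv_munit.
(* Of the two Leibniz terms, h(delta(a) b c) is already in place; the trace property turns h(a
   delta(b) c) into h(delta(b) c a). *)
rewrite delta_leibniz -[X in X + _]scale1r (mull_lin c) haar_linear scale1r.
rewrite addrC.
by rewrite -mA haar_trace -!mA.
Qed.

End Derivation.

(** * An sl_2-triple on every representation *)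

Section IsotropicSl2.
Variables (C : numClosedFieldType) (N : nat) (u w : 'cV[C]_N).
Hypotheses (uu : u^T *m u = 0) (ww : w^T *m w = 0) (wu : w^T *m u = 2%:M).

(** The standard sl_2-triple on the plane of u and w: h u = u, h w = - w, e w = u, f u = w. Isotropy
    lets it be written with e and f symmetric and h antisymmetric, as skew functionals require. *)
Definition iso_e : 'M[C]_N := 2^-1 *: (u *m u^T).
Definition iso_f : 'M[C]_N := 2^-1 *: (w *m w^T).
Definition iso_h : 'M[C]_N := 2^-1 *: (u *m w^T - w *m u^T).

Let two_neq0 : (2 : C) != 0. Proof. by rewrite pnatr_eq0. Qed.

Lemma iso_e_sym : iso_e + -1 *: iso_e^T = 0.
Proof. by rewrite /iso_e linearZ /= trmx_mul trmxK scaleN1r subrr. Qed.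

Lemma iso_f_sym : iso_f + -1 *: iso_f^T = 0.
Proof. by rewrite /iso_f linearZ /= trmx_mul trmxK scaleN1r subrr. Qed.

Lemma iso_h_antisym : iso_h + 1 *: iso_h^T = 0.
Proof.
have -> : iso_h^T = - iso_h.
  rewrite /iso_h linearZ /= -scalerN opprB; congr (_ *: _).
  by rewrite linearB /= !trmx_mul !trmxK.
by rewrite scale1r subrr.
Qed.

Let uw : u^T *m w = 2%:M.
Proof. by rewrite -[LHS]trmxK trmx_mul trmxK wu tr_scalar_mx. Qed.

Let rank1M (a b c d : 'cV[C]_N) s : b^T *m c = s%:M ->
  (a *m b^T) *m (c *m d^T) = s *: (a *m d^T).
Proof. by move=> h; rewrite mulmxA -(mulmxA a) h mul_mx_scalar scalemxAl. Qed.

Let uu0 : u^T *m u = 0%:M. Proof. by rewrite uu raddf0. Qed.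
Let ww0 : w^T *m w = 0%:M. Proof. by rewrite ww raddf0. Qed.

Lemma iso_he : iso_h *m iso_e - iso_e *m iso_h = 2 *: iso_e.
Proof.
rewrite /iso_h /iso_e -!scalemxAl -!scalemxAr mulmxBl mulmxBr.
rewrite !(rank1M _ _ uu0, rank1M _ _ wu, rank1M _ _ uw).
apply/matrixP => i j; rewrite !mxE; by field.
Qed.

Lemma iso_hf : iso_h *m iso_f - iso_f *m iso_h = - 2 *: iso_f.
Proof.
rewrite /iso_h /iso_f -!scalemxAl -!scalemxAr mulmxBl mulmxBr.
rewrite !(rank1M _ _ ww0, rank1M _ _ wu, rank1M _ _ uw).
apply/matrixP => i j; rewrite !mxE; by field.
Qed.

Lemma iso_ef : iso_e *m iso_f - iso_f *m iso_e = iso_h.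
Proof.
rewrite /iso_h /iso_f /iso_e -!scalemxAl -!scalemxAr.
rewrite !(rank1M _ _ wu, rank1M _ _ uw).
apply/matrixP => i j; rewrite !mxE; by field.
Qed.

End IsotropicSl2.

Section Sl2Representation.
Variables (C : numClosedFieldType) (N : nat) (G : quantumGroup C).
Variables (x : 'M[Pol G]_N) (hG : is_free_orthogonal x).
Variables (kap : Pol G -> Pol G) (hkap : is_kappa x kap).
Variables (eps : Pol G -> C^o) (heps : is_counit x eps).

Lemma skewZ s M (f : Pol G -> C^o) c : is_skew x eps s M f ->
  is_skew x eps s (c *: M) (fun a => c *: f a).
Proof.
move=> [lf f1 fr]; split; first exact: linear_Z.
  by rewrite f1 scaler0.
move=> j k b; rewrite fr mxE /GRing.scale /=; ring.
Qed.

Variables (u w : 'cV[C]_N).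
Hypotheses (uu : u^T *m u = 0) (ww : w^T *m w = 0) (wu : w^T *m u = 2%:M).
Hypothesis uw_conj : forall j, (u j 0)^* = w j 0.
Variables (eta : Pol G -> C^o) (heta : is_skew x eps 1 (iso_h u w) eta).
Variables (n : nat) (V : 'M[Pol G]_n) (hV : is_unitary_rep V).

(** By uniqueness of skew functionals, eta and the twisted functionals of e and f take on V values
    that form an sl_2-triple. Since w is the conjugate of u, the matrix eta(V) is hermitian, so its
    norm is governed by its eigenvalues. *)
Lemma sl2_rep_bound (v : 'cV[C]_n) :
  sqn (map_mx eta V *m v) <= n%:R ^+ 2 * sqn v.
Proof.
have N1 : (-1) * (-1) = 1 :> C by rewrite mulrNN mulr1.
have [fe he] := skew_exists hG heps N1 (iso_e_sym u).
have [ff hf] := skew_exists hG heps N1 (iso_f_sym w).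
set H := map_mx eta V; pose E := map_mx fe V; pose F := map_mx ff V.
have Zmx c (f : Pol G -> C^o) :
    map_mx (fun a => c *: f a : C) V = c *: map_mx f V.
  by apply/matrixP => i j; rewrite !mxE.
have hHE : H *m E - E *m H = 2 *: E.
  rewrite /E -Zmx; apply/esym/(rep_skew_comm hG heps hV heta he).
  by rewrite (iso_he uu wu) mul1r; exact: skewZ.
have hHF : H *m F - F *m H = - 2 *: F.
  rewrite /F -Zmx; apply/esym/(rep_skew_comm hG heps hV heta hf).
  by rewrite (iso_hf ww wu) mul1r; exact: skewZ.
have hEF : E *m F - F *m E = H.
  by rewrite -(rep_skew_comm hG heps hV he hf (h := eta)) // (iso_ef wu) N1.
apply: sqn_hermitian_bound => [|a ra ea]; last first.
  exact: (sl2_eigenvalue_bound hHE hHF hEF ra ea).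
apply/matrixP => i j; rewrite !mxE.
apply: (rep_skew_herm hG hkap heps hV heta); first exact: rmorph1.
move=> k l; rewrite !mxE !big_ord1 !mxE rmorphM rmorphB !rmorphM /=.
rewrite -!uw_conj !conjCK fmorphV rmorph_nat.
by ring.
Qed.

End Sl2Representation.

Section RankTwoVectors.
Variables (C : numClosedFieldType) (N : nat) (i0 i1 : 'I_N).
Hypothesis i01 : i0 != i1.

(** For c = 'i and c = - 'i these vectors are conjugate to each other and isotropic for the bilinear
    form; the resulting h has entries - 'i and 'i off the diagonal. *)
Definition iso_vec (c : C) : 'cV[C]_N := delta_mx i0 0 + c *: delta_mx i1 0.

Lemma iso_vecM c d : (iso_vec c)^T *m iso_vec d = (1 + c * d)%:M.
Proof.
have -> : (iso_vec c)^T = delta_mx 0 i0 + c *: delta_mx 0 i1.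
  by apply/matrixP => i j; rewrite !mxE !(andbC (j == _)).
rewrite /iso_vec mulmxDl !mulmxDr.
rewrite -!scalemxAl -!scalemxAr !mul_delta_mx_cond !eqxx (eq_sym i1).
rewrite (negPf i01) !mulr0n !mulr1n !scaler0 addr0 add0r scalerA.
by apply/matrixP => i j; rewrite !ord1 !mxE !eqxx; ring.
Qed.

Lemma iso_vec_conj j : (iso_vec 'i j 0)^* = iso_vec (- 'i) j 0.
Proof. by rewrite !mxE rmorphD rmorphM /= conjCi !rmorph_nat. Qed.

Lemma iso_vec_isotropic : [/\ (iso_vec 'i)^T *m iso_vec 'i = 0,
  (iso_vec (- 'i))^T *m iso_vec (- 'i) = 0
  & (iso_vec (- 'i))^T *m iso_vec 'i = 2%:M].
Proof.
have ii : 'i * 'i = -1 :> C by rewrite -expr2 sqrCi.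
by rewrite !iso_vecM mulrNN mulNr ii subrr opprK raddf0.
Qed.

Lemma iso_h_neq0 : iso_h (iso_vec 'i) (iso_vec (- 'i)) i1 i0 != 0.
Proof.
have two_neq0 : (2 : C) != 0 by rewrite pnatr_eq0.
have i10 : (i1 == i0) = false by rewrite eq_sym (negPf i01).
rewrite !mxE !big_ord1 !mxE !eqxx i10 (negPf i01) /=.
have -> : 2^-1 * ((0 + 'i * 1) * (1 + - 'i * 0) - (0 + - 'i * 1) * (1 + 'i * 0))
    = 'i :> C by field.
exact: neq0Ci.
Qed.

End RankTwoVectors.

Section FourierAlgebraProducts.
Variables (R : realType) (G : quantumGroup R[i]).
Local Notation C := R[i].
Variables (I : choiceType) (n : I -> nat).
Variable U : forall alpha, 'M[Pol G]_(n alpha).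
Variables (D : mxfamily R n -> mxfamily R (dim2 n)).
Hypothesis hD : is_dual_coproduct U D.
Variables (A : banachAlgebra C) (Phi : A -> mxfamily R n).
Hypothesis hA : is_Fourier_algebra D Phi.
Local Notation "a ** b" := (ba_mul a b) (at level 40).

Lemma blkM b c (y : 'M[C]_(n b)) (z : 'M[C]_(n c)) i (r s : 'I_(n i)) :
  Phi (blk hA y ** blk hA z) i r s = \sum_k \sum_l \sum_p \sum_q
    y k l * z p q
      * dual_rho D b c r s (mxtens_index (k, p)) (mxtens_index (l, q)).
Proof.
have lc := coor_linear hA r s.
have lm a : linear (fun a' => Phi (a' ** a) i r s : C^o).
  by move=> d u v; rewrite (mull_lin a) lc.
have lm' a : linear (fun a' => Phi (a ** a') i r s : C^o).
  by move=> d u v; rewrite (mulr_lin a) lc.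
rewrite (lin_sum _ _ _ (lm _)); apply: eq_bigr => k _.
rewrite (lin_sum _ _ _ (lm _)); apply: eq_bigr => l _.
rewrite (lin_Z _ _ (lm _)) (lin_sum _ _ _ (lm' _)) scaler_sumr.
apply: eq_bigr => p _; rewrite (lin_sum _ _ _ (lm' _)) scaler_sumr.
apply: eq_bigr => q _.
by rewrite (lin_Z _ _ (lm' _)) munitM /GRing.scale /= mulrA.
Qed.

Lemma bounded_dual (f : A -> C) (K : R) : linear (f : A -> C^o) ->
  (forall a, Normc.normc (f a) <= K * normA Phi a) -> dual f.
Proof.
move=> lf hK; split=> //.
apply: (@bounded_linear_continuous _ _ _ (linear_of lf)).
apply/linear_boundedP; exists (real_complex R K).
split; first by rewrite complex_real.
move=> r Kr a; apply: le_trans (ler_wpM2r (normr_ge0 a) (ltW Kr)).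
by rewrite (normAE hA) [leLHS]normC_nc -rmorphM lecR hK.
Qed.

End FourierAlgebraProducts.

(** * The derivation is not inner *)

Section NotInner.
Variables (R : realType) (G : quantumGroup R[i]).
Local Notation C := R[i].
Variables (N : nat) (x : 'M[Pol G]_N) (hG : is_free_orthogonal x).
Variables (kap : Pol G -> Pol G) (hkap : is_kappa x kap).
Variables (eps : Pol G -> C^o) (heps : is_counit x eps).
Variables (I : choiceType) (n : I -> nat).
Variables (U : forall alpha, 'M[Pol G]_(n alpha)) (hU : is_Irr U).
Variables (a0 : I) (e0 : 'I_(n a0)).
Hypothesis na0 : n a0 = 1%N.
Hypothesis Ua0 : forall i j, U a0 i j = 1.
Hypothesis irr0 : forall a v, a != a0 -> inv_vec (U a) v -> v = 0.
Variables (D : mxfamily R n -> mxfamily R (dim2 n)).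
Hypothesis hD : is_dual_coproduct U D.
Variables (A : banachAlgebra C) (Phi : A -> mxfamily R n).
Hypothesis hA : is_Fourier_algebra D Phi.
Local Notation "a ** b" := (ba_mul a b) (at level 40).
Local Notation munit := (munit hA).
Local Notation blk := (blk hA).

Variables (a1 : I) (T : 'M[C]_(N, n a1)) (S : 'M[C]_(n a1, N)).
Hypotheses (TS : T *m S = 1%:M) (ST : S *m T = 1%:M).
Hypothesis TU : intertwiner (U a1) x T.

(* The element of the Fourier algebra whose Fourier transform is [x j k]. *)
Definition gen_elt (j k : 'I_N) : A := blk (\matrix_(p, q) (T j p * S q k)).

(** The invariant vector sum_j e_j (x) e_j of x (x) x, transported by T to U a1 (x) U a1. *)
Let omega : 'rV[C]_(n a1 * n a1) :=
  \row_a \sum_j T j (mxtens_unindex a).1 * T j (mxtens_unindex a).2.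

Lemma omega_inv : cmx (Pol G) omega *m (U a1 *t U a1) = cmx (Pol G) omega.
Proof.
have TUx j r : \sum_p T j p *: U a1 p r = \sum_l T l r *: x j l.
  have /matrixP/(_ j r) := TU; rewrite !mxE.
  under eq_bigr do rewrite mxE mulr_algl.
  by under [X in _ = X -> _]eq_bigr do rewrite mxE mulr_algr.
apply/matrixP => i a; rewrite ord1 {i}; case: (mxtens_indexP a) => r s.
rewrite mxE sum_mxtens.
transitivity (\sum_j (\sum_p T j p *: U a1 p r) * (\sum_p T j p *: U a1 p s)).
  rewrite [RHS](eq_bigr (fun j => \sum_p \sum_q
      (T j p * T j q) *: (U a1 p r * U a1 q s))); last first.
    move=> j _; rewrite mulr_suml; apply: eq_bigr => p _.
    rewrite mulr_sumr; apply: eq_bigr => q _.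
    by rewrite -scalerAl -scalerAr scalerA.
  rewrite [RHS]exchange_big; apply: eq_bigr => p _ /=.
  rewrite [RHS]exchange_big; apply: eq_bigr => q _ /=.
  rewrite tensmxE !mxE mxtens_indexK /= mulr_algl scaler_suml.
  by [].
rewrite (eq_bigr (fun j => \sum_l \sum_m
    (T l r * T m s) *: (x j l * x j m))); last first.
  move=> j _; rewrite !TUx mulr_suml; apply: eq_bigr => p _.
  rewrite mulr_sumr; apply: eq_bigr => q _.
  by rewrite -scalerAl -scalerAr scalerA.
rewrite exchange_big /= !mxE mxtens_indexK /= scaler_suml.
apply: eq_bigr => l _; rewrite exchange_big /=.
transitivity (\sum_m (l == m)%:R *: ((T l r * T m s)%:A : Pol G)).
  apply: eq_bigr => m _; rewrite -scaler_sumr (fo_col hG).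
  by case: (l == m); rewrite ?scale1r ?scale0r ?scaler0.
by rewrite sum_deltaZ.
Qed.

Let dec11 := dual_decomposition hD a1 a1.
Let tu := tens_unitary (Irr_unitary hU a1) (Irr_unitary hU a1).

Lemma omega_inv_col : (U a1 *t U a1) *m cmx (Pol G) (adjm omega)
  = cmx (Pol G) (adjm omega).
Proof.
by apply/inv_vecP/(inv_row_adj tu); rewrite adjmK omega_inv.
Qed.

Lemma omega_rho i (r s : 'I_(n i)) : i != a0 ->
  omega *m dual_rho D a1 a1 r s = 0.
Proof.
move=> ia0; have := dec_inv dec11 irr0 s r ia0 omega_inv_col.
move=> /(congr1 (@adjm C _ _)); rewrite adjmM adjmK (dec_adj dec11) => ->.
by apply/matrixP => k l; rewrite !mxE rmorph0.
Qed.

Lemma omega_proj : omega *m dual_rho D a1 a1 e0 e0 = omega.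
Proof.
have := omega_inv_col.
move/(triv_projP hG heps hU e0 na0 Ua0 irr0 (dual_decomposition hD)).
move=> /(congr1 (@adjm C _ _)); rewrite adjmM adjmK.
by rewrite [adjm (triv_proj _ _ _ _)](dec_adj dec11).
Qed.

(** The relation sum_j x j k * x j q = (k == q), now inside A. The coordinates of the left side are
    omega rho sigma; invariance of omega kills every block except the trivial one, whose projection
    fixes omega. *)
Lemma gen_elt_col k q :
  \sum_j gen_elt j k ** gen_elt j q = (k == q)%:R *: munit e0 e0.
Proof.
apply: (Phi_inj hA); apply: functional_extensionality_dep => i.
apply/matrixP => r s; have lc := coor_linear hA r s.
pose sigma : 'cV[C]_(n a1 * n a1) :=
  \col_a (S (mxtens_unindex a).1 k * S (mxtens_unindex a).2 q).
rewrite (lin_Z _ _ lc) (lin_sum _ _ _ lc).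
transitivity ((omega *m dual_rho D a1 a1 r s *m sigma) 0 0).
  rewrite -mulmxA mxE sum_mxtens.
  under eq_bigr do rewrite blkM.
  rewrite exchange_big; apply: eq_bigr => p _ /=.
  under eq_bigr do rewrite exchange_big.
  rewrite exchange_big; apply: eq_bigr => p2 _ /=.
  rewrite !mxE mxtens_indexK /= sum_mxtens mulr_suml.
  apply: eq_bigr => j _; rewrite mulr_sumr; apply: eq_bigr => q1 _.
  rewrite mulr_sumr; apply: eq_bigr => q2 _.
  by rewrite !mxE !mxtens_indexK /=; ring.
have [ia0|ia0] := eqVneq i a0; last first.
  rewrite omega_rho // mul0mx mxE Phi_munit mxunit_out ?mxE ?scaler0 //.
  by rewrite eq_sym.
case: _ / (esym ia0) r s lc => r s _.
rewrite (ord_a0 e0 na0 r) (ord_a0 e0 na0 s) omega_proj Phi_munit mxunit_in.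
rewrite !mxE !eqxx [RHS]mulr1 sum_mxtens.
have /matrixP TS' := TS.
transitivity (\sum_j (\sum_p T j p * S p k) * (\sum_p T j p * S p q)).
  rewrite [RHS](eq_bigr (fun j => \sum_p \sum_p2
    (T j p * S p k) * (T j p2 * S p2 q))); last first.
    by move=> j _; rewrite mulr_suml; apply: eq_bigr => p _; rewrite mulr_sumr.
  rewrite [RHS]exchange_big; apply: eq_bigr => p _ /=.
  rewrite [RHS]exchange_big; apply: eq_bigr => p2 _ /=.
  rewrite !mxE !mxtens_indexK /= mulr_suml; apply: eq_bigr => j _.
  by ring.
transitivity (\sum_j (j == k)%:R * (j == q)%:R : C).
  apply: eq_bigr => j _; have := TS' j k; have := TS' j q.
  by rewrite !mxE => -> ->.
under eq_bigr do rewrite eq_sym.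
by rewrite sum_deltal.
Qed.

Variables (M : 'M[C]_N) (eta : Pol G -> C^o) (heta : is_skew x eps 1 M eta).
Hypothesis gen_bound : forall i v,
  l2norm (gen_mx U eta i *m v) <= (n i)%:R * l2norm v.
Local Notation deriv := (deriv U e0 hA eta).

(** eta applied to T U = x T, transported by S, the inverse of T. *)
Lemma gen_mx_gen : gen_mx U eta a1 *m S = S *m M.
Proof.
have [le _ _] := heta.
have TH : T *m gen_mx U eta a1 = M *m T.
  apply/matrixP => j r; have /matrixP/(_ j r)/(congr1 eta) := TU.
  rewrite !mxE !(lin_sum _ _ _ le).
  under eq_bigr do rewrite mxE mulr_algl (lin_Z _ _ le).
  under [X in _ = X -> _]eq_bigr do
    rewrite mxE mulr_algr (lin_Z _ _ le) (skew_gen heps _ _ heta).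
  move=> E; transitivity (\sum_p T j p *: eta (U a1 p r)).
    by apply: eq_bigr => p _; rewrite mxE.
  by rewrite E; apply: eq_bigr => l _; rewrite mulrC.
by rewrite -[LHS]mul1mx -ST -mulmxA (mulmxA T) TH -mulmxA TS mulmx1.
Qed.

(** This is delta(x j k) = sum_l M l k x j l, paired with b. *)
Lemma deriv_gen_elt j k b :
  deriv (gen_elt j k) b = \sum_l M l k * haar e0 Phi (gen_elt j l ** b).
Proof.
have ld := deriv_linl hG hkap heps hU e0 na0 Ua0 irr0 hD hA gen_bound.
have lh := haarM_linl e0 hA.
have /matrixP HS := gen_mx_gen.
rewrite (lin_sum _ _ _ (ld b)).
transitivity (\sum_p \sum_m (T j p * (S *m M) m k)
    *: haar e0 Phi (munit p m ** b)).
  apply: eq_bigr => p _; rewrite (lin_sum _ _ _ (ld b)).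
  rewrite (eq_bigr (fun q => \sum_m (T j p * (gen_mx U eta a1 m q * S q k))
    *: haar e0 Phi (munit p m ** b))); last first.
    move=> q _; rewrite (lin_Z _ _ (ld b)) deriv_munit mxE.
    rewrite (lin_sum _ _ _ (lh b)) scaler_sumr; apply: eq_bigr => m _.
    by rewrite (lin_Z _ _ (lh b)) scalerA; congr (_ *: _); ring.
  rewrite exchange_big; apply: eq_bigr => m _ /=.
  by rewrite -scaler_suml -mulr_sumr -HS mxE.
rewrite [RHS](eq_bigr (fun l => \sum_p \sum_m
    (T j p * (S m l * M l k)) *: haar e0 Phi (munit p m ** b))); last first.
  move=> l _; rewrite (lin_sum _ _ _ (lh b)) mulr_sumr; apply: eq_bigr => p _.
  rewrite (lin_sum _ _ _ (lh b)) mulr_sumr; apply: eq_bigr => m _.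
  by rewrite (lin_Z _ _ (lh b)) mxE /GRing.scale /=; ring.
rewrite [RHS]exchange_big; apply: eq_bigr => p _ /=.
rewrite [RHS]exchange_big; apply: eq_bigr => m _ /=.
by rewrite -scaler_suml -mulr_sumr mxE.
Qed.

Lemma deriv_gen_elt_sum k q :
  \sum_j deriv (gen_elt j k) (gen_elt j q) = M q k.
Proof.
have lh := haar_linear e0 hA.
under eq_bigr do rewrite deriv_gen_elt.
rewrite exchange_big /=.
transitivity (\sum_l M l k * (l == q)%:R); last exact: sum_deltar.
apply: eq_bigr => l _; rewrite -mulr_sumr -(lin_sum _ _ _ lh) gen_elt_col.
rewrite (lin_Z _ _ lh) /haar Phi_munit mxunit_in mxE !eqxx.
by rewrite [X in _ * X]mulr1.
Qed.

Lemma deriv_not_inner q k : M q k != 0 -> ~ inner_derivation deriv.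
Proof.
move=> /eqP Mqk [Y [lY _] hY]; apply: Mqk; rewrite -deriv_gen_elt_sum.
under eq_bigr do rewrite hY /dual_lact /dual_ract.
rewrite sumrB -!(lin_sum _ _ _ lY) !gen_elt_col eq_sym.
by rewrite subrr.
Qed.

Lemma deriv_bounded : bounded_derivation deriv.
Proof.
have ll := deriv_linl hG hkap heps hU e0 na0 Ua0 irr0 hD hA gen_bound.
have lr := deriv_linr hG hkap heps hU e0 na0 Ua0 irr0 hD hA gen_bound.
have le := deriv_le hG hkap heps hU e0 na0 Ua0 irr0 hD hA gen_bound.
split.
- move=> a; apply: (bounded_dual hA (K := normA Phi a)); first exact: lr.
  exact: le.
- by move=> c a b y; rewrite ll.
- exists 1 => a y; rewrite mul1r !(normAE hA) normC_nc -rmorphM lecR.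
  exact: le.
- move=> a b y; rewrite /dual_lact /dual_ract.
  exact: (deriv_leibniz hG hkap heps hU e0 na0 Ua0 irr0 hD hA heta gen_bound).
Qed.

End NotInner.

Theorem theorem5p8 (R : realType) (N : nat) (hN : (2 <= N)%N)
  (* the quantum group O_N^+ *)
  (G : quantumGroup R[i]) (x : 'M[Pol G]_N) (hG : is_free_orthogonal x)
  (* unitary representatives of Irr(O_N^+) *)
  (I : choiceType) (n : I -> nat) (U : forall alpha, 'M[Pol G]_(n alpha))
  (hU : is_Irr U)
  (* the dual coproduct and the Fourier algebra A = A(O_N^+) *)
  (D : mxfamily R n -> mxfamily R (dim2 n)) (hD : is_dual_coproduct U D)
  (A : banachAlgebra R[i]) (Phi : A -> mxfamily R n)
  (hA : is_Fourier_algebra D Phi) :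
  ~ weakly_amenable A.
Proof.
have N_gt0 : (0 < N)%N by exact: ltnW.
pose i0 : 'I_N := Ordinal N_gt0; pose i1 : 'I_N := Ordinal hN.
have i01 : i0 != i1 by [].
have [kap hkap] := kappa_exists hG.
(* Only the counit is kept here, so the zero matrix [iso_h 0 0] serves as M. *)
have [eps [_ [heps _]]] := skew_exists0 hG (mulr1 (1 : R[i]))
  (iso_h_antisym 0 0).
have [a0 [na0 Ua0 irr0]] := triv_index hU.
have e0 : 'I_(n a0) by rewrite na0; exact: ord0.
have [a1 [T [S [TS ST TU]]]] := Irr_exhaustive hU (fo_rep hG)
  (fo_irreducible hG heps N_gt0).
pose u := iso_vec i0 i1 ('i : R[i]); pose w := iso_vec i0 i1 (- 'i : R[i]).
have [uu ww wu] := iso_vec_isotropic R[i] i01.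
have uw_conj := @iso_vec_conj R[i] N i0 i1.
have [eta heta] := skew_exists hG heps (mulr1 1) (iso_h_antisym u w).
have gen_bound i v : l2norm (gen_mx U eta i *m v) <= (n i)%:R * l2norm v.
  rewrite l2norm_leP // rmorphXn /= rmorph_nat.
  exact: (sl2_rep_bound hG hkap heps uu ww wu uw_conj heta (Irr_unitary hU i)).
move=> /(_ _
  (deriv_bounded hG hkap heps hU e0 na0 Ua0 irr0 hD hA heta gen_bound)).
apply: (deriv_not_inner hG hkap heps hU na0 Ua0 irr0 hD TS ST TU heta gen_bound
  (q := i1) (k := i0)).
exact: iso_h_neq0.
Qed.
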